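(* Let $\Gamma$ be a sofic group, let $n\ge 1$, and let $A\in M_n(\overline{\mathbb{Q}}\Gamma)$, where $\overline{\mathbb{Q}}$ is the field of algebraic numbers. Let $\lambda(A)$ be the bounded operator on the Hilbert space $(\ell^2\Gamma)^{\oplus n}$ given by left convolution by $A$. Write $A=\sum_{g\in\Gamma}A_g\,g$ with coefficient matrices $A_g\in M_n(\overline{\mathbb{Q}})$. Then: (i) All eigenvalues of $\lambda(A)$ are algebraic numbers. (ii) If all entries of the coefficient matrices $A_g$ are in the ring $\mathcal{O}$ of algebraic integers, then the eigenvalues of $\lambda(A)$ are algebraic integers. (iii) If all entries of the coefficient matrices $A_g$ are in $\mathbb{Q}$, then for every eigenvalue of $\lambda(A)$ all its Galois conjugates are also eigenvalues of $\lambda(A)$, and the corresponding eigenspaces have the same von Neumann dimension.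
   Context: $\Gamma$ is a discrete group. For $\sigma\in S_m$ let $\#_1\sigma$ denote the number of fixed points of $\sigma$. $\Gamma$ is called sofic if for every real $0<\epsilon<1$ and every finite subset $F\subseteq\Gamma$ there exist a natural number $m$ and a map $\phi\colon\Gamma\to S_m$ such that: (1) $\#_1\big(\phi(g)\phi(h)\phi(gh)^{-1}\big)\ge(1-\epsilon)m$ for all $g,h\in F$; (2) $\phi(e)=e$; (3) $\#_1\phi(g)\le\epsilon m$ for all $e\ne g\in F$. $\ell^2\Gamma$ is the Hilbert space with orthonormal basis $\Gamma$; $L\Gamma$ is the von Neumann algebra of bounded operators on $\ell^2\Gamma$ commuting with the right convolution action of $\Gamma$, with trace $\tau(T)=\langle T\delta_e,\delta_e\rangle$. An eigenvalue of $\lambda(A)$ is $\alpha\in\mathbb{C}$ with $\ker(\alpha\cdot\mathrm{id}-\lambda(A))\neq 0$ in $(\ell^2\Gamma)^{\oplus n}$. The von Neumann dimension $\dim_{L\Gamma}V$ of a closed right-$\Gamma$-invariant subspace $V\subseteq(\ell^2\Gamma)^{\oplus n}$ is $\sum_{i=1}^n\tau(P_{ii})$, where $P=(P_{ij})\in M_n(L\Gamma)$ is the orthogonal projection onto $V$. The Galois conjugates of an algebraic number are the complex roots of its minimal polynomial over $\mathbb{Q}$. *)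

(* Defs.v *)
From HB Require Import structures.
From mathcomp Require Import all_boot all_order all_fingroup all_algebra finmap.
From mathcomp Require Import all_classical all_reals all_analysis.
From mathcomp Require Export complex.

Set Implicit Arguments.
Unset Strict Implicit.
Unset Printing Implicit Defensive.

Import Order.TTheory GRing.Theory Num.Theory.

Local Open Scope classical_set_scope.
Local Open Scope ring_scope.

Definition fixpoints (m : nat) (s : 'S_m) : nat := #|[pred i | s i == i]|.

(* The product in ['S_m] is [(s * t) i = t (s i)], so the permutation below is
   the composition [phi g \o phi h \o (phi (g h))^-1].  The bound [0 < m] is
   needed: for [m = 0] all the conditions hold trivially. *)
Definition sofic (R : realType) (G : groupType) : Prop :=
  forall (eps : R) (F : {fset G}), 0 < eps -> eps < 1 ->
  exists (m : nat) (phi : G -> 'S_m),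
    [/\ (0 < m)%N,
        forall g h, g \in F -> h \in F ->
          (1 - eps) * m%:R <=
            (fixpoints ((phi (g * h)%g)^-1 * phi h * phi g)%g)%:R,
        phi 1%g = 1%g &
        forall g, g \in F -> g != 1%g -> (fixpoints (phi g))%:R <= eps * m%:R].

(* The elements of the group ring [K G], as finitely supported functions; the
   product of [K G] is not needed, only its action by left convolution. *)
Definition group_ring (K : nzRingType) (G : groupType) : Type :=
  {fsfun G -> K with 0}.

Section GroupRingOperators.
Variables (R : realType) (G : groupType).
Local Notation C := R[i].

(* Unordered sums over [G] of absolutely summable families. *)
Definition rsum (f : G -> R) : R :=
  fine (\esum_(g in [set: G]) (EFin \o f)^\+ g
        - \esum_(g in [set: G]) (EFin \o f)^\- g)%E.

Definition csum (f : G -> C) : C :=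
  Complex (rsum (fun g => complex.Re (f g))) (rsum (fun g => complex.Im (f g))).

Definition l2 : set (G -> C) :=
  [set x | (\esum_(g in [set: G]) (Normc.normc (x g) ^+ 2)%:E < +oo)%E].

Definition l2_dot (x y : G -> C) : C := csum (fun g => x g * conjc (y g)).

Definition delta (g : G) : G -> C := fun h => (h == g)%:R.

Definition trace (T : (G -> C) -> (G -> C)) : C :=
  l2_dot (T (delta 1%g)) (delta 1%g).

Section Power.
Variable n : nat.

Definition l2n : set ('I_n -> G -> C) := [set x | forall i, l2 (x i)].

Definition l2n_dot (x y : 'I_n -> G -> C) : C := \sum_i l2_dot (x i) (y i).

(* The value at [x] of the orthogonal projection onto the closed subspace [V]
   of [l2n]: the unique [y] in [V] such that [x - y] is orthogonal to [V]. *)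
Definition orth_proj (V : set ('I_n -> G -> C)) (x : 'I_n -> G -> C) :
    'I_n -> G -> C :=
  xget 0 [set y | V y /\ forall v, V v -> l2n_dot (x - y) v = 0].

Definition op_entry (P : ('I_n -> G -> C) -> ('I_n -> G -> C)) (i j : 'I_n) :
    (G -> C) -> (G -> C) :=
  fun f => P (fun k => if k == j then f else 0) i.

Definition vN_dim (V : set ('I_n -> G -> C)) : C :=
  \sum_i trace (op_entry (orth_proj V) i i).

Definition coef_mx (A : 'M[group_ring C G]_n) (g : G) : 'M[C]_n :=
  \matrix_(i, j) A i j g.

Definition lambda (A : 'M[group_ring C G]_n) (x : 'I_n -> G -> C) :
    'I_n -> G -> C :=
  fun i g => \sum_j \sum_(h <- finsupp (A i j)) A i j h * x j (h^-1 * g)%g.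

Definition lambda_eigenspace (A : 'M[group_ring C G]_n) (a : C) :
    set ('I_n -> G -> C) :=
  [set x | l2n x /\ forall i g, a * x i g - lambda A x i g = 0].

Definition lambda_eigenvalue (A : 'M[group_ring C G]_n) (a : C) : Prop :=
  exists2 x, lambda_eigenspace A a x & x <> 0.

End Power.
End GroupRingOperators.

Definition algebraic_number (R : realType) (a : R[i]) : Prop :=
  algebraicOver (ratr : rat -> R[i]) a.

Definition algebraic_integer (R : realType) (a : R[i]) : Prop :=
  integralOver (intr : int -> R[i]) a.

Definition is_min_poly (R : realType) (a : R[i]) (p : {poly rat}) : Prop :=
  [/\ p \is monic, root (map_poly ratr p) a &
      forall q : {poly rat}, q != 0 -> root (map_poly ratr q) a ->
        (size p <= size q)%N].

Definition galois_conjugate (R : realType) (a b : R[i]) : Prop :=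
  exists2 p : {poly rat}, is_min_poly a p & root (map_poly ratr p) b.

(* Main.v *)
Require Import Defs.
From HB Require Import structures.
From mathcomp Require Import all_boot all_order all_fingroup all_algebra finmap.
From mathcomp Require Import cyclic separable cyclotomic.
From mathcomp Require Import all_classical all_reals all_analysis.
From mathcomp Require Import complex ring lra zify.

(** Let B = a - A, seen as an operator on square-summable vectors, and let
    T = 1 - c B^* B with c > 0 so small that 0 <= T <= 1.  The powers of T
    decrease to the orthogonal projection onto the kernel of B, so the von
    Neumann dimension of the eigenspace of a is the limit over r of the sum
    over i of <T^(2r) d_i, d_i>, where d_1, ..., d_n are the standard vectors
    at the unit of the group ([vN_dim_kernel]).  For a given r this sum involves
    finitely many elements of the group.  Replacing every group element by the
    permutation that a sofic approximation phi : G -> S_m assigns to it turns B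
    into a square matrix B_m of size d = nm, and the sum above becomes, up to
    a small error, 1 / m times the trace of the same power of 1 - c B_m B_m^*
    ([trace_transfer]).  If s runs over the squares of the singular values of
    B_m, that trace is the sum of the (1 - c s)^(2r): it is at least the nullity
    of B_m, and for large r it exceeds the nullity by little more than the
    number of s in the interval ]0, e] ([trace_exp_le_ker]).

    The heart of the matter is a bound on the number of small s that does not
    depend on m.  Assume that A has integer coefficients, so that B_m = a - A_m
    for an integer matrix A_m whose norm is bounded independently of m.

    - If a is an algebraic integer, then few s lie in ]0, e]
      ([few_small_singular_values_at_integer]).  A nonzero minor of B_m whose
      size is the rank of B_m is the value at a of an integer polynomial.  The
      product of the nonzero values of this polynomial at the roots of a monic
      integer polynomial that vanishes at a has modulus at least 1, and all its
      factors are at most exponential in d; hence the value at a is bounded below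
      by some K^(-d).  Each s in ]0, e] contributes a factor e to an
      upper bound for the square of that minor.

    - If a is not an algebraic integer, then few s lie in [0, e]
      ([few_small_singular_values_off_integers]).  By the pigeonhole principle
      there is an integer polynomial f with |f| <= X on a disc containing the
      eigenvalues of every A_m and |f| <= X^(-Q) near a, and since a is not an
      eigenvalue of A_m the product of the nonzero values of f at the
      eigenvalues of A_m shows that at most d / Q of them lie near a
      ([few_eigenvalues_near_nonintegral]).  So the characteristic polynomial of
      A_m is not too small at some point w of a small circle around a
      ([max_on_circle_ge]), whereas many small singular values of a - A_m would
      make w - A_m contract a large subspace and its determinant tiny
      ([det_le_small_space]).

    If a is an eigenvalue, the sum above stays bounded away from 0
    ([ralpha_lower]), so the second bound shows that a is an algebraic integer
    when A has integer coefficients ([eigenvalue_integral]).  Coefficients that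
    are algebraic integers act on a finitely generated abelian group through
    integer matrices with a common eigenvector ([common_integral_module]), and
    tensoring with that eigenvector reduces this case to integer coefficients
    ([integral_eigenvalue]).  Multiplying A by a suitable integer then settles
    algebraic coefficients, and it turns rational coefficients into integers.
    For integer coefficients the nullity of a - A_m is decided by which integer
    polynomials vanish at a, so it is the same for conjugate numbers; by the
    first bound this equality passes to the limit ([sum_alpha_lim_conjugate]).
    So the eigenspaces of conjugate numbers have equal dimensions, and when one
    of them is nonzero so is the other. *)

Set Implicit Arguments.
Unset Strict Implicit.
Unset Printing Implicit Defensive.

Import Order.TTheory GRing.Theory Num.Theory.
Import numFieldNormedType.Exports.

Local Open Scope ring_scope.

(** * Singular values and minors *)

Section SmallSubspaces.
Local Open Scope sesquilinear_scope.
Variable C : numClosedFieldType.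
Implicit Types e M : C.

Definition sqnorm n (x : 'rV[C]_n) : C := \sum_j `|x 0 j| ^+ 2.

Lemma sqnormE n (x : 'rV[C]_n) : sqnorm x = (x *m x ^t*) 0 0.
Proof. by rewrite mxE; apply: eq_bigr => j _; rewrite !mxE normCK. Qed.

Lemma sqnorm_ge0 n (x : 'rV[C]_n) : 0 <= sqnorm x.
Proof. by apply: sumr_ge0 => j _; rewrite exprn_ge0. Qed.

Lemma sqnorm_eq0 n (x : 'rV[C]_n) : sqnorm x = 0 -> x = 0.
Proof.
move=> /eqP; rewrite psumr_eq0 => [/allP x0|j _]; last by rewrite exprn_ge0.
apply/rowP => j; apply/eqP; rewrite !mxE.
by have := x0 j (mem_index_enum j); rewrite sqrf_eq0 normr_eq0.
Qed.

Lemma sqnorm_unitary m n (x : 'rV[C]_m) (P : 'M[C]_(m, n)) :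
  P \is unitarymx -> sqnorm (x *m P) = sqnorm x.
Proof.
by move=> /unitarymxP uP; rewrite !sqnormE trmx_mul map_mxM mulmxA -(mulmxA x) uP mulmx1.
Qed.

(** The entries of s are the squares of the singular values of B, which avoids
    square roots. Matrices act on row vectors from the right, so the rows of P
    are the singular vectors, and B B^* takes the place of B^* B. *)
Definition singular_values n (B P : 'M[C]_n) (s : 'I_n -> C) :=
  [/\ P \is unitarymx, forall i, 0 <= s i &
      B *m B ^t* = P ^t* *m diag_mx (\row_i s i) *m P].

Lemma sqnorm_gram n (B P : 'M[C]_n) s (x : 'rV_n) :
  P \is unitarymx -> B *m B ^t* = P ^t* *m diag_mx (\row_i s i) *m P ->
  sqnorm (x *m P *m B) = \sum_i s i * `|x 0 i| ^+ 2.
Proof.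
move=> /unitarymxP uP BB.
rewrite sqnormE trmx_mul map_mxM trmx_mul map_mxM mulmxA -(mulmxA (x *m P)) BB.
rewrite !mulmxA -(mulmxA x P) uP mulmx1 -(mulmxA _ P) uP mulmx1.
rewrite mxE; apply: eq_bigr => i _; rewrite !mxE (bigD1 i) //= big1 => [|j ji].
  by rewrite !mxE eqxx mulr1n addr0 normCK; ring.
by rewrite !mxE (negPf ji) mulr0n mulr0.
Qed.

Lemma singular_valuesE n (B P : 'M[C]_n) s (x : 'rV_n) :
  singular_values B P s -> sqnorm (x *m P *m B) = \sum_i s i * `|x 0 i| ^+ 2.
Proof. by case=> uP _ BB; apply: sqnorm_gram. Qed.

Lemma sum_sqnorm_delta n (s : 'I_n -> C) i :
  \sum_j s j * `|(delta_mx 0 i : 'rV[C]_n) 0 j| ^+ 2 = s i.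
Proof.
rewrite (bigD1 i) //= big1 => [|j /negPf ji].
  by rewrite mxE !eqxx normr1 expr1n mulr1 addr0.
by rewrite mxE ji andbF normr0 expr0n mulr0.
Qed.

Lemma sqnorm_delta n i : sqnorm (delta_mx 0 i : 'rV[C]_n) = 1.
Proof. by rewrite -(sum_sqnorm_delta (fun=> 1) i); apply: eq_bigr => j _; rewrite mul1r. Qed.

Lemma singular_values_exist n (B : 'M[C]_n) : exists P s, singular_values B P s.
Proof.
have hB : B *m B ^t* \is normalmx.
  by apply/normalmxP; rewrite trmx_mul map_mxM trmxCK.
have /orthomx_spectralP eB := hB.
have uP := spectral_unitarymx (B *m B ^t*).
set P := spectralmx _ in uP eB; set D := spectral_diag _ in eB.
have eB' : B *m B ^t* = P ^t* *m diag_mx D *m P by rewrite -(invmx_unitary uP).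
have eD : D = \row_i D 0 i by apply/rowP => i; rewrite mxE.
rewrite eD in eB'; exists P, (fun i => D 0 i); split=> // i.
by rewrite -(sum_sqnorm_delta (D 0) i) -(sqnorm_gram _ uP eB') sqnorm_ge0.
Qed.

Lemma prod_singular_values n (B P : 'M[C]_n) s :
  singular_values B P s -> `|\det B| ^+ 2 = \prod_i s i.
Proof.
move=> [/unitarymxP uP _ BB]; have /(congr1 determinant) := BB.
rewrite !det_mulmx det_diag det_map_mx det_tr -normCK => ->.
rewrite mulrC mulrA -det_mulmx uP det1 mul1r.
by apply: eq_bigr => i _; rewrite mxE.
Qed.

Lemma rowsub1_unitary n k (f : 'I_k -> 'I_n) : injective f ->
  rowsub f (1%:M : 'M[C]_n) \is unitarymx.
Proof.
move=> fi; apply/unitarymxP.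
apply/matrixP => i j; rewrite !mxE (bigD1 (f j)) //= big1 => [|l lj].
  by rewrite !mxE eqxx conjC1 mulr1 addr0 (inj_eq fi).
by rewrite !mxE (eq_sym (f j)) (negPf lj) conjC0 mulr0.
Qed.

Lemma mul_rowsub1 n k (f : 'I_k -> 'I_n) (x : 'rV[C]_k) j :
  (x *m rowsub f 1%:M) 0 j = \sum_(i | f i == j) x 0 i.
Proof.
rewrite mxE [RHS]big_mkcond; apply: eq_bigr => i _; rewrite !mxE.
by case: eqP => _; rewrite ?mulr1 ?mulr0.
Qed.

Lemma mul_rowsub1_notin n k (f : 'I_k -> 'I_n) (x : 'rV[C]_k) j :
  (forall i, f i != j) -> (x *m rowsub f 1%:M) 0 j = 0.
Proof. by move=> fj; rewrite mul_rowsub1 big_pred0 // => i; apply: negPf. Qed.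

Lemma sqnorm_colsub n k (g : 'I_k -> 'I_n) (x : 'rV[C]_n) : injective g ->
  sqnorm (colsub g x) <= sqnorm x.
Proof.
move=> gi; rewrite /sqnorm [leRHS](bigID (mem (g @: [set: 'I_k]))) /=.
rewrite big_imset /=; last by move=> i j _ _; apply: gi.
under [X in _ <= X + _]eq_bigl do rewrite finset.in_setT.
rewrite [X in X <= _ + _](eq_bigr (fun i => `|x 0 (g i)| ^+ 2)) => [|i _]; last by rewrite mxE.
by rewrite lerDl sumr_ge0 // => j _; rewrite exprn_ge0.
Qed.

(** The rows of P with index in S span the space W; y lists the coordinates in
    the basis P of the vector with coordinates x in the basis W. *)
Lemma span_singular_vectors n (B P : 'M[C]_n) s (S : {set 'I_n}) :
  singular_values B P s ->
  exists W : 'M[C]_(#|S|, n), row_free W /\ forall x : 'rV_#|S|, exists y : 'rV_n,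
      [/\ sqnorm y = sqnorm (x *m W), forall i, i \notin S -> y 0 i = 0 &
          sqnorm (x *m W *m B) = \sum_i s i * `|y 0 i| ^+ 2].
Proof.
move=> sB; have uP : P \is unitarymx by case: sB.
exists (rowsub enum_val 1%:M *m P); split.
  rewrite /row_free mxrankMfree ?row_free_unit ?unitarymx_unit //.
  by rewrite mxrank_unitary // rowsub1_unitary //; apply: enum_val_inj.
move=> x; exists (x *m rowsub enum_val 1%:M); split.
- by rewrite mulmxA [RHS]sqnorm_unitary.
- move=> i iS; apply: mul_rowsub1_notin => j.
  by apply: contraNneq iS => <-; apply: enum_valP.
- by rewrite mulmxA (singular_valuesE _ sB).
Qed.

Lemma small_singular_space n (B P : 'M[C]_n) s e (S : {set 'I_n}) :
  singular_values B P s -> (forall i, i \in S -> s i <= e) ->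
  exists W : 'M[C]_(#|S|, n), row_free W /\ forall x : 'rV_n, (x <= W)%MS -> sqnorm (x *m B) <= e * sqnorm x.
Proof.
move=> sB sS; have [W [fW WP]] := span_singular_vectors S sB.
exists W; split=> // x /submxP[z ->].
have [y [<- y0 ->]] := WP z; rewrite mulr_sumr ler_sum // => i _.
have [iS|iS] := boolP (i \in S); first by rewrite ler_wpM2r ?exprn_ge0 ?sS.
by rewrite y0 // normr0 expr0n !mulr0.
Qed.

(** The singular vectors with value above e span a space on whose nonzero
    vectors B multiplies the squared norm by more than e, so it meets U only
    in 0 and the dimensions add up to at most n. *)
Lemma card_small_singular n k (B P : 'M[C]_n) s e (U : 'M[C]_(k, n)) :
  0 <= e ->
  singular_values B P s ->
  (forall x : 'rV_n, (x <= U)%MS -> sqnorm (x *m B) <= e * sqnorm x) ->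
  (\rank U <= #|[set i | (s i <= e)%R]|)%N.
Proof.
move=> e2_ge0 sB UP; set S := [set i | _].
have [W [fW WP]] := span_singular_vectors (~: S) sB.
have s_ge0 i : 0 <= s i by case: sB.
have UW0 : (U :&: W)%MS = 0.
  apply/eqP/rowV0P => x; rewrite sub_capmx => /andP[xU /submxP[z xz]].
  have [y [yx y0 xB]] := WP z; rewrite -xz in yx xB.
  apply: sqnorm_eq0; rewrite -yx.
  have := UP _ xU; rewrite xB -yx /sqnorm mulr_sumr -subr_ge0 -sumrB => h.
  have lt i : i \notin S -> e < s i.
    by rewrite inE -real_ltNge ?ger0_real.
  have le i : (e * `|y 0 i| ^+ 2 - s i * `|y 0 i| ^+ 2) <= 0.
    have [iS|iS] := boolP (i \in ~: S).
      rewrite subr_le0 ler_wpM2r ?exprn_ge0 //; apply/ltW/lt.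
      by move: iS; rewrite inE.
    by rewrite y0 // normr0 expr0n !mulr0 subr0.
  rewrite big1 // => i _; have [iS|iS] := boolP (i \in ~: S); last first.
    by rewrite y0 // normr0 expr0n.
  have : \sum_i (s i * `|y 0 i| ^+ 2 - e * `|y 0 i| ^+ 2) == 0.
    rewrite eq_le; apply/andP; split.
      by move: h; rewrite -oppr_le0 -sumrN; under eq_bigr do rewrite opprB.
    by apply: sumr_ge0 => j _; rewrite -oppr_le0 opprB.
  rewrite psumr_eq0 => [/allP/(_ i (mem_index_enum i))/=|j _]; last first.
    by rewrite -oppr_le0 opprB.
  rewrite -mulrBl mulf_eq0 => /orP[|/eqP//].
  by rewrite subr_eq0 => /eqP si; move: (lt i); rewrite si ltxx inE in iS *; move/(_ iS).
have := mxrank_sum_cap U W; rewrite UW0 mxrank0 addn0 => rk.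
have : (\rank (U + W)%MS <= n)%N by apply: rank_leq_col.
rewrite rk; move: fW; rewrite /row_free => /eqP ->.
by rewrite -[X in (_ <= X)%N](card_ord n) -(cardsC S) leq_add2r.
Qed.

(** The square of the determinant is the product of all the s i; by the
    previous count at least u of them are at most e, and all of them are at
    most M. *)
Lemma det_le_small_space n k (B : 'M[C]_n) e M (U : 'M[C]_(k, n)) u :
  0 <= e -> e <= M -> (u <= \rank U)%N ->
  (forall x : 'rV_n, sqnorm (x *m B) <= M * sqnorm x) ->
  (forall x : 'rV_n, (x <= U)%MS -> sqnorm (x *m B) <= e * sqnorm x) ->
  `|\det B| ^+ 2 <= e ^+ u * M ^+ (n - u).
Proof.
move=> e0 eM uU BM BU; have [P [s sB]] := singular_values_exist B.
have uS := leq_trans uU (card_small_singular e0 sB BU).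
rewrite (prod_singular_values sB); set S := [set i | _] in uS.
have M0 : 0 <= M by apply: le_trans eM.
have s_ge0 i : 0 <= s i by case: sB.
have s_le i : s i <= M.
  have := BM ((delta_mx 0 i) *m P); rewrite (singular_valuesE _ sB).
  rewrite sqnorm_unitary; last by case: sB.
  by rewrite sqnorm_delta sum_sqnorm_delta mulr1.
have Sn : (#|S| <= n)%N by rewrite -[X in (_ <= X)%N](card_ord n) max_card.
rewrite (bigID (mem S)) /=.
have : \prod_(i in S) s i * \prod_(i | i \notin S) s i
      <= e ^+ #|S| * M ^+ (n - #|S|).
  rewrite ler_pM ?prodr_ge0 //.
    rewrite -prodr_const; apply: ler_prod => i; rewrite inE => si.
    by rewrite s_ge0.
  have -> : (n - #|S| = #|[pred i | i \notin S]|)%N.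
    by rewrite -[X in (X - _)%N](card_ord n) -(cardC S) addKn.
  by rewrite -prodr_const; apply: ler_prod => i _; rewrite s_ge0 s_le.
move=> /le_trans; apply.
rewrite -{1}(subnK uS) exprD -mulrA mulrC -mulrA.
rewrite ler_wpM2l ?exprn_ge0 // mulrC.
have -> : (n - u = (n - #|S|) + (#|S| - u))%N.
  by rewrite addnBA // subnK.
rewrite exprD mulrC ler_wpM2l ?exprn_ge0 //.
exact: lerXn2r.
Qed.

(** The minor is the determinant of B restricted to the r coordinates picked
    by f and then projected to the r coordinates picked by g. Restricting to a
    coordinate space of dimension r makes U lose at most n - r dimensions, and
    projecting does not increase norms. *)
Lemma minor_le_small_space n k r (B : 'M[C]_n) e M (U : 'M[C]_(k, n))
    (f g : 'I_r -> 'I_n) u :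
  injective f -> injective g ->
  0 <= e -> e <= M -> (u + n <= \rank U + r)%N ->
  (forall x : 'rV_n, sqnorm (x *m B) <= M * sqnorm x) ->
  (forall x : 'rV_n, (x <= U)%MS -> sqnorm (x *m B) <= e * sqnorm x) ->
  `|\det (mxsub f g B)| ^+ 2 <= e ^+ u * M ^+ (r - u).
Proof.
move=> fi gi e0 eM uU BM BU.
pose F : 'M[C]_(r, n) := rowsub f 1%:M.
have uF : F \is unitarymx by apply: rowsub1_unitary.
have xF (x : 'rV_r) : x *m mxsub f g B = colsub g (x *m F *m B).
  rewrite -mulmxA mul_rowsub_mx mul1mx; apply/rowP => j; rewrite !mxE.
  by apply: eq_bigr => i _; rewrite !mxE.
pose V := ((F :&: U)%MS *m F ^t*).
have FK (x : 'rV_n) : (x <= F)%MS -> x *m F ^t* *m F = x.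
  by move=> /submxP[z ->]; move/unitarymxP: uF => uF; rewrite -(mulmxA z) uF mulmx1.
have rV : \rank V = \rank (F :&: U)%MS.
  apply/eqP; rewrite eqn_leq mxrankM_maxl /=.
  suff {1}-> : (F :&: U)%MS = V *m F by apply: mxrankM_maxl.
  apply/row_matrixP => i; rewrite !row_mul FK //.
  by apply: submx_trans (row_sub _ _) (capmxSl _ _).
apply: (@det_le_small_space r _ _ e M V) => //.
- have rF : \rank F = r by rewrite mxrank_unitary.
  have := mxrank_sum_cap F U; rewrite -rV rF => rk.
  have : (\rank (F + U)%MS <= n)%N by apply: rank_leq_col.
  by move: uU; rewrite addnC [(\rank U + r)%N]addnC -rk; lia.
- move=> x; rewrite xF; apply: le_trans (sqnorm_colsub _ gi) _.
  by apply: le_trans (BM _) _; rewrite sqnorm_unitary.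
- move=> x /submxP[z ->]; rewrite xF; apply: le_trans (sqnorm_colsub _ gi) _.
  have zF : z *m V *m F = z *m (F :&: U)%MS.
    by rewrite /V mulmxA FK // (submx_trans (submxMl _ _)) // capmxSl.
  rewrite -(sqnorm_unitary (z *m V) uF) zF; apply: BU.
  by rewrite (submx_trans (submxMl _ _)) // capmxSr.
Qed.

End SmallSubspaces.

(** * Traces of powers of a contraction *)

Section PowersOfContraction.
Local Open Scope sesquilinear_scope.
Variable C : numClosedFieldType.
Implicit Types e M c : C.

Definition gram_contraction n c (B : 'M[C]_n) : 'M[C]_n := 1%:M - c *: (B *m B ^t*).

Lemma gram_contraction_exp n c (B P : 'M[C]_n) s k : singular_values B P s ->
  gram_contraction c B ^+ k = P ^t* *m diag_mx (\row_i (1 - c * s i) ^+ k) *m P.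
Proof.
case=> uP _ BB; have /unitarymxP PP := uP.
have PsP : P ^t* *m P = 1%:M.
  by have := mulVmx (unitarymx_unit uP); rewrite invmx_unitary.
have TE : gram_contraction c B = P ^t* *m diag_mx (\row_i (1 - c * s i)) *m P.
  have -> : diag_mx (\row_i (1 - c * s i)) = 1%:M - c *: diag_mx (\row_i s i).
    apply/matrixP => i j; rewrite !mxE.
    by case: eqP => _; rewrite ?mulr1n ?mulr0n ?mulr0 ?subr0.
  by rewrite mulmxBr mulmxBl mulmx1 PsP -scalemxAr -scalemxAl -BB.
elim: k => [|k IH].
  rewrite expr0 (_ : diag_mx _ = 1%:M) ?mulmx1 ?PsP //.
  by apply/matrixP => i j; rewrite !mxE expr0.
rewrite exprSr -[_ * _]/(_ *m _) IH TE !mulmxA -(mulmxA _ P) PP mulmx1.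
congr (_ *m _); rewrite -mulmxA mulmx_diag; congr (_ *m diag_mx _).
by apply/rowP => i; rewrite !mxE exprSr.
Qed.

Lemma trace_exp n c (B P : 'M[C]_n) s k : singular_values B P s ->
  \tr (gram_contraction c B ^+ k) = \sum_i (1 - c * s i) ^+ k.
Proof.
move=> sB; rewrite (gram_contraction_exp _ _ sB); case: sB => /unitarymxP PP _ _.
rewrite mxtrace_mulC mulmxA PP mul1mx mxtrace_diag.
by apply: eq_bigr => i _; rewrite mxE.
Qed.

Lemma singular_values_le n M (B P : 'M[C]_n) s i : singular_values B P s ->
  (forall x : 'rV_n, sqnorm (x *m B) <= M * sqnorm x) -> s i <= M.
Proof.
move=> sB BM; have := BM ((delta_mx 0 i) *m P); rewrite (singular_valuesE _ sB).
rewrite sqnorm_unitary; last by case: sB.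
by rewrite sqnorm_delta sum_sqnorm_delta mulr1.
Qed.

Lemma contraction_values n c M (B P : 'M[C]_n) s i : singular_values B P s ->
  (forall x : 'rV_n, sqnorm (x *m B) <= M * sqnorm x) -> 0 <= c -> c * M <= 1 ->
  0 <= 1 - c * s i <= 1.
Proof.
move=> sB BM c0 cM; have s0 : 0 <= s i by case: sB.
have sM := singular_values_le i sB BM.
rewrite subr_ge0 gerBl mulr_ge0 // andbT.
by apply: le_trans cM; apply: ler_wpM2l.
Qed.

(** The entry is an average of the numbers (1 - c s_i)^k, weighted by the
    squared moduli in the unit column j of P. *)
Lemma diag_exp_itv n c M (B : 'M[C]_n) k j :
  (forall x : 'rV_n, sqnorm (x *m B) <= M * sqnorm x) -> 0 <= c -> c * M <= 1 ->
  0 <= (gram_contraction c B ^+ k) j j <= 1.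
Proof.
move=> BM c0 cM; have [P [s sB]] := singular_values_exist B.
rewrite (gram_contraction_exp _ _ sB).
have PsP : P ^t* *m P = 1%:M.
  by case: sB => uP _ _; have := mulVmx (unitarymx_unit uP); rewrite invmx_unitary.
have -> : (P ^t* *m diag_mx (\row_i (1 - c * s i) ^+ k) *m P) j j =
    \sum_i (1 - c * s i) ^+ k * `|P i j| ^+ 2.
  rewrite mxE; apply: eq_bigr => i _; rewrite mxE (bigD1 i) //= big1 => [|l li].
    by rewrite !mxE eqxx mulr1n addr0 normCK; ring.
  by rewrite !mxE (negPf li) mulr0n mulr0.
have sum1 : \sum_i `|P i j| ^+ 2 = 1.
  have /matrixP/(_ j j) := PsP; rewrite !mxE eqxx mulr1n => <-.
  by apply: eq_bigr => i _; rewrite !mxE normCK mulrC.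
have v i := contraction_values i sB BM c0 cM.
apply/andP; split.
  apply: sumr_ge0 => i _; have /andP[v0 _] := v i.
  by rewrite mulr_ge0 ?exprn_ge0.
rewrite -[leRHS]sum1; apply: ler_sum => i _; have /andP[v0 v1] := v i.
by apply: ler_piMl; [rewrite exprn_ge0 | apply: exprn_ile1].
Qed.

(** Each s_i <= e contributes at most 1 to the trace and every other one at
    most (1 - c e)^k. *)
Lemma trace_exp_le n e c M (B P : 'M[C]_n) s k : singular_values B P s ->
  (forall x : 'rV_n, sqnorm (x *m B) <= M * sqnorm x) -> 0 <= c -> c * M <= 1 ->
  0 <= e -> c * e <= 1 ->
  \tr (gram_contraction c B ^+ k) <=
    #|[set i | s i <= e]|%:R + n%:R * (1 - c * e) ^+ k.
Proof.
move=> sB BM c0 cM e0 ce; rewrite (trace_exp _ _ sB) (bigID (mem [set i | s i <= e])) /=.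
have v i := contraction_values i sB BM c0 cM.
have q0 : 0 <= (1 - c * e) ^+ k by rewrite exprn_ge0 // subr_ge0.
apply: lerD.
  rewrite -sumr_const; apply: ler_sum => i _; have /andP[v0 v1] := v i.
  exact: exprn_ile1.
apply: (@le_trans _ _ (\sum_(i | i \notin [set i | s i <= e]) (1 - c * e) ^+ k)).
  apply: ler_sum => i; rewrite inE -real_ltNge ?ger0_real //; last by case: sB.
  move=> si; have /andP[v0 v1] := v i.
  apply: lerXn2r; rewrite ?nnegrE ?subr_ge0 //; first by rewrite -subr_ge0.
  by rewrite lerD2l lerN2 ler_wpM2l // ltW.
rewrite -[X in _ <= X%:R * _](card_ord n) mulr_natl -sumr_const big_mkcond /=.
by apply: ler_sum => i _; case: ifP.
Qed.

Lemma card_zero_singular n (B P : 'M[C]_n) s : singular_values B P s ->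
  #|[set i | s i == 0]| = (n - \rank B)%N.
Proof.
move=> sB; have s0 i : 0 <= s i by case: sB.
have eS : [set i | s i == 0] = [set i | s i <= 0].
  by apply/setP => i; rewrite !inE eq_le s0 andbT.
rewrite -mxrank_ker; apply/eqP; rewrite eqn_leq eS; apply/andP; split.
  have [|W [fW WB]] := small_singular_space (e := 0) (S := [set i | s i <= 0]) sB.
    by move=> i; rewrite inE.
  move: fW; rewrite /row_free => /eqP {1}<-; apply/mxrankS/row_subP => i.
  apply/sub_kermxP/sqnorm_eq0/le_anti; rewrite sqnorm_ge0 andbT.
  by apply: le_trans (WB _ (row_sub i W)) _; rewrite mul0r.
apply: card_small_singular sB _ => // x /sub_kermxP->.
by rewrite mul0r /sqnorm big1 // => j _; rewrite mxE normr0 expr0n.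
Qed.

Lemma trace_exp_ge n c M (B P : 'M[C]_n) s k : singular_values B P s ->
  (forall x : 'rV_n, sqnorm (x *m B) <= M * sqnorm x) -> 0 <= c -> c * M <= 1 ->
  (n - \rank B)%:R <= \tr (gram_contraction c B ^+ k).
Proof.
move=> sB BM c0 cM; rewrite -(card_zero_singular sB) (trace_exp _ _ sB).
have v i := contraction_values i sB BM c0 cM.
rewrite (bigID (mem [set i | s i == 0])) /= -sumr_const.
have -> : \sum_(i in [set i | s i == 0]) (1 - c * s i) ^+ k = \sum_(i in [set i | s i == 0]) 1.
  by apply: eq_bigr => i; rewrite inE => /eqP->; rewrite mulr0 subr0 expr1n.
rewrite lerDl sumr_ge0 // => i _; have /andP[v0 _] := v i.
exact: exprn_ge0.
Qed.

(** Isolating the vanishing s_i, which are counted by the nullity, leaves the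
    two error terms that have to be controlled: the number of small nonzero
    s_i, and a term that tends to 0 with k. *)
Lemma trace_exp_le_ker n e c M (B P : 'M[C]_n) s k : singular_values B P s ->
  (forall x : 'rV_n, sqnorm (x *m B) <= M * sqnorm x) -> 0 <= c -> c * M <= 1 ->
  0 <= e -> c * e <= 1 ->
  \tr (gram_contraction c B ^+ k) <=
    (n - \rank B)%:R + #|[set i | 0 < s i <= e]|%:R + n%:R * (1 - c * e) ^+ k.
Proof.
move=> sB BM c0 cM e0 ce.
apply: le_trans (trace_exp_le k sB BM c0 cM e0 ce) _.
rewrite lerD2r -(card_zero_singular sB) -natrD ler_nat -cardsUI.
apply: leq_trans (leq_addr _ _); apply: subset_leq_card; apply/fintype.subsetP => i.
rewrite !inE => ->; rewrite andbT lt_def; have -> : 0 <= s i by case: sB.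
by rewrite andbT; case: eqP.
Qed.

End PowersOfContraction.

(** * Eigenvalues of integer matrices *)

Section Spectrum.
Variable C : numClosedFieldType.

Lemma char_poly_prod n (N : 'M[C]_n) :
  exists rs : seq C, char_poly N = \prod_(z <- rs) ('X - z%:P).
Proof.
have [rs e] := closed_field_poly_normal (char_poly N); exists rs.
by rewrite e (monicP (char_poly_monic N)) scale1r.
Qed.

Lemma size_spectrum n (N : 'M[C]_n) rs :
  char_poly N = \prod_(z <- rs) ('X - z%:P) -> size rs = n.
Proof. by move=> /(congr1 (fun p : {poly C} => size p)); rewrite size_char_poly size_prod_XsubC => -[]. Qed.

Lemma horner_char_poly (K : comNzRingType) n (N : 'M[K]_n) w :
  (char_poly N).[w] = \det (w%:M - N).
Proof.
rewrite -[LHS]/(horner_eval w _) -det_map_mx; congr (\det _).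
by apply/matrixP => i j; rewrite !mxE rmorphB rmorphMn /= /horner_eval hornerX hornerC.
Qed.

(** After factoring f into linear factors, each factor contributes a value of
    the characteristic polynomial of N. *)
Lemma det_horner_mx n (N : 'M[C]_n.+1) rs (f : {poly C}) :
  char_poly N = \prod_(z <- rs) ('X - z%:P) ->
  \det (horner_mx N f) = \prod_(z <- rs) f.[z].
Proof.
move=> eN; have sz := size_spectrum eN.
have [ws ->] := closed_field_poly_normal f; set a := lead_coef f.
under [RHS]eq_bigr do rewrite hornerZ.
rewrite horner_mxZ detZ big_split /= big_const_seq count_predT sz.
rewrite -Monoid.iteropE; congr (_ * _).
elim: ws => [|w ws IH].
  rewrite big_nil rmorph1 det1 big1_seq // => z _; exact: hornerC.
rewrite big_cons rmorphM /= det_mulmx IH.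
under [RHS]eq_bigr do rewrite hornerM.
rewrite big_split /=; congr (_ * _).
rewrite rmorphB /= horner_mx_X horner_mx_C -opprB -scaleN1r detZ -horner_char_poly eN.
have -> : (-1) ^+ n.+1 = \prod_(z <- rs) (-1) :> C.
  by rewrite big_const_seq count_predT sz -Monoid.iteropE.
rewrite horner_prod -big_split /=.
by apply: eq_bigr => z _; rewrite !hornerE mulN1r opprB.
Qed.

(** A numerically closed field is infinite, so a polynomial is determined by
    its values. *)
Lemma poly_ext (p q : {poly C}) : (forall x, p.[x] = q.[x]) -> p = q.
Proof.
move=> pq; apply/eqP; rewrite -subr_eq0; apply/eqP.
apply: (@roots_geq_poly_eq0 _ _ [seq k%:R | k <- iota 0 (size (p - q)%R)]).
- by apply/allP => _ /mapP[k _ ->]; rewrite rootE !hornerE pq subrr.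
- by rewrite map_inj_uniq ?iota_uniq // => k l /eqP; rewrite eqr_nat => /eqP.
- by rewrite size_map size_iota.
Qed.

Lemma char_poly_horner_mx n (N : 'M[C]_n.+1) rs (f : {poly C}) :
  char_poly N = \prod_(z <- rs) ('X - z%:P) ->
  char_poly (horner_mx N f) = \prod_(z <- rs) ('X - f.[z]%:P).
Proof.
move=> eN; apply: poly_ext => x; rewrite horner_char_poly.
rewrite -(horner_mx_C N) -rmorphB (det_horner_mx _ eN) horner_prod.
by apply: eq_bigr => z _; rewrite !hornerE.
Qed.

(** The lowest nonzero coefficient of a product of linear factors collects the
    nonzero roots. *)
Lemma norm_low_coef_prod_XsubC (mus : seq C) :
  `|(\prod_(m <- mus) ('X - m%:P))`_(count (pred1 0) mus)| =
  \prod_(m <- mus | m != 0) `|m|.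
Proof.
rewrite (bigID (pred1 0)) /=.
rewrite (eq_bigr (fun=> 'X)) => [|m /eqP->]; last by rewrite subr0.
rewrite big_const_seq -Monoid.iteropE coefXnM ltnn subnn.
rewrite -horner_coef0 horner_prod normr_prod.
by apply: eq_bigr => m _; rewrite !hornerE normrN.
Qed.

(** The values f(z) are the eigenvalues of the integer matrix f(N). Up to sign
    the product of the nonzero ones is the lowest nonzero coefficient of the
    characteristic polynomial of f(N), which is a nonzero integer. *)
Lemma prod_nonzero_values_ge1 n (N : 'M[int]_n) rs (f : {poly int}) :
  char_poly (map_mx intr N : 'M[C]_n) = \prod_(z <- rs) ('X - z%:P) ->
  1 <= \prod_(z <- rs | (map_poly intr f).[z] != 0) `|(map_poly intr f).[z] : C|.
Proof.
case: n N => [|n] N eN.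
  by rewrite (size0nil (size_spectrum eN)) big_nil.
have := char_poly_horner_mx (map_poly intr f) eN.
rewrite -map_horner_mx -map_char_poly.
rewrite -(big_map (fun z => (map_poly intr f).[z]) predT (fun m => 'X - m%:P)) => e.
rewrite -(big_map (fun z => (map_poly intr f).[z]) (fun m => m != 0) (fun m => `|m|)).
rewrite -norm_low_coef_prod_XsubC -e coef_map /= -intr_norm -[1]/(1%:~R) ler_int.
set k := count _ _; have : `|(map_poly intr (char_poly (horner_mx N f)))`_k : C| != 0.
  rewrite e norm_low_coef_prod_XsubC prodf_seq_neq0; apply/allP => m _ /=.
  by rewrite normr_eq0; apply/implyP.
by rewrite coef_map /= normr_eq0 intr_eq0 -gtz0_ge1 normr_gt0.
Qed.

End Spectrum.

(** * Monic polynomials on a circle *)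

Section RootsOfUnity.
Variable C : numClosedFieldType.

Lemma closed_prim_root n : (0 < n)%N -> exists z : C, n.-primitive_root z.
Proof.
move=> n_gt0; pose p : {poly C} := 'X^n - 1.
have [r Dp] := closed_field_poly_normal p.
move: Dp; rewrite (monicP _) ?monicXnsubC // scale1r => Dp.
have rn1 : all n.-unity_root r.
  by apply/allP => z; rewrite -root_prod_XsubC -Dp unity_rootE rootE !hornerE subr_eq0.
have sz : size r = n by apply: succn_inj; rewrite -(size_prod_XsubC r id) -Dp size_XnsubC.
have Ur : uniq r.
  rewrite -separable_prod_XsubC -Dp separable_Xn_sub_1 //.
  by rewrite pnatr_eq0 -lt0n.
by have /hasP[z _ zP] := has_prim_root n_gt0 rn1 Ur (eq_leq (esym sz)); exists z.
Qed.

(** Let w be a primitive root of unity of order N = deg h + 1. The sum of the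
    w^j h(w^j) over j < N isolates the leading coefficient of h and equals N,
    so one of the N terms has modulus at least 1. *)
Lemma monic_ge1_on_unit_circle (h : {poly C}) :
  h \is monic -> exists2 w, `|w| = 1 & 1 <= `|h.[w]|.
Proof.
move=> mh; have h0 : h != 0 by apply: monic_neq0.
have sz_gt0 : (0 < size h)%N by rewrite size_poly_gt0.
have [w wP] := closed_prim_root sz_gt0.
have nw : `|w| = 1.
  apply: (@pexpIrn _ _ sz_gt0); rewrite ?nnegrE //.
  by rewrite -normrX (prim_expr_order wP) expr1n normr1.
have sum_eq : \sum_(j < size h) w ^+ j * h.[w ^+ j] = (size h)%:R.
  under eq_bigr do rewrite horner_coef mulr_sumr.
  rewrite exchange_big /=.
  have /esym Nlt := prednK sz_gt0.
  have geo k : (k < size h)%N ->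
      \sum_(j < size h) w ^+ j * (h`_k * w ^+ j ^+ k) =
      h`_k * (k.+1 == size h)%:R * (size h)%:R.
    move=> kn; have -> : \sum_(j < size h) w ^+ j * (h`_k * w ^+ j ^+ k) =
        h`_k * \sum_(j < size h) (w ^+ k.+1) ^+ j.
      rewrite mulr_sumr; apply: eq_bigr => j _.
      by rewrite mulrCA -exprM -exprM -exprD mulSn [(j * k)%N]mulnC.
    have [->|ne] := eqVneq k.+1 (size h).
      rewrite (prim_expr_order wP) mulr1; congr (_ * _).
      by under eq_bigr do rewrite expr1n; rewrite sumr_const card_ord.
    rewrite mulr0 mul0r; have /eqP := subrX1 (w ^+ k.+1) (size h).
    rewrite -exprM mulnC exprM (prim_expr_order wP) expr1n subrr eq_sym mulf_eq0.
    case/orP=> [|/eqP->]; last by rewrite mulr0.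
    rewrite subr_eq0 -(prim_order_dvd wP) => /dvdn_leq le.
    by move: ne; rewrite eqn_leq kn le.
  rewrite (eq_bigr (fun k : 'I_(size h) => h`_k * (k.+1 == size h)%:R * (size h)%:R));
    last by move=> k _; apply: geo.
  have lt : ((size h).-1 < size h)%N by rewrite ltn_predL.
  rewrite (bigD1 (Ordinal lt)) //= big1 => [|k /eqP kn]; last first.
    case: eqP => [e|]; last by rewrite mulr0 mul0r.
    by case: kn; apply: val_inj; rewrite /=; have := f_equal predn e.
  by rewrite prednK // eqxx mulr1 addr0 -lead_coefE (monicP mh) mul1r.
have [/existsP[j hj]|] := boolP [exists j : 'I_(size h), 1 <= `|h.[w ^+ j]|].
  by exists (w ^+ j) => //; rewrite normrX nw expr1n.
rewrite negb_exists => /forallP no.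
have : `|(size h)%:R : C| < (size h)%:R.
  rewrite -{1}sum_eq -[X in _ < X%:R]card_ord -sumr_const.
  apply: le_lt_trans (ler_norm_sum _ _ _) _.
  apply: ltr_sum => [|j _]; first by apply/hasP; exists (Ordinal sz_gt0); rewrite ?mem_index_enum.
  rewrite normrM normrX nw expr1n mul1r real_ltNge ?no ?realE ?normr_ge0 ?ler01 //.
by rewrite normr_nat ltxx.
Qed.

(** The affine map sending the circle of radius rho around a to the unit
    circle turns the product into rho^(size zs) times a monic polynomial. *)
Lemma max_on_circle_ge (zs : seq C) (a rho : C) : 0 < rho ->
  exists2 w, `|w - a| = rho & rho ^+ size zs <= \prod_(z <- zs) `|w - z|.
Proof.
move=> r0; pose us := [seq (z - a) / rho | z <- zs].
have [w nw hw] := monic_ge1_on_unit_circle (monic_prod_XsubC us xpredT id).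
exists (a + rho * w); first by rewrite addrC addKr normrM nw mulr1 gtr0_norm.
rewrite -[leLHS]mulr1; apply: le_trans (ler_wpM2l _ hw) _.
  by rewrite exprn_ge0 ?ltW.
have {1}-> : rho ^+ size zs = \prod_(z <- zs) rho.
  by rewrite big_const_seq count_predT -Monoid.iteropE.
rewrite horner_prod big_map normr_prod -big_split /=.
rewrite le_eqVlt; apply/orP; left; apply/eqP; apply: eq_bigr => z _.
rewrite -{1}(gtr0_norm r0) -normrM; congr (`|_|).
by rewrite !hornerE mulrBr mulrCA divff ?gt_eqF // mulr1; ring.
Qed.

End RootsOfUnity.

(** * Integer polynomials with a small value *)

Section SmallIntegerPolynomials.
Local Open Scope complex_scope.
Variable R : realType.
Local Notation C := R[i].

Lemma normc_leD (z : C) : `|z| <= (`|complex.Re z| + `|complex.Im z|)%:C.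
Proof.
case: z => x y /=; rewrite (_ : Complex x y = x%:C + y%:C * 'i%C); last by simpc.
apply: le_trans (ler_normD _ _) _; rewrite normrM.
rewrite !normc_def /= !expr0n /= !addr0 !sqrtr_sqr !expr1n add0r sqrtr1 mulr1.
by rewrite rmorphD.
Qed.

Lemma norm_Re_le (z : C) (x : R) : `|z| <= x%:C -> `|complex.Re z| <= x.
Proof. by move=> zx; rewrite -lecR; apply: le_trans (normc_ge_Re z) zx. Qed.

Lemma norm_Im_le (z : C) (x : R) : `|z| <= x%:C -> `|complex.Im z| <= x.
Proof.
move=> zx; rewrite -[complex.Im z]opprK -ReiNIm normrN.
apply: norm_Re_le; rewrite normrM (normc_def 'i%C) /= expr0n expr1n add0r.
by rewrite sqrtr1 mulr1.
Qed.

Lemma norm_horner_le (f : {poly C}) (z : C) (L : C) : 1 <= L -> `|z| <= L ->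
  `|f.[z]| <= \sum_(k < size f) `|f`_k| * L ^+ size f.
Proof.
move=> L1 zL; rewrite horner_coef; apply: le_trans (ler_norm_sum _ _ _) _.
apply: ler_sum => k _; rewrite normrM normrX ler_wpM2l //.
apply: le_trans (lerXn2r _ _ _ zL) _; rewrite ?nnegrE ?(le_trans _ L1) //.
by rewrite ler_weXn2l // ltnW.
Qed.

Lemma bounded_power_sum (s H L : nat) (c : 'I_s -> int) (z : C) :
  (0 < L)%N -> (forall k, `|c k| <= H%:Z) -> `|z| <= L%:R ->
  `|\sum_(k < s) (c k)%:~R * z ^+ k| <= (s * H * L ^ s)%:R.
Proof.
move=> L0 cH zL; apply: le_trans (ler_norm_sum _ _ _) _.
rewrite -mulnA natrM -[X in _ <= X%:R * _](card_ord s) mulr_natl -sumr_const.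
apply: ler_sum => k _; rewrite normrM normrX natrM ler_pM ?exprn_ge0 //.
  by rewrite -intr_norm -[H%:R]/(H%:Z%:~R) ler_int.
apply: le_trans (lerXn2r _ _ _ zL) _; rewrite ?nnegrE //.
by rewrite natrX ler_weXn2l ?ler1n // ltnW.
Qed.

(** Cutting [-X, X] into cells of length 1 / D, numbered by truncation. *)
Lemma same_cell (t t' : R) (X D : nat) :
  `|t| <= X%:R -> `|t'| <= X%:R -> (0 < D)%N ->
  Num.truncn ((t + X%:R) * D%:R) = Num.truncn ((t' + X%:R) * D%:R) ->
  `|t - t'| <= D%:R^-1.
Proof.
move=> tX t'X D0 e.
have D0' : 0 < D%:R :> R by rewrite ltr0n.
have ge0 u : `|u| <= X%:R -> 0 <= (u + X%:R) * D%:R :> R.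
  by rewrite ler_norml => /andP[h _]; rewrite mulr_ge0 ?ler0n // -(opprK X%:R) subr_ge0.
have /andP[h1 h2] := truncn_itv (ge0 _ tX).
have /andP[h3 h4] := truncn_itv (ge0 _ t'X).
rewrite e in h1 h2; rewrite -(ler_pM2r D0') mulVf ?gt_eqF //.
rewrite -{1}(gtr0_norm D0') -normrM ler_norml.
set w := (Num.truncn _) in h1 h2 h3 h4.
by rewrite -!natr1 in h2 h4; apply/andP; split; nra.
Qed.

Lemma cell_lt (t : R) (X D : nat) : `|t| <= X%:R ->
  (Num.truncn ((t + X%:R) * D%:R) < (2 * X * D).+1)%N.
Proof.
move=> tX; rewrite ltnS -(ler_nat R).
apply: le_trans (_ : (t + X%:R) * D%:R <= _).
  move: tX; rewrite ler_norml => /andP[h _].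
  by rewrite truncn_le mulr_ge0 ?ler0n // -(opprK X%:R) subr_ge0.
move: tX; rewrite ler_norml => /andP[_ h].
by rewrite natrM ler_wpM2r // natrM mulr_natl mulr2n lerD2r.
Qed.

(** Pigeonhole: among the polynomials of degree < s with coefficients in
    {0, ..., H} two have values at a in the same small cell of the square of
    side 2 X, as soon as there are more polynomials than cells; their
    difference is f. *)
Lemma small_value_int_poly (a : C) (L Q : nat) : (0 < L)%N -> `|a| <= L%:R ->
  exists (f : {poly int}) (X : nat), [/\ f != 0, (1 < X)%N,
    forall z : C, `|z| <= L%:R -> `|(map_poly intr f).[z]| <= X%:R &
    `|(map_poly intr f).[a]| * 2 * X%:R ^+ Q <= 1].
Proof.
(* There are (H + 1)^(2u) polynomials and about (8 X^(Q + 1))^2 cells, for the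
   real and the imaginary part; u = Q + 2 and the factor 9 in H make
   9 X^(Q + 1) <= H^u, and D is the number of cells per unit length. *)
move=> L0 aL; pose u := Q.+2; pose s := (2 * u)%N.
pose H := (9 * (s * L ^ s) ^ Q.+1)%N; pose X := (s * H * L ^ s)%N.
pose D := (4 * X ^ Q)%N.
have Ls0 : (0 < L ^ s)%N by rewrite expn_gt0 L0.
have H9 : (9 <= H)%N by rewrite leq_pmulr // expn_gt0 muln_gt0 Ls0.
have X1 : (1 < X)%N.
  apply: (@leq_trans H); first by apply: leq_trans H9.
  by rewrite /X mulnAC leq_pmull // muln_gt0 Ls0.
have X0 := ltnW X1.
have XQ0 : (0 < X ^ Q)%N by rewrite expn_gt0 X0.
have D0 : (0 < D)%N by rewrite muln_gt0 XQ0.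
have cells : ((2 * X * D).+1 <= H ^ u)%N.
  apply: (@leq_trans (9 * X ^ Q.+1)).
    rewrite /D expnS.
    by move: (X ^ Q)%N (X) XQ0 X0 => y x; nia.
  by rewrite /X mulnAC expnMn mulnA -/H -expnS.
pose v (c : {ffun 'I_s -> 'I_H.+1}) : C := \sum_(k < s) (c k)%:Z%:~R * a ^+ k.
have vX c : `|v c| <= (X%:R)%:C.
  rewrite rmorph_nat; apply: (@bounded_power_sum s H L (fun k => (c k : nat)%:Z)) => // k.
  by rewrite ger0_norm // lez_nat -ltnS.
pose cell c := (Ordinal (cell_lt D (norm_Re_le (vX c))), Ordinal (cell_lt D (norm_Im_le (vX c)))).
have /injectivePn [c [c' cc' ecc']] : ~~ injectiveb cell.
  apply/negP => /injectiveP/leq_card; rewrite card_prod card_ffun !card_ord leqNgt => /negP; apply.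
  apply: (@leq_ltn_trans (H ^ s)); last by rewrite ltn_exp2r.
  have -> : (H ^ s = H ^ u * H ^ u)%N by rewrite -expnD addnn -mul2n.
  by rewrite leq_mul.
pose d (k : 'I_s) : int := (c k)%:Z - (c' k)%:Z.
pose f : {poly int} := \poly_(k < s) (if insub k is Some i then d i else 0).
have fE z : (map_poly intr f).[z] = \sum_(k < s) (d k)%:~R * z ^+ k :> C.
  rewrite (@horner_coef_wide _ s) => [|].
    by apply: eq_bigr => k _; rewrite coef_map coef_poly ltn_ord valK.
  by apply: leq_trans (size_poly _ _) _; apply: size_poly.
exists f, X; split=> //.
- apply/eqP => f0; move/eqP: cc'; apply; apply/ffunP => k; apply: val_inj => /=.
  have /(congr1 (fun p : {poly int} => p`_k)) := f0.
  by rewrite coef_poly ltn_ord valK coef0 /d => /eqP; rewrite subr_eq0 eqz_nat => /eqP.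
- move=> z zL; rewrite fE; apply: bounded_power_sum => // k; rewrite /d.
  by have := ltn_ord (c k); have := ltn_ord (c' k); lia.
- have -> : (map_poly intr f).[a] = v c - v c'.
    by rewrite fE -sumrB; apply: eq_bigr => k _; rewrite rmorphB /= mulrBl.
  case: ecc' => eRe eIm.
  have reB := same_cell (norm_Re_le (vX c)) (norm_Re_le (vX c')) D0 eRe.
  have imB := same_cell (norm_Im_le (vX c)) (norm_Im_le (vX c')) D0 eIm.
  have le : `|v c - v c'| <= (2 * D%:R^-1)%:C.
    apply: le_trans (normc_leD _) _; rewrite lecR mulrDl mul1r.
    by case: (v c) (v c') reB imB => [x y] [x' y'] /= reB imB; apply: lerD.
  rewrite -mulrA; apply: le_trans (ler_wpM2r _ le) _.
    by rewrite mulr_ge0 ?exprn_ge0.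
  have -> : 2 * X%:R ^+ Q = (2 * X%:R ^+ Q)%:C :> C.
    by rewrite (rmorphM (real_complex R)) (rmorphXn (real_complex R)) /= !(rmorph_nat (real_complex R)).
  rewrite -rmorphM -[leRHS](rmorph1 (real_complex R)) lecR /D natrM natrX invfM.
  have XQ : X%:R ^+ Q != 0 :> R by rewrite -natrX pnatr_eq0 -lt0n.
  by rewrite le_eqVlt; apply/orP; left; apply/eqP; field.
Qed.

Lemma avoid_roots (a : C) (zs : seq C) :
  exists2 eta : R, 0 < eta & forall z, `|z - a| < eta%:C -> z \in zs -> z = a.
Proof.
elim: zs => [|w zs [eta e0 IH]]; first by exists 1.
have [->|wa] := eqVneq w a.
  by exists eta => // z za; rewrite inE => /orP[/eqP//|]; apply: IH.
have wa0 : 0 < complex.Re `|w - a|.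
  by rewrite -ltcR RRe_real ?normr_real // normr_gt0 subr_eq0.
exists (Num.min eta (complex.Re `|w - a|)); first by rewrite lt_min e0.
move=> z za; rewrite inE => /orP[/eqP zw|].
  have : `|z - a| < (complex.Re `|w - a|)%:C.
    by apply: lt_le_trans za _; rewrite lecR ge_min lexx orbT.
  by rewrite zw RRe_real ?normr_real // ltxx.
by apply: IH; apply: lt_le_trans za _; rewrite lecR ge_min lexx.
Qed.

(** The quotient of f - f(a) by the linear factor at a is bounded on the unit
    disc around a. *)
Lemma horner_lipschitz (f : {poly C}) (a : C) :
  exists2 K : R, 0 < K & forall z, `|z - a| <= 1 -> `|f.[z]| <= `|f.[a]| + K%:C * `|z - a|.
Proof.
have /factor_theorem[q qE] : root (f - f.[a]%:P) a by rewrite rootE !hornerE subrr.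
pose L := 1 + `|a|; pose K := complex.Re (\sum_(k < size q) `|q`_k| * L ^+ size q) + 1.
have L1 : 1 <= L by rewrite lerDl.
have sum_ge0 : 0 <= \sum_(k < size q) `|q`_k| * L ^+ size q.
  by apply: sumr_ge0 => k _; rewrite mulr_ge0 // exprn_ge0 // (le_trans ler01).
have KE : K%:C = \sum_(k < size q) `|q`_k| * L ^+ size q + 1.
  by rewrite /K rmorphD /= RRe_real // ger0_real.
exists K; first by rewrite -ltcR KE ltr_wpDl.
move=> z z1; have -> : f.[z] = f.[a] + q.[z] * (z - a).
  have := congr1 (fun p : {poly C} => p.[z]) qE; rewrite !hornerE => <-.
  by rewrite addrC subrK.
apply: le_trans (ler_normD _ _) _; rewrite lerD2l normrM ler_wpM2r // KE.
apply: le_trans (norm_horner_le q L1 _) _; last by rewrite lerDl.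
by rewrite -[z](subrK a) (le_trans (ler_normD _ _)) // lerD2r.
Qed.

(** Continuity at a spreads the smallness of the value at a over a disc, and a
    small enough disc contains no root of f but possibly a itself. *)
Lemma small_int_poly_near (a : C) (L Q : nat) : (0 < L)%N -> `|a| <= L%:R ->
  exists (f : {poly int}) (X : nat) (eta : R), [/\ (1 < X)%N, 0 < eta,
    forall z : C, `|z| <= L%:R -> `|(map_poly intr f).[z]| <= X%:R,
    forall z : C, `|z - a| < eta%:C -> `|(map_poly intr f).[z]| * X%:R ^+ Q <= 1 &
    forall z : C, `|z - a| < eta%:C -> z != a -> (map_poly intr f).[z] != 0].
Proof.
move=> L0 aL; have [f [X [f0 X1 fX fa]]] := small_value_int_poly Q L0 aL.
have [K K0 Kf] := horner_lipschitz (map_poly intr f) a.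
have [rs rsE] := closed_field_poly_normal (map_poly intr f : {poly C}).
have [eta0 e0 av] := avoid_roots a rs.
have X0 : 0 < X%:R :> R by rewrite ltr0n ltnW.
(* Half of the room X^(-Q) is for the value at a, the other half for the
   variation K eta1. *)
pose eta1 := (K * 2 * X%:R ^+ Q)^-1.
have e1 : 0 < eta1 by rewrite invr_gt0 !mulr_gt0 // exprn_gt0.
exists f, X, (Num.min (Num.min eta0 eta1) 1); split=> //.
- by rewrite !lt_min e0 e1 ltr01.
- move=> z za.
  have za1 : `|z - a| <= 1.
    by apply/ltW/(lt_le_trans za); rewrite -[leRHS](rmorph1 (real_complex R)) lecR ge_min lexx orbT.
  have zae : `|z - a| <= eta1%:C.
    by apply/ltW/(lt_le_trans za); rewrite lecR !ge_min lexx orbT.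
  have Kz : K%:C * `|z - a| * 2 * X%:R ^+ Q <= 1.
    have -> : K%:C * `|z - a| * 2 * X%:R ^+ Q = (K * 2 * X%:R ^+ Q)%:C * `|z - a|.
      by rewrite !(rmorphM (real_complex R)) (rmorphXn (real_complex R)) /= !(rmorph_nat (real_complex R)); ring.
    apply: le_trans (ler_wpM2l _ zae) _; first by rewrite lecR !mulr_ge0 ?exprn_ge0 // ltW.
    by rewrite -rmorphM /= mulfV // !mulf_neq0 ?expf_neq0 // gt_eqF.
  have h := Kf z za1.
  have XQ : 0 <= X%:R ^+ Q :> C by rewrite exprn_ge0.
  apply: le_trans (ler_wpM2r XQ h) _; rewrite mulrDl.
  rewrite -(@ler_pM2l _ 2) // mulr1 mulrDr -[leRHS](_ : 1 + 1 = 2) //.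
  have AC (u w : C) : 2 * (u * w) = u * 2 * w by ring.
  by rewrite !AC lerD.
- move=> z za zne; apply: contraNneq zne => fz; apply/eqP/av.
    by apply: lt_le_trans za _; rewrite lecR !ge_min lexx.
  have : root (map_poly intr f) z by apply/eqP.
  have lc0 : lead_coef (map_poly intr f : {poly C}) != 0.
    rewrite lead_coef_eq0; apply: contraNneq f0 => /polyP fp; apply/eqP/polyP => k.
    by have /eqP := fp k; rewrite coef_map !coef0 intr_eq0 => /eqP.
  by rewrite rsE rootZ // root_prod_XsubC.
Qed.

End SmallIntegerPolynomials.

(** * Integer matrices have few small singular values *)

Lemma prodr_const_seq (K : pzSemiRingType) (I : Type) (r : seq I) (P : pred I) (x : K) :
  \prod_(i <- r | P i) x = x ^+ count P r.
Proof. by rewrite big_const_seq -Monoid.iteropE. Qed.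

Lemma leq_expn_base m n e : (m <= n)%N -> (m ^ e <= n ^ e)%N.
Proof. by move=> mn; elim: e => // e IH; rewrite !expnS leq_mul. Qed.

Section ShiftBounds.
Local Open Scope complex_scope.
Variable C : numClosedFieldType.

Lemma sqr_normD_le (u v : C) : `|u + v| ^+ 2 <= 2 * (`|u| ^+ 2 + `|v| ^+ 2).
Proof.
apply: (@le_trans _ _ ((`|u| + `|v|) ^+ 2)).
  by apply: lerXn2r (ler_normD _ _); rewrite nnegrE // addr_ge0.
rewrite -subr_ge0 (_ : _ - _ = (`|u| - `|v|) ^+ 2); last by ring.
by rewrite real_exprn_even_ge0 // realB.
Qed.

Lemma sqnormD_le n (x y : 'rV[C]_n) : sqnorm (x + y) <= 2 * (sqnorm x + sqnorm y).
Proof.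
rewrite /sqnorm -big_split mulr_sumr; apply: ler_sum => j _.
by rewrite mxE sqr_normD_le.
Qed.

Lemma sqnormZ n (a : C) (x : 'rV[C]_n) : sqnorm (a *: x) = `|a| ^+ 2 * sqnorm x.
Proof. by rewrite /sqnorm mulr_sumr; apply: eq_bigr => j _; rewrite mxE normrM exprMn. Qed.

Lemma sqnorm_scalar_sub_le n (A : 'M[C]_n) (b K : C) :
  (forall x : 'rV_n, sqnorm (x *m A) <= K * sqnorm x) ->
  forall x : 'rV_n, sqnorm (x *m (b%:M - A)) <= 2 * (`|b| ^+ 2 + K) * sqnorm x.
Proof.
move=> AK x; rewrite mulmxBr mul_mx_scalar.
apply: le_trans (sqnormD_le _ _) _; rewrite -mulrA ler_pM2l // mulrDl sqnormZ.
by rewrite lerD2l -scaleN1r sqnormZ normrN1 expr1n mul1r.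
Qed.

(** Testing the norm bound on an eigenvector. *)
Lemma spectrum_bound n (A : 'M[C]_n) rs (K : C) z : 0 <= K ->
  char_poly A = \prod_(z <- rs) ('X - z%:P) ->
  (forall x : 'rV_n, sqnorm (x *m A) <= K ^+ 2 * sqnorm x) ->
  z \in rs -> `|z| <= K.
Proof.
move=> K0 eA AK zrs.
have : root (char_poly A) z by rewrite eA root_prod_XsubC.
rewrite -eigenvalue_root_char => /eigenvalueP[v vA v0].
have nv : 0 < sqnorm v.
  rewrite lt_def sqnorm_ge0 andbT; apply: contraNneq v0 => /sqnorm_eq0->.
  exact: eqxx.
have := AK v; rewrite vA sqnormZ ler_pM2r //.
by rewrite ler_pXn2r ?nnegrE.
Qed.

(** Choosing independent rows and then independent columns of the matrix
    formed by these rows. *)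
Lemma nonzero_full_minor (K : fieldType) n (B : 'M[K]_n) :
  exists f g : 'I_(\rank B) -> 'I_n,
    [/\ injective f, injective g & \det (mxsub f g B) != 0].
Proof.
pose f := maxrankfun B; pose B' := (rowsub f B)^T.
have fB' : row_full B'.
  by rewrite /row_full mxrank_tr; have := maxrowsub_free B; rewrite /row_free.
pose g := fullrankfun fB'.
exists f, g; split; [exact: maxrankfun_inj | exact: fullrankfun_inj |].
have : mxsub f g B = (rowsub g B')^T by apply/matrixP => i j; rewrite !mxE.
move=> ->; rewrite det_tr -unitfE -[_ \is a _]/(_ \in unitmx) -row_full_unit.
by rewrite /row_full mxrank_fullrowsub.
Qed.

(** This makes all the minors of w - A with given rows and columns, for
    varying w, the values of one integer polynomial. *)
Lemma horner_minor_char_poly n r (A : 'M[int]_n) (f g : 'I_r -> 'I_n) (w : C) :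
  (map_poly intr (\det (mxsub f g (char_poly_mx A)))).[w] =
  \det (mxsub f g (w%:M - map_mx intr A)).
Proof.
rewrite -det_map_mx -[LHS]/(horner_eval w _) -det_map_mx; congr (\det _).
apply/matrixP => i j; rewrite !mxE rmorphB rmorphMn /= map_polyX map_polyC /=.
by rewrite /horner_eval !hornerE hornerMn hornerX.
Qed.

End ShiftBounds.

Section UniformBounds.
Local Open Scope complex_scope.
Variable R : realType.
Local Notation C := R[i].

(** The norm is measured over C, as that of the operator on row vectors. *)
Definition int_bounded n (K : nat) (A : 'M[int]_n) : Prop :=
  forall x : 'rV[C]_n, sqnorm (x *m map_mx intr A) <= K%:R ^+ 2 * sqnorm x.

Lemma nat_bound (a : C) : exists K : nat, `|a| <= K%:R.
Proof.
exists (Num.bound (complex.Re `|a|)); rewrite -(rmorph_nat (real_complex R)).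
rewrite -[leLHS]RRe_real ?normr_real // lecR; apply/ltW.
by apply: le_lt_trans (archi_boundP _); rewrite ?ler_norm // -ler0c RRe_real ?normr_real.
Qed.

Lemma nat_bound_seq (s : seq C) : exists2 K : nat, (1 < K)%N & forall z, z \in s -> `|z| <= K%:R.
Proof.
elim: s => [|a s [K K2 IH]]; first by exists 2%N.
have [K' aK'] := nat_bound a; exists (K + K')%N; first by rewrite ltn_addr.
move=> z; rewrite inE => /orP[/eqP->|/IH zK].
  by apply: le_trans aK' _; rewrite ler_nat leq_addl.
by apply: le_trans zK _; rewrite ler_nat leq_addr.
Qed.

Lemma sqr_scalar_bound (b : C) (K L : nat) : `|b| <= L%:R ->
  2 * (`|b| ^+ 2 + K%:R ^+ 2) <= ((2 * (K + L)) ^ 2)%:R :> C.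
Proof.
move=> bL; apply: le_trans (_ : 2 * (L%:R ^+ 2 + K%:R ^+ 2) <= _).
  by rewrite ler_pM2l // lerD2r lerXn2r ?nnegrE.
by rewrite -!natrX -natrD -natrM ler_nat; nia.
Qed.

(** Let g be the integer polynomial whose value at a is a nonzero minor of
    a - A of maximal size. At every root b of P one has |g(b)|^2 <= L^(2n),
    and at a even |g(a)|^2 <= e^k L^(2n), where k counts the s in ]0, e]: the
    s that vanish are compensated by the corank. Since the product of the
    nonzero values of g at the roots of P is at least 1, it follows that
    1 <= e^k L^(2n deg P), and e = L^(-2 t deg P) gives k t <= n. *)
Lemma few_small_singular_values_at_integer (a : C) (P : {poly int}) (K : nat) :
  P \is monic -> root (map_poly intr P) a ->
  forall t : nat, exists2 e : C, 0 < e &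
    forall n (A : 'M[int]_n), int_bounded K A ->
    forall U s, singular_values (a%:M - map_mx intr A) U s ->
    (#|[set i | (0 < s i <= e)%R]| * t <= n)%N.
Proof.
move=> mP Pa t; have [rs rsE] := closed_field_poly_normal (map_poly intr P : {poly C}).
have mPC : map_poly intr P \is (@monic C) by apply: monic_map.
rewrite (monicP mPC) scale1r in rsE.
have [L0 L02 rsL] := nat_bound_seq rs.
pose L := (2 * (K + L0))%N; have L2 : (1 < L)%N by rewrite /L; lia.
have ars : a \in rs by move: Pa; rewrite rsE root_prod_XsubC.
pose q := ((size rs) * t)%N.
exists (L%:R ^+ 2 ^- q); first by rewrite invr_gt0 !exprn_gt0 // ltr0n ltnW.
move=> n A AK U s sB.
have LR1 : 1 < L%:R :> C by rewrite ltr1n.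
have L0' : 0 < L%:R :> C by rewrite ltr0n ltnW.
set e := _ ^- q.
have e0 : 0 <= e by rewrite invr_ge0 !exprn_ge0.
have eM : e <= L%:R ^+ 2.
  apply: (@le_trans _ _ 1); last by rewrite exprn_ege1 // ltW.
  by rewrite invf_le1 ?exprn_gt0 // !exprn_ege1 // ltW.
have bound b : b \in rs -> forall x : 'rV_n,
    sqnorm (x *m (b%:M - map_mx intr A)) <= L%:R ^+ 2 * sqnorm x.
  move=> brs x; apply: le_trans (sqnorm_scalar_sub_le b AK x) _.
  by rewrite ler_wpM2r ?sqnorm_ge0 // -[L%:R ^+ 2]natrX sqr_scalar_bound ?rsL.
set B := a%:M - _ in sB; set k := #|_|.
have [f [g [fi gi mn0]]] := nonzero_full_minor B.
set r := \rank B in f g fi gi mn0.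
pose G := \det (mxsub f g (char_poly_mx A)).
have GE w : (map_poly intr G).[w] = \det (mxsub f g (w%:M - map_mx intr A)) :> C.
  exact: horner_minor_char_poly.
have rn : (r <= n)%N by apply: rank_leq_row.
(* At an arbitrary root the whole space serves as U. *)
have Gb b : b \in rs -> `|(map_poly intr G).[b]| ^+ 2 <= (L%:R ^+ 2) ^+ n :> C.
  move=> brs; rewrite GE.
  apply: le_trans (minor_le_small_space (e := L%:R ^+ 2) (M := L%:R ^+ 2) (U := 1%:M) (u := r) fi gi _ _ _ (bound b brs) _) _ => //.
  - by rewrite mxrank1 addnC.
  - by move=> x _; apply: bound.
  rewrite subnn mulr1; apply: ler_weXn2l => //.
  by rewrite exprn_ege1 // ltW.
(* The span of the singular vectors with s <= e has dimension k + (n - r), so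
   that restricting it to r coordinates leaves a space of dimension k. *)
have Ga : `|(map_poly intr G).[a]| ^+ 2 <= e ^+ k * (L%:R ^+ 2) ^+ n :> C.
  rewrite GE.
  have [|W [fW WB]] := small_singular_space (e := e) (S := [set i | (s i <= e)%R]) sB.
    by move=> i; rewrite inE.
  apply: le_trans (minor_le_small_space (u := k) fi gi e0 eM _ (bound a ars) WB) _.
    move: fW; rewrite /row_free => /eqP ->.
    have -> : [set i | s i <= e] = [set i | (0 < s i <= e)%R] :|: [set i | s i == 0].
      apply/setP => i; rewrite !inE; have s0 : 0 <= s i by case: sB.
      by rewrite lt_def s0 andbT; case: (eqVneq (s i) 0) => [->|_]; rewrite ?e0 /= ?orbF.
    rewrite cardsU (_ : _ :&: _ = finset.set0) ?cards0 ?subn0; last first.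
      by apply/setP => i; rewrite !inE lt_def; case: eqP => //; rewrite !andbF.
    by rewrite (card_zero_singular sB) -/k -/r -addnA subnK.
  rewrite ler_wpM2l ?exprn_ge0 //; apply: ler_weXn2l.
    by rewrite exprn_ege1 // ltW.
  by apply: leq_trans rn; apply: leq_subr.
(* The roots of P are the eigenvalues of its companion matrix. *)
have cP : char_poly (map_mx intr (companionmx P) : 'M[C]_((size P).-1)) =
    \prod_(z <- rs) ('X - z%:P).
  by rewrite -map_char_poly companionmxK.
have := prod_nonzero_values_ge1 G cP.
rewrite (perm_big _ (perm_to_rem ars)) big_cons GE mn0 -GE.
set rs' := rem a rs; set Pi := \prod_(_ <- _ | _) _ => h.
have Pi_le : Pi ^+ 2 <= ((L%:R ^+ 2) ^+ n) ^+ size rs'.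
  rewrite /Pi -prodrXl.
  have -> : ((L%:R ^+ 2) ^+ n) ^+ size rs' = \prod_(z <- rs') ((L%:R ^+ 2) ^+ n) :> C.
    by rewrite prodr_const_seq count_predT.
  rewrite big_mkcond /= big_seq_cond [leRHS]big_seq_cond; apply: ler_prod => z.
  rewrite andbT => zrs'; have zrs : z \in rs := mem_rem zrs'.
  case: ifP => _; last by rewrite ler01 !exprn_ege1 // ltW.
  by rewrite exprn_ge0 //= Gb.
have Pi0 : 0 <= Pi by apply: prodr_ge0.
have : 1 <= e ^+ k * (L%:R ^+ 2) ^+ n * ((L%:R ^+ 2) ^+ n) ^+ size rs'.
  apply: (@le_trans _ _ ((`|(map_poly intr G).[a]| * Pi) ^+ 2)).
    by rewrite exprn_ege1.
  by rewrite exprMn ler_pM ?exprn_ge0.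
rewrite -mulrA -exprS /rs' size_rem // prednK; last by case: (rs) ars.
rewrite /e exprVn -!exprM mulrC ler_pdivlMr ?exprn_gt0 // mul1r.
rewrite ler_eXn2l // -!mulnA leq_pmul2l // /q.
have : (0 < size rs)%N by case: (rs) ars.
move: (size rs) => m m0.
by rewrite [(n * m)%N]mulnC leq_pmul2l // mulnC.
Qed.

(** Let f be an integer polynomial that is at most X on the disc of radius L
    and at most X^(-Q) near a. As a is not an eigenvalue of A, the values of f
    at the eigenvalues near a do not vanish, and the product of the nonzero
    values over all the eigenvalues is at least 1. If N eigenvalues are near a
    this gives 1 <= X^(n - Q N). *)
Lemma few_eigenvalues_near_nonintegral (a : C) (K Q : nat) :
  ~ integralOver (intr : int -> C) a ->
  exists2 eta : R, 0 < eta &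
    forall n (A : 'M[int]_n) rs, int_bounded K A ->
    char_poly (map_mx intr A : 'M[C]_n) = \prod_(z <- rs) ('X - z%:P) ->
    (count (fun z => `|z - a| < eta%:C)%R rs * Q <= n)%N.
Proof.
move=> a_nint; have [L0 aL0] := nat_bound a; pose L := (K + L0).+1.
have aL : `|a| <= L%:R by apply: le_trans aL0 _; rewrite ler_nat /L; lia.
have [f [X [eta [X1 eta0 fX fnear fne]]]] := small_int_poly_near Q (ltn0Sn _) aL.
exists eta => // n A rs AK eA; set near := fun z => _.
pose F z : C := (map_poly intr f).[z].
have XC : 1 < X%:R :> C by rewrite ltr1n.
have X0 : 0 < X%:R :> C by rewrite ltr0n ltnW.
have szrs := size_spectrum eA.
have rsL z : z \in rs -> `|F z| <= X%:R.
  move=> zrs; apply: fX; apply: (@le_trans _ _ K%:R).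
    by apply: spectrum_bound AK zrs.
  by rewrite ler_nat /L; lia.
have rsa z : z \in rs -> z != a.
  move=> zrs; apply/eqP => za; apply: a_nint; exists (char_poly A).
    exact: char_poly_monic.
  by rewrite map_char_poly eA root_prod_XsubC -za.
have := prod_nonzero_values_ge1 f eA.
rewrite big_mkcond (bigID near) /= => h.
have : 1 <= \prod_(z <- rs | near z) (X%:R ^- Q) * \prod_(z <- rs | ~~ near z) X%:R :> C.
  apply: le_trans h _; apply: ler_pM.
  - by apply: prodr_ge0 => z _; case: ifP.
  - by apply: prodr_ge0 => z _; case: ifP.
  - rewrite big_seq_cond [leRHS]big_seq_cond; apply: ler_prod => z /andP[zrs zn].
    rewrite (fne z zn (rsa z zrs)) normr_ge0 /=.
    by rewrite -[leRHS]mul1r ler_pdivlMr ?exprn_gt0 // fnear.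
  - rewrite big_seq_cond [leRHS]big_seq_cond; apply: ler_prod => z /andP[zrs zn].
    by case: ifP => _; rewrite ?normr_ge0 ?rsL // ler01 ltW.
rewrite !prodr_const_seq => {}h.
have : 1 <= (X%:R ^- Q) ^+ count near rs * X%:R ^+ n :> C.
  apply: le_trans h _; rewrite ler_wpM2l ?exprn_ge0 ?invr_ge0 ?exprn_ge0 //.
  apply: ler_weXn2l; first exact: ltW.
  by rewrite -szrs count_size.
rewrite exprVn -exprM mulrC ler_pdivlMr ?exprn_gt0 // mul1r ler_eXn2l //.
by rewrite mulnC.
Qed.

(** Let N be the number of eigenvalues of A at distance less than eta from a,
    so that 2 t N <= n. On the circle of radius rho = beta^(-4 t) around a
    there is a point w with |det (w - A)| >= rho^N beta^(-n), because the N
    near eigenvalues contribute at least rho^N there and each of the other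
    ones at least 1 / beta. If k of the s are at most rho^2, then w - A
    contracts a space of dimension k by a factor of order rho, and
    |det (w - A)|^2 <= rho^(2k) beta^(2n). Comparing the exponents of beta
    gives 8 t k <= 4 n + 8 t N <= 8 n. *)
Lemma few_small_singular_values_off_integers (a : C) (K : nat) :
  ~ integralOver (intr : int -> C) a ->
  forall t : nat, (0 < t)%N -> exists2 e : C, 0 < e &
    forall n (A : 'M[int]_n), int_bounded K A ->
    forall U s, singular_values (a%:M - map_mx intr A) U s ->
    (#|[set i | (s i <= e)%R]| * t <= n)%N.
Proof.
move=> a_nint t t0.
have [eta eta0 few] := few_eigenvalues_near_nonintegral K (2 * t) a_nint.
have [L0 aL0] := nat_bound (`|a| + 1); pose L := (2 * (K + L0)).+2.
rewrite ger0_norm ?addr_ge0 // in aL0.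
have LR (w : C) : `|w - a| <= 1 -> 2 * (`|w| ^+ 2 + K%:R ^+ 2) <= L%:R ^+ 2.
  move=> wa; apply: le_trans (sqr_scalar_bound K (_ : _ <= L0%:R)) _.
    apply: le_trans aL0; rewrite -[w](subrK a) [leRHS]addrC.
    by apply: le_trans (ler_normD _ _) _; rewrite lerD2r.
  by rewrite -natrX ler_nat leq_exp2r // /L; lia.
(* With 2 / beta <= eta and rho <= 1 / beta, a point of the circle is at
   distance at least 1 / beta from all eigenvalues outside the disc of radius
   eta. *)
pose b0 := Num.bound (2 / eta); pose beta := (b0 + 2 * L)%N.
have beta2 : (2 * L <= beta)%N by apply: leq_addl.
have beta1 : (1 < beta)%N by apply: leq_trans beta2; rewrite /L; lia.
have bC0 : 0 < beta%:R :> C by rewrite ltr0n ltnW.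
have bC1 : 1 < beta%:R :> C by rewrite ltr1n.
have beta_eta : 2 / beta%:R <= eta%:C.
  have -> : 2 / beta%:R = (2 / beta%:R)%:C :> C.
    by rewrite (rmorphM (real_complex R)) fmorphV !(rmorph_nat (real_complex R)).
  have bR0 : 0 < beta%:R :> R by rewrite ltr0n ltnW.
  rewrite lecR ler_pdivrMr // mulrC -ler_pdivrMr //; apply/ltW.
  apply: lt_le_trans (archi_boundP _) _; first by rewrite divr_ge0 // ltW.
  by rewrite ler_nat leq_addr.
pose p := (4 * t)%N; pose rho : C := beta%:R ^- p.
have rho0 : 0 < rho by rewrite invr_gt0 exprn_gt0.
have rhob : rho <= beta%:R^-1.
  rewrite lef_pV2 ?posrE ?exprn_gt0 // -[leLHS]expr1; apply: ler_weXn2l; first exact: ltW.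
  by rewrite /p; lia.
have rho1 : rho <= 1 by apply: le_trans rhob _; rewrite invf_le1 // ltW.
exists (rho ^+ 2); first by rewrite exprn_gt0.
move=> n A AK U s sB; set k := #|_|.
have [rs eA] := char_poly_prod (map_mx intr A : 'M[C]_n).
have szrs := size_spectrum eA.
pose near (z : C) := `|z - a| < eta%:C.
have fewn : (count near rs * (2 * t) <= n)%N by apply: few eA.
have kn : (k <= n)%N by rewrite -[leqRHS](card_ord n) max_card.
have [w wa hw] := max_on_circle_ge [seq z <- rs | near z] a rho0.
have w1 : `|w - a| <= 1 by rewrite wa.
have lower : rho ^+ count near rs * beta%:R ^- n <= `|\det (w%:M - map_mx intr A)|.
  rewrite -horner_char_poly eA horner_prod normr_prod (bigID near) /=.
  have rho_ge0 := ltW rho0.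
  apply: ler_pM; rewrite ?exprn_ge0 ?invr_ge0 ?exprn_ge0 //.
    rewrite size_filter big_filter in hw; apply: le_trans hw _.
    by apply: ler_prod => z _; rewrite hornerXsubC normr_ge0 lexx.
  apply: (@le_trans _ _ (\prod_(z <- rs | ~~ near z) beta%:R^-1)).
    rewrite prodr_const_seq -exprVn -szrs.
    apply: ler_wiXn2l; rewrite ?invr_ge0 //; last exact: count_size.
    by rewrite invf_le1 // ltW.
  apply: ler_prod => z zn; rewrite invr_ge0 ler0n hornerXsubC /=.
  rewrite /near -real_leNgt ?normr_real ?ger0_real ?ler0c ?(ltW eta0) // in zn.
  have dist : `|z - a| <= `|w - z| + rho.
    by rewrite -wa (distrC w z); apply: ler_distD.
  rewrite -(lerD2r rho); apply: le_trans dist; apply: le_trans zn.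
  by apply: le_trans beta_eta; rewrite mulrDl mul1r lerD2l.
have e4 : 2 * (rho ^+ 2 + rho ^+ 2) <= L%:R ^+ 2.
  have r2 : rho ^+ 2 <= 1 by rewrite exprn_ile1 // ltW.
  apply: (@le_trans _ _ (2 * (1 + 1))); first by rewrite ler_pM2l // lerD.
  rewrite -natrX -(natrD _ 1 1) -natrM ler_nat; apply: (@leq_trans (2 ^ 2)) => //.
  by rewrite leq_exp2r.
have e40 : 0 <= 2 * (rho ^+ 2 + rho ^+ 2).
  by rewrite mulr_ge0 // addr_ge0 // exprn_ge0 // (ltW rho0).
have [|W [fW WB]] := small_singular_space (e := rho ^+ 2) (S := [set i | (s i <= rho ^+ 2)%R]) sB.
  by move=> i; rewrite inE.
(* Moving from a to w changes a vector x by (w - a) x, of norm rho |x|. *)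
have upper : `|\det (w%:M - map_mx intr A)| ^+ 2 <=
    (2 * (rho ^+ 2 + rho ^+ 2)) ^+ k * (L%:R ^+ 2) ^+ (n - k).
  apply: (det_le_small_space (U := W)) => //.
  - by move: fW; rewrite /row_free => /eqP ->.
  - move=> x; apply: le_trans (sqnorm_scalar_sub_le w AK x) _.
    by rewrite ler_wpM2r ?sqnorm_ge0 // LR.
  move=> x xW; have -> : x *m (w%:M - map_mx intr A) =
      x *m (a%:M - map_mx intr A) + (w - a) *: x.
    by rewrite !mulmxBr !mul_mx_scalar scalerBl addrAC addrCA subrr addr0.
  apply: le_trans (sqnormD_le _ _) _; rewrite -mulrA ler_pM2l // mulrDl.
  by rewrite lerD ?WB // sqnormZ wa.
have : (rho ^+ count near rs * beta%:R ^- n) ^+ 2 <= (beta%:R ^+ 2) ^+ n * (rho ^+ 2) ^+ k.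
  apply: le_trans (_ : `|\det (w%:M - map_mx intr A)| ^+ 2 <= _).
    apply: lerXn2r lower; rewrite nnegrE // mulr_ge0 ?exprn_ge0 ?invr_ge0 ?exprn_ge0 // (ltW rho0).
  apply: le_trans upper _.
  have -> : 2 * (rho ^+ 2 + rho ^+ 2) = 4%:R * rho ^+ 2 by ring.
  rewrite exprMn mulrAC ler_wpM2r ?exprn_ge0 //; first exact: ltW.
  rewrite -!natrX -!natrM ler_nat.
  apply: (@leq_trans ((4 * L ^ 2) ^ k * (4 * L ^ 2) ^ (n - k))).
    by apply: leq_mul; rewrite expnMn ?leq_pmulr ?leq_pmull // !expn_gt0.
  rewrite -expnD subnKC // -[(4 * _)%N]/(2 ^ 2 * _)%N -expnMn.
  by apply: leq_expn_base; rewrite leq_exp2r.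
set N := count near rs in fewn *.
have e1 : (rho ^+ N * beta%:R ^- n) ^+ 2 * beta%:R ^+ ((p * N + n) * 2) = 1.
  rewrite /rho exprVn -exprM -invfM -exprD exprVn -exprM mulVf //.
  by rewrite expf_neq0 // gt_eqF.
have e2 : (rho ^+ 2) ^+ k * beta%:R ^+ (p * 2 * k) = 1.
  by rewrite /rho !exprVn -!exprM mulnA mulVf // expf_neq0 // gt_eqF.
set A2 := (rho ^+ N * beta%:R ^- n) ^+ 2 in e1 *; set E2 := (rho ^+ 2) ^+ k in e2 * => h.
have : beta%:R ^+ (p * 2 * k) <= (beta%:R ^+ 2) ^+ n * beta%:R ^+ ((p * N + n) * 2) :> C.
  have pos : 0 <= beta%:R ^+ ((p * N + n) * 2) * beta%:R ^+ (p * 2 * k) :> C.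
    by rewrite mulr_ge0 ?exprn_ge0.
  have := ler_wpM2r pos h; rewrite mulrA e1 mul1r => /le_trans; apply.
  rewrite le_eqVlt; apply/orP; left; apply/eqP.
  move: e2; set x := beta%:R ^+ (p * 2 * k); set y := beta%:R ^+ ((p * N + n) * 2) => e2.
  by rewrite -mulrA [E2 * _]mulrCA e2 mulr1.
rewrite -exprM -exprD ler_eXn2l // /p => h2.
have t1 : (4 * t * 2 * k = 8 * (k * t))%N by ring.
have t2 : (2 * n + (4 * t * N + n) * 2 = 4 * n + 4 * (N * (2 * t)))%N by ring.
rewrite t1 t2 in h2; clear -h2 fewn; move: (k * t)%N (N * (2 * t))%N h2 fewn => u1 u2 h2 fewn; lia.
Qed.

End UniformBounds.

(** * Finitely supported vectors over a group *)

Section Letters.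
Variables (G : groupType) (I : finType).

Section Accessors.
Variable K : Type.
(** A letter (g, i, j, z) stands for the matrix with the single nonzero entry
    z g, in row i and column j. A matrix over the group ring is a list of
    letters, with sums as concatenations, and each letter acts through any
    action of the group. *)
Definition letter := (G * I * I * K)%type.
Definition lg (t : letter) : G := t.1.1.1.
Definition li (t : letter) : I := t.1.1.2.
Definition lj (t : letter) : I := t.1.2.
Definition lc (t : letter) : K := t.2.
End Accessors.

Variable C : numClosedFieldType.
Implicit Types (L : seq (letter C)) (u v : seq ((I * G) * C)).

(** The same formula gives the operator on functions on I * G, with G acting
    on itself by left multiplication by inverses, and its finite models, where
    a permutation takes the place of each group element. *)
Definition letter_op (X : eqType) (act : G -> X -> X) L (y : I * X -> C) : I * X -> C :=
  fun p => \sum_(t <- L | li t == p.1) lc t * y (lj t, act (lg t) p.2).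

Definition adj L : seq (letter C) :=
  [seq ((lg t)^-1%g, lj t, li t, (lc t)^*) | t <- L].

(** An upper bound for the operator norm, valid in all the models at once. *)
Definition weight L : C := \sum_(t <- L) `|lc t|.

Definition sq_sums_le (T : eqType) (y : T -> C) (K : C) : Prop :=
  forall s : seq T, uniq s -> \sum_(p <- s) `|y p| ^+ 2 <= K.

Lemma weight_ge0 L : 0 <= weight L.
Proof. by apply: sumr_ge0. Qed.

Lemma weight_adj L : weight (adj L) = weight L.
Proof. by rewrite /weight big_map; apply: eq_bigr => t _; rewrite norm_conjC. Qed.

(** The Cauchy-Schwarz inequality for the measure with weights w, between b
    and the constant 1. *)
Lemma weighted_cauchy (T : Type) (r : seq T) (P : pred T) (w b : T -> C) :
  (forall t, 0 <= w t) -> (forall t, 0 <= b t) ->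
  (\sum_(t <- r | P t) w t * b t) ^+ 2 <=
  (\sum_(t <- r | P t) w t) * \sum_(t <- r | P t) w t * b t ^+ 2.
Proof.
move=> w0 b0; elim: r => [|x r IH]; first by rewrite !big_nil expr0n mulr0.
rewrite !big_cons; case: ifP => // _.
set W := \sum_(_ <- _ | _) w _ in IH *; set B := \sum_(_ <- _ | _) _ * _ in IH *.
set D := \sum_(_ <- _ | _) _ * _ ^+ 2 in IH *.
have W0 : 0 <= W by apply: sumr_ge0.
have B0 : 0 <= B by apply: sumr_ge0 => t _; rewrite mulr_ge0.
have D0 : 0 <= D by apply: sumr_ge0 => t _; rewrite mulr_ge0 ?exprn_ge0.
(* Twice the mixed product is bounded by summing w t (b x - b t)^2 >= 0. *)
have key : 2 * b x * B <= W * b x ^+ 2 + D.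
  rewrite -subr_ge0 /W /D /B mulr_suml mulr_sumr -sumrN -!big_split /=.
  apply: sumr_ge0 => t _.
  rewrite (_ : _ + _ = w t * (b x - b t) ^+ 2); last by ring.
  by rewrite mulr_ge0 // real_exprn_even_ge0 // realB ?ger0_real.
rewrite -subr_ge0.
rewrite (_ : _ - _ = (W * D - B ^+ 2) + w x * (W * b x ^+ 2 + D - 2 * b x * B)); last by ring.
by rewrite addr_ge0 ?subr_ge0 // mulr_ge0 ?subr_ge0.
Qed.

(** The norm of the operator is at most its weight (Schur test): group the
    terms with weights the moduli of the coefficients, and use that each
    letter moves points injectively. *)
Lemma sq_sums_letter_op (X : eqType) (act : G -> X -> X) L y K :
  (forall g, injective (act g)) ->
  sq_sums_le y K -> sq_sums_le (letter_op act L y) (weight L ^+ 2 * K).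
Proof.
move=> actI yK s us.
apply: (@le_trans _ _ (\sum_(p <- s) weight L *
    \sum_(t <- L | li t == p.1) `|lc t| * `|y (lj t, act (lg t) p.2)| ^+ 2)).
  apply: ler_sum => p _.
  apply: (@le_trans _ _ ((\sum_(t <- L | li t == p.1) `|lc t| * `|y (lj t, act (lg t) p.2)|) ^+ 2)).
    apply: lerXn2r; rewrite ?nnegrE //; first by apply: sumr_ge0 => t _; rewrite mulr_ge0.
    apply: le_trans (ler_norm_sum _ _ _) _.
    by apply: ler_sum => t _; rewrite normrM.
  apply: le_trans (weighted_cauchy _ _ _ _) _ => //.
  apply: ler_wpM2r; first by apply: sumr_ge0 => t _; rewrite mulr_ge0 ?exprn_ge0.
  by rewrite /weight [leRHS](bigID (fun t => li t == p.1)) /= lerDl sumr_ge0.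
rewrite -mulr_sumr expr2 -mulrA ler_wpM2l ?weight_ge0 //.
rewrite (exchange_big_dep xpredT) //= /weight mulr_suml.
apply: ler_sum => t _; rewrite -mulr_sumr ler_wpM2l //.
rewrite -big_filter -(big_map (fun p => (lj t, act (lg t) p.2)) predT (fun p => `|y p| ^+ 2)).
apply: yK; rewrite map_inj_in_uniq ?filter_uniq // => -[i p] [j q].
rewrite !mem_filter /= => /andP[/eqP <- _] /andP[/eqP <- _] [] /actI ->.
by [].
Qed.

Implicit Types (y : I * G -> C).

Definition left_shift (g h : G) : G := (g^-1 * h)%g.

(** The action of the letters on vectors that are formal linear combinations
    of basis vectors, given by lists. Adjointness and self-adjointness then
    become identities between finite sums, and the support of a vector can be
    traced letter by letter. *)
Definition vact L u : seq ((I * G) * C) :=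
  [seq ((li t, (lg t * q.1.2)%g), (lj t == q.1.1)%:R * (lc t * q.2)) | t <- L, q <- u].

Definition vscale (c : C) u : seq ((I * G) * C) := [seq (q.1, c * q.2) | q <- u].

Definition ev u : I * G -> C := fun p => \sum_(q <- u | q.1 == p) q.2.

Definition vdot u y : C := \sum_(q <- u) q.2 * (y q.1)^*.

Definition vsqnorm u : C := vdot u (ev u).

Lemma left_shift_inj g : injective (left_shift g).
Proof. exact: mulgI. Qed.

Lemma vdot_vact L u y : vdot (vact L u) y = vdot u (letter_op left_shift (adj L) y).
Proof.
rewrite /vdot /vact big_allpairs_dep exchange_big /=; apply: eq_bigr => q _.
rewrite /letter_op /adj big_map /= rmorph_sum mulr_sumr [RHS]big_mkcond /=.
apply: eq_bigr => t _; rewrite /li /lj /lg /lc /=; case: eqP => _; last by rewrite !mul0r.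
by rewrite rmorphM /= conjCK /left_shift invgK mul1r; ring.
Qed.

Lemma letter_op_adjK L y : letter_op left_shift (adj (adj L)) y =1 letter_op left_shift L y.
Proof.
move=> p; rewrite /letter_op /adj !big_map; apply: eq_bigr => t _ /=.
by rewrite /lc /lg /= conjCK invgK.
Qed.

Lemma letter_op_ext L y y' : y =1 y' -> letter_op left_shift L y =1 letter_op left_shift L y'.
Proof. by move=> yy p; apply: eq_bigr => t _; rewrite yy. Qed.

Lemma vdot_ext u y y' : y =1 y' -> vdot u y = vdot u y'.
Proof. by move=> yy; apply: eq_bigr => t _; rewrite yy. Qed.

Lemma ev_vact L u : ev (vact L u) =1 letter_op left_shift L (ev u).
Proof.
move=> p; rewrite /ev /vact big_mkcond big_allpairs_dep /letter_op [RHS]big_mkcond /=.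
apply: eq_bigr => t _; case: p => i g /=; have [<-|ne] := eqVneq (li t) i; last first.
  rewrite big1 // => q _; case: eqP => // -[e _]; by rewrite e eqxx in ne.
rewrite mulr_sumr [RHS]big_mkcond; apply: eq_bigr => -[[j h] z] _ /=.
rewrite !xpair_eqE eqxx /= [j == _]eq_sym.
have -> : ((lg t * h)%g == g) = (h == left_shift (lg t) g).
  by apply/eqP/eqP => [<-|->]; rewrite /left_shift ?mulKg ?mulKVg.
by case: eqP => _; case: eqP => _ //=; rewrite ?mul1r ?mul0r.
Qed.

Lemma ev_cat u v p : ev (u ++ v) p = ev u p + ev v p.
Proof. exact: big_cat. Qed.

Lemma ev_vscale c u p : ev (vscale c u) p = c * ev u p.
Proof. by rewrite /ev big_map mulr_sumr. Qed.

Lemma vdot_cat u v y : vdot (u ++ v) y = vdot u y + vdot v y.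
Proof. exact: big_cat. Qed.

Lemma vdot_vscale c u y : vdot (vscale c u) y = c * vdot u y.
Proof. by rewrite /vdot big_map mulr_sumr; apply: eq_bigr => q _; rewrite mulrA. Qed.

Lemma vdotD u y z : vdot u (fun p => y p + z p) = vdot u y + vdot u z.
Proof. by rewrite /vdot -big_split; apply: eq_bigr => q _; rewrite rmorphD mulrDr. Qed.

Lemma vdotZ u c y : vdot u (fun p => c * y p) = c^* * vdot u y.
Proof. by rewrite /vdot mulr_sumr; apply: eq_bigr => q _; rewrite rmorphM /= mulrCA. Qed.

Lemma ev_notin u p : p \notin map fst u -> ev u p = 0.
Proof.
move=> pu; rewrite /ev big_seq_cond big1 // => q /andP[qu /eqP qp].
by case/negP: pu; rewrite -qp; apply: map_f.
Qed.

Lemma vdot_sum u y (s : seq (I * G)) : uniq s -> {subset map fst u <= s} ->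
  vdot u y = \sum_(p <- s) ev u p * (y p)^*.
Proof.
move=> us sub; under eq_bigr do rewrite mulr_suml.
rewrite (exchange_big_dep xpredT) //= /vdot big_seq [RHS]big_seq.
apply: eq_bigr => q qu; rewrite -big_filter.
rewrite (_ : [seq p <- s | q.1 == p] = [:: q.1]) ?big_seq1 //.
rewrite (@eq_filter _ _ (pred1 q.1)) => [|p]; last by rewrite /= eq_sym.
by rewrite filter_pred1_uniq ?sub // map_f.
Qed.

Lemma vsqnormE u (s : seq (I * G)) : uniq s -> {subset map fst u <= s} ->
  vsqnorm u = \sum_(p <- s) `|ev u p| ^+ 2.
Proof. by move=> us sub; rewrite /vsqnorm (vdot_sum _ us sub); apply: eq_bigr => p _; rewrite normCK. Qed.

Lemma sub_undup u : {subset map fst u <= undup (map fst u)}.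
Proof. by move=> p; rewrite mem_undup. Qed.

Lemma vsqnorm_ge0 u : 0 <= vsqnorm u.
Proof.
rewrite (vsqnormE (undup_uniq _) (@sub_undup u)); apply: sumr_ge0 => p _.
exact: exprn_ge0.
Qed.

Lemma vsqnorm_le u K : sq_sums_le (ev u) K -> vsqnorm u <= K.
Proof.
by move=> uK; rewrite (vsqnormE (undup_uniq _) (@sub_undup u)); apply/uK/undup_uniq.
Qed.

Lemma sq_sums_ev u : sq_sums_le (ev u) (vsqnorm u).
Proof.
move=> s us; set s' := undup (map fst u); pose S := undup (s ++ s').
have sS : {subset map fst u <= S}.
  by move=> p pu; rewrite /S mem_undup mem_cat [p \in s']mem_undup pu orbT.
rewrite (vsqnormE (undup_uniq _) sS).
rewrite [leRHS](bigID (mem s)) /= -[leRHS]addr0 -/S.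
have -> : \sum_(p <- s) `|ev u p| ^+ 2 = \sum_(p <- S | p \in s) `|ev u p| ^+ 2.
  rewrite -[RHS]big_filter; apply: perm_big; apply: uniq_perm => //.
    by rewrite filter_uniq // undup_uniq.
  by move=> p; rewrite mem_filter mem_undup mem_cat; case: (p \in s).
by rewrite addr0 lerDl; apply: sumr_ge0 => p _; apply: exprn_ge0.
Qed.

Lemma vsqnorm_vact L u : vsqnorm (vact L u) <= weight L ^+ 2 * vsqnorm u.
Proof.
apply: vsqnorm_le => s us; under eq_bigr do rewrite ev_vact.
exact: (sq_sums_letter_op L left_shift_inj (@sq_sums_ev u)) us.
Qed.

Lemma sq_sums_ge0 (T : eqType) (y : T -> C) K : sq_sums_le y K -> 0 <= K.
Proof. by move=> yK; have := yK [::] isT; rewrite big_nil. Qed.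

(** The Cauchy-Schwarz inequality against a function that need not have finite
    support. *)
Lemma vdot_cauchy u y K : sq_sums_le y K -> `|vdot u y| ^+ 2 <= vsqnorm u * K.
Proof.
move=> yK; have K0 := sq_sums_ge0 yK.
rewrite (vdot_sum y (undup_uniq _) (@sub_undup u)) (vsqnormE (undup_uniq _) (@sub_undup u)).
set s := undup _; have us : uniq s by apply: undup_uniq.
apply: (@le_trans _ _ ((\sum_(p <- s) `|ev u p| * `|y p|) ^+ 2)).
  apply: lerXn2r; rewrite ?nnegrE //; first by apply: sumr_ge0 => t _; rewrite mulr_ge0.
  apply: le_trans (ler_norm_sum _ _ _) _; apply: ler_sum => p _.
  by rewrite normrM norm_conjC.
apply: (@le_trans _ _ ((\sum_(p <- s) `|ev u p| ^+ 2) * \sum_(p <- s) `|y p| ^+ 2)).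
  elim: (s) => [|p r IH]; first by rewrite !big_nil expr0n mulr0.
  rewrite !big_cons.
  set A := \sum_(_ <- _) _ ^+ 2 in IH *; set B := \sum_(_ <- _) _ * _ in IH *.
  set D := \sum_(_ <- _) `|y _| ^+ 2 in IH *.
  have key : 2 * (`|ev u p| * `|y p|) * B <= `|ev u p| ^+ 2 * D + A * `|y p| ^+ 2.
    rewrite -subr_ge0 /A /B /D mulr_sumr mulr_sumr mulr_suml -sumrN -!big_split /=.
    apply: sumr_ge0 => t _.
    rewrite (_ : _ + _ = (`|ev u p| * `|y t| - `|ev u t| * `|y p|) ^+ 2); last by ring.
    by rewrite real_exprn_even_ge0 // realB ?ger0_real // mulr_ge0.
  rewrite -subr_ge0 (_ : _ - _ = (A * D - B ^+ 2) +
     (`|ev u p| ^+ 2 * D + A * `|y p| ^+ 2 - 2 * (`|ev u p| * `|y p|) * B)); last by ring.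
  by rewrite addr_ge0 ?subr_ge0.
by rewrite ler_wpM2l ?yK // sumr_ge0 // => p _; rewrite exprn_ge0.
Qed.

Variables (c : C) (L : seq (letter C)).

(** With B the operator given by L, this is T = 1 - c B^* B, on formal
    combinations and on functions. *)
Definition vcontract u := u ++ vscale (- c) (vact (adj L) (vact L u)).
Definition fcontract y : I * G -> C := fun p => y p - c * letter_op left_shift (adj L) (letter_op left_shift L y) p.

Hypothesis c_ge0 : 0 <= c.
Hypothesis c_small : c * weight L ^+ 2 <= 1.

Lemma cNJ : (- c)^* = - c.
Proof. by apply/CrealP; rewrite realN; apply: ger0_real. Qed.

Lemma ev_vcontract u : ev (vcontract u) =1 fcontract (ev u).
Proof.
move=> p; rewrite ev_cat ev_vscale mulNr ev_vact; congr (_ - c * _).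
by apply: letter_op_ext; apply: ev_vact.
Qed.

Lemma vdot_vcontract u y : vdot (vcontract u) y = vdot u (fcontract y).
Proof.
rewrite vdot_cat vdot_vscale 2!vdot_vact /fcontract.
rewrite [RHS](_ : _ = vdot u (fun p => y p + (- c) * letter_op left_shift (adj L) (letter_op left_shift L y) p)).
  rewrite vdotD vdotZ cNJ; congr (_ + _ * _); apply: vdot_ext.
  by apply: letter_op_ext; apply: letter_op_adjK.
by apply: vdot_ext => p; rewrite mulNr.
Qed.

(** With T = 1 - c B^* B one has |T u|^2 = |u|^2 - 2 c |B u|^2 +
    c^2 |B^* B u|^2, and the last term is at most c |B u|^2 when c |B|^2 <= 1.
    The gain c |B u|^2 makes the limit of the powers lie in the kernel of B. *)
Lemma vsqnorm_vcontract u : vsqnorm (vcontract u) <= vsqnorm u - c * vsqnorm (vact L u).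
Proof.
pose w := vact (adj L) (vact L u).
have e1 : vdot w (ev u) = vsqnorm (vact L u).
  rewrite /w vdot_vact /vsqnorm; apply: vdot_ext => p.
  by rewrite letter_op_adjK ev_vact.
have e2 : vdot u (ev w) = vsqnorm (vact L u).
  rewrite /vsqnorm vdot_vact; apply: vdot_ext => p.
  by rewrite /w ev_vact.
(* Here w = B^* B u, so that <w, u> = |B u|^2. *)
have -> : vsqnorm (vcontract u) = vsqnorm u - c * vsqnorm (vact L u) - c * (vsqnorm (vact L u) - c * vsqnorm w).
  rewrite /vsqnorm {1}/vcontract vdot_cat vdot_vscale.
  have evT : ev (vcontract u) =1 (fun p => ev u p + (- c) * ev w p).
    by move=> p; rewrite ev_cat ev_vscale.
  rewrite !(vdot_ext _ evT) !vdotD !vdotZ -/w cNJ e1 e2.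
  by rewrite -![vdot _ (ev _)]/(vsqnorm _); ring.
rewrite gerBl mulr_ge0 // subr_ge0.
apply: le_trans (ler_wpM2l c_ge0 (vsqnorm_vact _ _)) _.
by rewrite weight_adj mulrA ler_piMl ?vsqnorm_ge0.
Qed.

Variable p0 : I * G.
Definition powT r := iter r vcontract [:: (p0, 1)].
(** With d the basis vector at p0, this is |T^r d|^2, which is nonincreasing
    in r once c |B|^2 <= 1. *)
Definition alpha r := vsqnorm (powT r).

Lemma iter_fcontract_ext r y y' : y =1 y' -> iter r fcontract y =1 iter r fcontract y'.
Proof.
move=> yy; elim: r => //= r IH p; rewrite /fcontract IH; congr (_ - c * _).
by apply: letter_op_ext; apply: letter_op_ext.
Qed.

Lemma vdot_iter_vcontract r u y : vdot (iter r vcontract u) y = vdot u (iter r fcontract y).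
Proof. by elim: r u y => // r IH u y; rewrite /= vdot_vcontract IH -iterSr. Qed.

Lemma ev_iter_vcontract r u : ev (iter r vcontract u) =1 iter r fcontract (ev u).
Proof.
elim: r => // r IH p; rewrite /= ev_vcontract /fcontract IH; congr (_ - c * _).
by apply: letter_op_ext; apply: letter_op_ext.
Qed.

Lemma vdot_delta y : vdot [:: (p0, 1)] y = (y p0)^*.
Proof. by rewrite /vdot big_seq1 mul1r. Qed.

Lemma vdot_powT r s : vdot (powT r) (ev (powT s)) = (ev (powT (r + s)) p0)^*.
Proof.
rewrite /powT vdot_iter_vcontract -vdot_delta; apply: vdot_ext => p.
rewrite iterD ev_iter_vcontract; apply: iter_fcontract_ext => q; by [].
Qed.

(** Since T is self-adjoint, |T^r d|^2 = <T^(2r) d, d>. *)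
Lemma alphaE r : alpha r = ev (powT (r + r)) p0.
Proof.
rewrite /alpha /vsqnorm vdot_powT; apply/CrealP; rewrite -[_ p0]conjCK -vdot_powT.
by rewrite CrealJ; apply/ger0_real/vsqnorm_ge0.
Qed.

Lemma alpha_ge0 r : 0 <= alpha r. Proof. exact: vsqnorm_ge0. Qed.

Lemma alpha_decr r : alpha r.+1 <= alpha r - c * vsqnorm (vact L (powT r)).
Proof. exact: vsqnorm_vcontract. Qed.

Lemma alpha_le r s : (r <= s)%N -> alpha s <= alpha r.
Proof.
move=> /subnK <-; elim: (s - r)%N => [|k IH]; first by rewrite add0n.
apply: le_trans IH; rewrite addSn; apply: le_trans (alpha_decr _) _.
by rewrite gerBl mulr_ge0 // vsqnorm_ge0.
Qed.

(** T is self-adjoint and fixes the kernel of B. *)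
Lemma vdot_powT_kernel r y : (forall p, letter_op left_shift L y p = 0) ->
  vdot (powT r) y = (y p0)^*.
Proof.
move=> By; rewrite /powT vdot_iter_vcontract vdot_delta; congr (_^*).
have Ty : fcontract y =1 y.
  move=> p; rewrite /fcontract /letter_op big1 ?mulr0 ?subr0 // => t _.
  by rewrite -/(letter_op left_shift L y _) By mulr0.
have it k : iter k fcontract y =1 y.
  by elim: k => // k IH p; rewrite iterS -Ty; apply: (iter_fcontract_ext 1 IH).
by rewrite it.
Qed.

(** For y in the kernel, y(p0) is the scalar product with T^r d by the
    previous lemma, and Cauchy-Schwarz applies. *)
Lemma alpha_lower r y K : (forall p, letter_op left_shift L y p = 0) -> sq_sums_le y K ->
  `|y p0| ^+ 2 <= alpha r * K.
Proof.
move=> By yK; apply: le_trans (vdot_cauchy (powT r) yK).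
by rewrite (vdot_powT_kernel r By) norm_conjC.
Qed.

Lemma sq_sums_weaken (T : eqType) (y : T -> C) K K' : K <= K' -> sq_sums_le y K -> sq_sums_le y K'.
Proof. by move=> KK yK s us; apply: le_trans (yK s us) KK. Qed.

Lemma sq_sums_ext (T : eqType) (y y' : T -> C) K : y =1 y' -> sq_sums_le y K -> sq_sums_le y' K.
Proof. by move=> yy yK s us; under eq_bigr do rewrite -yy; apply: yK. Qed.

(** The sequence T^(2r) d is Cauchy: expanding the square gives
    |T^(2r) d - T^(2s) d|^2 = alpha (2r) - 2 alpha (r + s) + alpha (2s), where
    alpha (r + s) >= alpha (2s). *)
Lemma sq_sums_powT_diff r s : (r <= s)%N ->
  sq_sums_le (fun p => ev (powT (r + r)) p - ev (powT (s + s)) p) (alpha (r + r) - alpha (s + s)).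
Proof.
move=> rs; pose w := powT (r + r) ++ vscale (-1) (powT (s + s)).
have evw : ev w =1 (fun p => ev (powT (r + r)) p + (-1) * ev (powT (s + s)) p).
  by move=> p; rewrite ev_cat ev_vscale.
have alphaJ k : (alpha k)^* = alpha k by apply/CrealP; apply/ger0_real/alpha_ge0.
have vdotA k l : vdot (powT (k + k)) (ev (powT (l + l))) = alpha (k + l).
  by rewrite vdot_powT -alphaJ alphaE; congr ((ev (powT _) _)^*); lia.
have nw : vsqnorm w = alpha (r + r) - 2 * alpha (r + s) + alpha (s + s).
  rewrite /vsqnorm (vdot_ext _ evw) vdot_cat vdot_vscale !vdotD !vdotZ !vdotA.
  by rewrite rmorphN rmorph1 addnC [(s + r)%N]addnC; ring.
apply: (@sq_sums_ext _ (ev w)); first by move=> p; rewrite evw mulN1r.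
apply: sq_sums_weaken (@sq_sums_ev w); rewrite nw -subr_ge0.
rewrite (_ : _ - _ = 2 * (alpha (r + s) - alpha (s + s))); last by ring.
by rewrite mulr_ge0 // subr_ge0 alpha_le // leq_add2r.
Qed.

End Letters.

(** * Finite models from sofic approximations *)

Section FiniteModel.
Local Open Scope sesquilinear_scope.
Variables (G : groupType) (I : finType) (m : nat) (phi : G -> 'S_m).
Local Notation X := (I * 'I_m)%type.
Local Notation d := #|{: I * 'I_m}|.

(** Acting on row vectors, this matrix sends the basis vector at (j, p) to the
    sum over the letters (g, i, j, z) of z times the basis vector at (i,
    phi g p). It is used for letters with integer coefficients as well as
    complex ones. *)
Definition model_mx (K : nzRingType) (L : seq (letter G I K)) : 'M[K]_d :=
  \matrix_(a, b) \sum_(t <- L | [&& lj t == (enum_val a).1, li t == (enum_val b).1 &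
     phi (lg t) (enum_val a).2 == (enum_val b).2]) lc t.

Definition map_letters (K K' : Type) (f : K -> K') (L : seq (letter G I K)) :
  seq (letter G I K') := [seq (lg t, li t, lj t, f (lc t)) | t <- L].

Lemma map_model_mx (K K' : nzRingType) (f : {rmorphism K -> K'}) (L : seq (letter G I K)) :
  map_mx f (model_mx L) = model_mx (map_letters f L).
Proof.
by apply/matrixP => a b; rewrite !mxE rmorph_sum [RHS]big_map.
Qed.

Variable C : numClosedFieldType.
Implicit Types (L : seq (letter G I C)) (u : seq ((I * G) * C)).

(** On functions a letter acts through the inverse permutation, as it does
    through the inverse translation on the group. *)
Definition perm_act (g : G) (q : 'I_m) : 'I_m := (phi g)^-1%g q.

Definition basis_row (p : X) : 'rV[C]_d := delta_mx 0 (enum_rank p).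

Lemma perm_act_inj g : injective (perm_act g).
Proof. exact: perm_inj. Qed.

Lemma mul_model_mx L (x : 'rV[C]_d) b :
  (x *m model_mx L) 0 b = letter_op perm_act L (fun p => x 0 (enum_rank p)) (enum_val b).
Proof.
rewrite mxE; under eq_bigr do rewrite mxE mulr_sumr big_mkcond /=.
rewrite exchange_big /letter_op [RHS]big_mkcond /=; apply: eq_bigr => t _.
rewrite (bigD1 (enum_rank (lj t, perm_act (lg t) (enum_val b).2))) //= big1 => [|a ane].
  rewrite enum_rankK /= eqxx /perm_act permKV eqxx addr0 andbT /=.
  by case: eqP => // _; rewrite mulrC.
case: ifP => // /and3P[/eqP e1 e2 /eqP e3]; case/eqP: ane.
by apply: enum_val_inj; rewrite enum_rankK e1 /perm_act -e3 permK -surjective_pairing.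
Qed.

Lemma sum_enum_val (V : nmodType) (f : X -> V) : \sum_(a < d) f (enum_val a) = \sum_p f p.
Proof.
by rewrite (reindex (@enum_rank _)) /=; [under eq_bigr do rewrite enum_rankK | apply: onW_bij; apply: enum_rank_bij].
Qed.

Lemma sqnorm_mul_model_mx L (x : 'rV[C]_d) :
  sqnorm (x *m model_mx L) <= weight L ^+ 2 * sqnorm x.
Proof.
rewrite /sqnorm; under eq_bigr do rewrite mul_model_mx.
rewrite (sum_enum_val (fun p => `|letter_op perm_act L (fun p => x 0 (enum_rank p)) p| ^+ 2)).
have xb : sq_sums_le (fun p => x 0 (enum_rank p)) (sqnorm x).
  move=> s us; rewrite /sqnorm -(eq_bigr _ (fun a _ => congr1 (fun b => `|x 0 b| ^+ 2) (enum_valK a))).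
  rewrite (sum_enum_val (fun p => `|x 0 (enum_rank p)| ^+ 2)) big_uniq //=.
  by rewrite [leRHS](bigID (mem s)) /= lerDl sumr_ge0 // => p _; rewrite exprn_ge0.
have := sq_sums_letter_op L perm_act_inj xb (index_enum_uniq _); apply.
Qed.

Lemma basis_row_mul L j p : basis_row (j, p) *m model_mx L =
  \sum_(t <- L | lj t == j) lc t *: basis_row (li t, phi (lg t) p).
Proof.
rewrite -rowE; apply/rowP => b; rewrite !mxE summxE enum_rankK /= big_mkcond [RHS]big_mkcond.
apply: eq_bigr => t _; case: eqP => _ //=.
rewrite !mxE eqxx /= -(inj_eq enum_val_inj) enum_rankK (eq_sym (enum_val b)).
rewrite [enum_val b]surjective_pairing xpair_eqE /=.
by case: andP => _; rewrite ?mulr1 ?mulr0.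
Qed.

Lemma basis_row_mul_adj L j p : basis_row (j, p) *m (model_mx L)^t* =
  \sum_(t <- L | li t == j) (lc t)^* *: basis_row (lj t, (phi (lg t))^-1%g p).
Proof.
rewrite -rowE; apply/rowP => b; rewrite !mxE summxE enum_rankK /= rmorph_sum /=.
rewrite big_mkcond [RHS]big_mkcond.
apply: eq_bigr => t _; rewrite andbCA; case: eqP => _ //=.
rewrite !mxE eqxx /= -(inj_eq enum_val_inj) enum_rankK (eq_sym (enum_val b)).
rewrite [enum_val b]surjective_pairing xpair_eqE /=.
have -> : (phi (lg t) (enum_val b).2 == p) = ((phi (lg t))^-1%g p == (enum_val b).2).
  by apply/eqP/eqP => [<-|<-]; rewrite ?permK ?permKV.
by case: andP => _; rewrite ?mulr1 ?mulr0.
Qed.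

Variable p0 : 'I_m.

(** The linear map sending the basis vector at (i, g) to the one at (i,
    phi g p0), which transports vectors on the group to the finite model. *)
Definition pushforward u : 'rV[C]_d := \sum_(q <- u) q.2 *: basis_row (q.1.1, phi q.1.2 p0).

(** The pushforward intertwines the operator on the group with its model as
    long as phi is multiplicative at p0 on the finitely many elements
    involved. *)
Lemma pushforward_vact L u :
  (forall t q, t \in L -> q \in u -> phi (lg t) (phi q.1.2 p0) = phi (lg t * q.1.2)%g p0) ->
  pushforward (vact L u) = pushforward u *m model_mx L.
Proof.
move=> loc; rewrite /pushforward mulmx_suml [LHS]big_allpairs_dep exchange_big /=.
rewrite big_seq [RHS]big_seq; apply: eq_bigr => q qu.
rewrite -scalemxAl basis_row_mul scaler_sumr [RHS]big_mkcond big_seq [RHS]big_seq.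
apply: eq_bigr => t tL; rewrite /= loc //.
by case: eqP => _; rewrite ?mul0r ?scale0r // mul1r scalerA mulrC.
Qed.

Lemma pushforward_vact_adj L u :
  (forall t q, t \in L -> q \in u -> phi (lg t) (phi ((lg t)^-1 * q.1.2)%g p0) = phi q.1.2 p0) ->
  pushforward (vact (adj L) u) = pushforward u *m (model_mx L)^t*.
Proof.
move=> loc; rewrite /pushforward mulmx_suml [LHS]big_allpairs_dep exchange_big /=.
rewrite big_seq [RHS]big_seq; apply: eq_bigr => q qu.
rewrite -scalemxAl basis_row_mul_adj scaler_sumr [RHS]big_mkcond [LHS]big_map big_seq [RHS]big_seq.
apply: eq_bigr => t tL; rewrite /lj /li /lg /lc /= -(loc _ _ tL qu) permK.
by case: eqP => _; rewrite ?mul0r ?scale0r // mul1r scalerA mulrC.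
Qed.

Lemma pushforward_cat u v : pushforward (u ++ v) = pushforward u + pushforward v.
Proof. exact: big_cat. Qed.

Lemma pushforward_vscale z u : pushforward (vscale z u) = z *: pushforward u.
Proof. by rewrite /pushforward big_map scaler_sumr; apply: eq_bigr => q _; rewrite scalerA. Qed.

Definition supp u : seq G := [seq q.1.2 | q <- u].

(** On the elements of F the map phi is multiplicative at p, and its
    nontrivial elements move p, as in a free action. *)
Definition good_point (F : seq G) (p : 'I_m) : bool :=
  all (fun g => all (fun h => phi g (phi h p) == phi (g * h)%g p) F) F &&
  all (fun g => (g != 1%g) ==> (phi g p != p)) F.

Variables (L : seq (letter G I C)) (c : C) (i0 : I) (F : seq G).
Hypothesis phi1 : phi 1%g = 1%g.
Local Notation pw := (powT c L (i0, 1%g)).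

Definition letters_of : seq G := [seq lg t | t <- L].

(** T u is obtained by appending to u, so that supports increase with the
    exponent. *)
Lemma supp_mono r k : (r <= k)%N -> {subset pw r <= pw k}.
Proof.
move=> /subnK <-; elim: (k - r)%N => [|n IH]; first by rewrite add0n.
by move=> q /IH qn; rewrite addSn /powT iterS mem_cat -/(powT _ _ _ _) qn.
Qed.

(** At a good point the powers of T on the group and in the finite model
    correspond, since all the elements that the computation meets lie in F. *)
Lemma pushforward_powT k :
  good_point F p0 -> {subset letters_of <= F} -> {subset supp (pw k) <= F} ->
  {subset supp (vact L (pw k)) <= F} ->
  forall r, (r <= k)%N -> pushforward (pw r) = basis_row (i0, p0) *m gram_contraction c (model_mx L) ^+ r.
Proof.
move=> /andP[/allP loc _] LF uF BuF; have {}loc g h : g \in F -> h \in F ->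
    phi g (phi h p0) = phi (g * h)%g p0.
  by move=> gF hF; have /allP/(_ h hF)/eqP := loc g gF.
elim=> [|r IH] rk.
  by rewrite expr0 -[1]/(1%:M) mulmx1 /pushforward big_seq1 scale1r phi1 perm1.
have rk' := ltnW rk.
rewrite exprSr -[X in _ *m X]/(_ *m _) mulmxA -IH // /gram_contraction mulmxBr mulmx1.
rewrite -scalemxAr mulmxA /powT iterS -/(powT _ _ _ _) pushforward_cat pushforward_vscale scaleNr.
congr (_ - _ *: _); rewrite pushforward_vact_adj ?pushforward_vact // => t q tL qu.
  apply: loc; first by apply/LF/map_f.
  by apply/uF/map_f/(supp_mono rk').
have lF : lg t \in F by apply/LF/map_f.
rewrite loc ?mulKVg //; apply: uF; apply/mapP.
exists ((lj t, ((lg t)^-1 * q.1.2)%g), - c * ((li t == q.1.1)%:R * ((lc t)^* * q.2))) => //.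
apply: (supp_mono rk); rewrite /powT iterS -/(powT _ _ _ _) mem_cat; apply/orP; right.
apply/mapP; exists ((lj t, ((lg t)^-1 * q.1.2)%g), (li t == q.1.1)%:R * ((lc t)^* * q.2)) => //.
apply/allpairsP; exists (((lg t)^-1%g, lj t, li t, (lc t)^*), q); split=> //.
by apply: map_f.
Qed.

(** The diagonal entry in the finite model collects the coefficients of T^k d
    at the (i0, g) with phi g p0 = p0; at a good point only g = 1 contributes. *)
Lemma diag_exp_good k :
  good_point F p0 -> {subset letters_of <= F} -> {subset supp (pw k) <= F} ->
  {subset supp (vact L (pw k)) <= F} ->
  (gram_contraction c (model_mx L) ^+ k) (enum_rank (i0, p0)) (enum_rank (i0, p0)) =
  ev (pw k) (i0, 1%g).
Proof.
move=> gp LF uF BuF; have := pushforward_powT gp LF uF BuF (leqnn k).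
rewrite /basis_row -rowE => /rowP/(_ (enum_rank (i0, p0))); rewrite [in RHS]mxE => <-.
rewrite /pushforward summxE /ev big_seq [RHS]big_seq_cond big_mkcondr /=.
apply: eq_bigr => -[[j g] z] qu; rewrite !mxE eqxx /= (inj_eq enum_rank_inj) !xpair_eqE.
rewrite eq_sym; case: eqP => _ /=; last by rewrite mulr0.
have gF : g \in F by apply: uF; apply/mapP; exists (j, g, z).
have [->|g1] := eqVneq g 1%g; first by rewrite phi1 perm1 eqxx mulr1.
case/andP: gp => _ /allP/(_ g gF); rewrite g1 /= eq_sym => /negPf ->.
by rewrite mulr0.
Qed.

End FiniteModel.

Section CountingBadPoints.
Local Open Scope sesquilinear_scope.
Variables (R : realType) (G : groupType).

Definition bad_points m (phi : G -> 'S_m) (F : seq G) : {set 'I_m} :=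
  [set p | ~~ good_point phi F p].

Lemma card_has_le (T : finType) (S : Type) (Q : S -> pred T) (s : seq S) :
  (#|[set p | has (Q^~ p) s]| <= \sum_(x <- s) #|[set p | Q x p]|)%N.
Proof.
elim: s => [|x s IH]; first by rewrite big_nil leqn0 cards_eq0; apply/eqP/setP => p; rewrite !inE.
rewrite big_cons; apply: leq_trans (leq_add (leqnn _) IH).
apply: leq_trans (leq_card_setU _ _); apply/subset_leq_card/fintype.subsetP => p.
by rewrite !inE.
Qed.

(** The fixed points of the permutation on the right correspond, under
    phi (g h), to the points where phi is multiplicative for the pair g, h. *)
Lemma card_noncompatible m (phi : G -> 'S_m) g h :
  (#|[set p | phi g (phi h p) != phi (g * h)%g p]| =
    m - fixpoints ((phi (g * h)%g)^-1 * phi h * phi g)%g)%N.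
Proof.
rewrite /fixpoints.
have -> : #|[pred i | ((phi (g * h)%g)^-1 * phi h * phi g)%g i == i]| =
    #|[set p | phi g (phi h p) == phi (g * h)%g p]|.
  rewrite -(card_imset _ (@perm_inj _ (phi (g * h)%g))); apply: eq_card => i.
  rewrite inE; apply/idP/imsetP => [ei|[p]].
    exists ((phi (g * h)%g)^-1%g i); last by rewrite permKV.
    by rewrite inE permKV; move: ei; rewrite !permM.
  by rewrite inE !permM => pP ->; rewrite permK.
rewrite -[X in (X - _)%N](card_ord m) -(cardsC [set p | phi g (phi h p) == phi (g * h)%g p]) addKn.
by apply: eq_card => p; rewrite !inE.
Qed.

Lemma card_bad_points m (phi : G -> 'S_m) (F : seq G) :
  (#|bad_points phi F| <=
    \sum_(g <- F) \sum_(h <- F) (m - fixpoints ((phi (g * h)%g)^-1 * phi h * phi g)%g)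
    + \sum_(g <- F | g != 1%g) fixpoints (phi g))%N.
Proof.
apply: (@leq_trans (#|[set p | has (fun g => has (fun h => phi g (phi h p) != phi (g * h)%g p) F) F]|
   + #|[set p | has (fun g => phi g p == p) [seq g <- F | g != 1%g]]|)%N).
  apply: leq_trans (leq_card_setU _ _); apply/subset_leq_card/fintype.subsetP => p.
  rewrite !inE negb_and => /orP[|] /allPn[g gF hg]; apply/orP; [left|right]; apply/hasP; exists g => //.
  - by move: hg => /allPn[h hF hh]; apply/hasP; exists h.
  - by rewrite mem_filter gF andbT; move: hg; rewrite negb_imply => /andP[].
  - by move: hg; rewrite negb_imply negbK => /andP[].
apply: leq_add.
  apply: leq_trans (card_has_le _ _) _; apply: leq_sum => g _.
  apply: leq_trans (card_has_le _ _) _; apply: leq_sum => h _.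
  by rewrite card_noncompatible.
apply: leq_trans (card_has_le _ _) _; rewrite big_filter; apply: leq_sum => g _.
by apply: eq_leq; apply: eq_card => p; rewrite !inE.
Qed.

(** A point is bad because of one of the at most k^2 pairs or one of the at
    most k elements of F, where k is the length of F, and each of them
    excludes at most eps m points. *)
Lemma sofic_good_points : sofic R G -> forall (F : seq G) (delta : R), 0 < delta ->
  exists (m : nat) (phi : G -> 'S_m),
    [/\ (0 < m)%N, phi 1%g = 1%g & #|bad_points phi F|%:R <= delta * m%:R].
Proof.
move=> sof F delta d0; pose k := size F; pose N := (k * k + k)%N.
(* The successor guards against an empty F, and the minimum keeps eps below 1. *)
pose eps := Num.min 2^-1 (delta / N.+1%:R).
have eps0 : 0 < eps by rewrite lt_min invr_gt0 ltr0n divr_gt0 // ltr0n.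
have eps1 : eps < 1 by rewrite gt_min invf_lt1 ?ltr1n // ltr0n.
have [m [phi [m0 comp phi1 free]]] := sof eps [fset x in F]%fset eps0 eps1.
exists m, phi; split=> //; apply: le_trans (_ : (N%:R * eps) * m%:R <= _); last first.
  rewrite ler_wpM2r //; apply: (@le_trans _ _ (N.+1%:R * eps)).
    by rewrite ler_wpM2r ?ler_nat // ltW.
  rewrite mulrC -ler_pdivlMr ?ltr0n //.
  by rewrite ge_min lexx orbT.
have : #|bad_points phi F|%:R <= (\sum_(g <- F) \sum_(h <- F) (m - fixpoints ((phi (g * h)%g)^-1 * phi h * phi g)%g)
    + \sum_(g <- F | g != 1%g) fixpoints (phi g))%N%:R :> R by rewrite ler_nat card_bad_points.
move=> /le_trans; apply; rewrite natrD /N natrD !mulrDl; apply: lerD.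
  rewrite natrM natr_sum -mulrA -mulrA.
  apply: (@le_trans _ _ (\sum_(g <- F) k%:R * (eps * m%:R))).
    rewrite big_seq [leRHS]big_seq; apply: ler_sum => g gF.
    rewrite natr_sum; apply: (@le_trans _ _ (\sum_(h <- F) eps * m%:R)).
      rewrite big_seq [leRHS]big_seq; apply: ler_sum => h hF.
      have := comp g h; rewrite !inE => /(_ gF hF).
      set f := fixpoints _ => fP.
      have fm : (f <= m)%N by rewrite -[leqRHS](card_ord m) max_card.
      by rewrite natrB // lerBlDr addrC -lerBlDr -{1}[m%:R]mul1r -mulrBl.
    by rewrite big_const_seq count_predT iter_addr_0 mulr_natl.
  by rewrite big_const_seq count_predT iter_addr_0 -[leLHS]mulr_natl.
rewrite natr_sum -mulrA; apply: (@le_trans _ _ (\sum_(g <- F) eps * m%:R)).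
  rewrite big_mkcond big_seq [leRHS]big_seq; apply: ler_sum => g gF.
  case: ifP => g1; first by apply: free => //; rewrite !inE.
  by rewrite mulr_ge0 // ltW.
by rewrite big_const_seq count_predT iter_addr_0 mulr_natl.
Qed.

End CountingBadPoints.

Section TraceTransfer.
Local Open Scope sesquilinear_scope.
Variables (C : numClosedFieldType) (G : groupType) (I : finType).
Variables (L : seq (letter G I C)) (c : C).
Hypothesis c_ge0 : 0 <= c.
Hypothesis c_small : c * weight L ^+ 2 <= 1.

(** The elements met by the computation of the k-th power of T on the basis
    vectors at the unit. *)
Definition window k : seq G := letters_of L ++
  flatten [seq supp (powT c L (i, 1%g) k) ++ supp (vact L (powT c L (i, 1%g) k)) | i <- enum I].

Lemma windowP k i : [/\ {subset letters_of L <= window k},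
  {subset supp (powT c L (i, 1%g) k) <= window k} &
  {subset supp (vact L (powT c L (i, 1%g) k)) <= window k}].
Proof.
have sub (s : seq G) : {subset s <= supp (powT c L (i, 1%g) k) ++ supp (vact L (powT c L (i, 1%g) k))} ->
    {subset s <= window k}.
  move=> ss g gs; rewrite mem_cat; apply/orP; right; apply/flattenP.
  exists (supp (powT c L (i, 1%g) k) ++ supp (vact L (powT c L (i, 1%g) k))); last exact: ss.
  by apply/mapP; exists i; rewrite ?mem_enum.
split; first by move=> g gL; rewrite mem_cat gL.
- by apply: sub => g gs; rewrite mem_cat gs.
- by apply: sub => g gs; rewrite mem_cat gs orbT.
Qed.

Lemma alpha0 i : alpha c L (i, 1%g) 0 = 1 :> C.
Proof. by rewrite alphaE // /ev big_mkcond big_seq1 eqxx. Qed.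

Lemma alpha_le1 i r : alpha c L (i, 1%g) r <= 1 :> C.
Proof. by rewrite -(alpha0 i) alpha_le. Qed.

(** The diagonal entry at (i, p) equals alpha if p is a good point; in any
    case both numbers lie in [0, 1], so that each bad point costs at most 1
    for every i. *)
Lemma trace_transfer m (phi : G -> 'S_m) (F : seq G) r :
  phi 1%g = 1%g -> {subset window (r + r) <= F} ->
  `|\tr (gram_contraction c (model_mx phi L) ^+ (r + r))
     - m%:R * \sum_i alpha c L (i, 1%g) r| <= #|I|%:R * #|bad_points phi F|%:R.
Proof.
move=> phi1 sF; set T := _ ^+ (r + r).
have -> : \tr T - m%:R * \sum_i alpha c L (i, 1%g) r =
    \sum_(p : I * 'I_m) (T (enum_rank p) (enum_rank p) - alpha c L (p.1, 1%g) r).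
  rewrite sumrB; congr (_ - _).
    rewrite /mxtrace -(sum_enum_val (fun p => T (enum_rank p) (enum_rank p))).
    by apply: eq_bigr => a _; rewrite enum_valK.
  rewrite -(pair_bigA _ (fun i (_ : 'I_m) => alpha c L (i, 1%g) r)) /= mulr_sumr.
  by apply: eq_bigr => i _; rewrite sumr_const card_ord mulr_natl.
apply: le_trans (ler_norm_sum _ _ _) _.
have -> : \sum_(p : I * 'I_m) `|T (enum_rank p) (enum_rank p) - alpha c L (p.1, 1%g) r| =
    \sum_i \sum_p `|T (enum_rank (i, p)) (enum_rank (i, p)) - alpha c L (i, 1%g) r|.
  by rewrite pair_bigA /=; apply: eq_bigr => -[i p] _.
rewrite mulr_natl -sumr_const; apply: ler_sum => i _.
rewrite -sumr_const [leLHS](bigID (mem (bad_points phi F))) /= -[leRHS]addr0.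
apply: lerD.
  apply: ler_sum => p _.
  have Bw x := sqnorm_mul_model_mx phi L x.
  have /andP[t0 t1] := diag_exp_itv (r + r) (enum_rank (i, p)) Bw c_ge0 c_small.
  have a0 := alpha_ge0 c L (i, 1%g) r; have a1 := alpha_le1 i r.
  rewrite real_ler_norml ?realB ?ger0_real //.
  set x := T _ _ in t0 t1 *; set a := alpha _ _ _ _ in a0 a1 *.
  apply/andP; split; rewrite -subr_ge0.
    rewrite (_ : _ - _ = x + (1 - a)); last by ring.
    by rewrite addr_ge0 // subr_ge0.
  rewrite (_ : _ - _ = (1 - x) + a); last by ring.
  by rewrite addr_ge0 // subr_ge0.
rewrite big1 // => p; rewrite inE negbK => gp.
have [LF uF BuF] := windowP (r + r) i.
rewrite (diag_exp_good phi1 gp) -?alphaE ?subrr ?normr0 //.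
- by move=> g /LF/sF.
- by move=> g /uF/sF.
- by move=> g /BuF/sF.
Qed.

End TraceTransfer.

(** * Unordered sums *)

Section UnorderedSums.
Local Open Scope classical_set_scope.
Local Open Scope complex_scope.
Variables (R : realType) (G : groupType).
Local Notation C := R[i].
Implicit Types (f g : G -> R).

(** A bound for all finite partial sums, which for nonnegative f amounts to a
    bound for the unordered sum. *)
Definition sums_le (T : eqType) (f : T -> R) (K : R) : Prop :=
  forall s : seq T, uniq s -> \sum_(x <- s) f x <= K.

Definition nsum f : R := fine (\esum_(x in [set: G]) (f x)%:E)%E.

Lemma esum_le f K : sums_le f K -> (\esum_(x in [set: G]) (f x)%:E <= K%:E)%E.
Proof.
move=> fK; apply: ge_ereal_sup => _ [F [finF _] <-].
by rewrite fsbig_finite //= sumEFin lee_fin; apply/fK/fset_uniq.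
Qed.

Lemma le_esum_seq f s : uniq s ->
  ((\sum_(x <- s) f x)%:E <= \esum_(x in [set: G]) (f x)%:E)%E.
Proof.
move=> us; apply: esum_ge; exists [set` s]; first by split; [exact: finite_seq|].
by rewrite -fsbig_seq // sumEFin.
Qed.

Lemma nsumE f K : sums_le f K -> (\esum_(x in [set: G]) (f x)%:E)%E = (nsum f)%:E.
Proof.
move=> fK; rewrite /nsum fineK // fin_numElt.
rewrite (lt_le_trans (ltNyr 0)) ?(le_lt_trans (esum_le fK)) ?ltry //.
by have := @le_esum_seq f [::] isT; rewrite big_nil.
Qed.

Lemma nsum_le f K : sums_le f K -> nsum f <= K.
Proof. by move=> fK; rewrite -lee_fin -(nsumE fK) esum_le. Qed.

Lemma nsum_ge f K s : sums_le f K -> uniq s -> \sum_(x <- s) f x <= nsum f.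
Proof. by move=> fK us; rewrite -lee_fin -(nsumE fK) le_esum_seq. Qed.

Lemma sums_leD (T : eqType) (f g : T -> R) K K' : sums_le f K -> sums_le g K' ->
  sums_le (fun x => f x + g x) (K + K').
Proof. by move=> fK gK s us; rewrite big_split lerD ?fK ?gK. Qed.

Lemma nsumD f g K K' : (forall x, 0 <= f x) -> (forall x, 0 <= g x) ->
  sums_le f K -> sums_le g K' -> nsum (fun x => f x + g x) = nsum f + nsum g.
Proof.
move=> f0 g0 fK gK; apply: EFin_inj; rewrite -(nsumE (sums_leD fK gK)) EFinD.
rewrite -(nsumE fK) -(nsumE gK) -esumD //; last 2 first.
- by move=> x _; rewrite lee_fin.
- by move=> x _; rewrite lee_fin.
Qed.

Lemma sums_le_finsupp f s : (forall x, 0 <= f x) -> uniq s ->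
  (forall x, x \notin s -> f x = 0) -> sums_le f (\sum_(x <- s) f x).
Proof.
move=> f0 us fs s' us'; rewrite (bigID (mem s)) /= [X in _ + X]big1 => [|x xs]; last exact: fs.
rewrite addr0 -big_filter [leRHS](bigID (mem s')) /= -[leLHS]addr0 lerD ?sumr_ge0 //.
rewrite -[leRHS]big_filter (perm_big [seq x <- s | x \in s']) //.
apply: uniq_perm; rewrite ?filter_uniq // => x.
by rewrite !mem_filter andbC.
Qed.

Lemma nsum_finsupp f s : (forall x, 0 <= f x) -> uniq s ->
  (forall x, x \notin s -> f x = 0) -> nsum f = \sum_(x <- s) f x.
Proof.
move=> f0 us fs; have fK := sums_le_finsupp f0 us fs.
by apply/le_anti; rewrite nsum_le //= (nsum_ge fK).
Qed.

Definition fpos f x := Num.max (f x) 0.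
Definition fneg f x := Num.max (- f x) 0.

Lemma fpos_ge0 f x : 0 <= fpos f x. Proof. by rewrite le_max lexx orbT. Qed.
Lemma fneg_ge0 f x : 0 <= fneg f x. Proof. by rewrite le_max lexx orbT. Qed.
Lemma fpos_le f x : fpos f x <= `|f x|.
Proof. by rewrite ge_max ler_norm normr_ge0. Qed.
Lemma fneg_le f x : fneg f x <= `|f x|.
Proof. by rewrite ge_max normr_ge0 -normrN ler_norm. Qed.
Lemma fposneg f x : fpos f x - fneg f x = f x.
Proof. by rewrite /fpos /fneg; case: (leP (f x) 0); case: (leP (- f x) 0) => h1 h2; lra. Qed.

Lemma sums_le_mono (T : eqType) (f g : T -> R) K : (forall x, f x <= g x) -> sums_le g K -> sums_le f K.
Proof. by move=> fg gK s us; apply: le_trans (gK s us); apply: ler_sum. Qed.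

Lemma sums_fpos f K : sums_le (fun x => `|f x|) K -> sums_le (fpos f) K.
Proof. exact/sums_le_mono/fpos_le. Qed.
Lemma sums_fneg f K : sums_le (fun x => `|f x|) K -> sums_le (fneg f) K.
Proof. exact/sums_le_mono/fneg_le. Qed.

Lemma rsumE f K : sums_le (fun x => `|f x|) K -> rsum f = nsum (fpos f) - nsum (fneg f).
Proof.
move=> fK; rewrite /rsum.
rewrite (@eq_esum _ _ _ _ (fun x => (fpos f x)%:E)); last first.
  by move=> x _; rewrite funeposE /= -EFin_max.
rewrite (@eq_esum _ _ _ ((EFin \o f)^\-)%E (fun x => (fneg f x)%:E)); last first.
  by move=> x _; rewrite funenegE /= -?EFinN -EFin_max.
by rewrite (nsumE (sums_fpos fK)) (nsumE (sums_fneg fK)).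
Qed.

(** From f + g = h one gets fpos h + fneg f + fneg g = fneg h +
    fpos f + fpos g, and sums of nonnegative families are additive. *)
Lemma rsumD f g K K' : sums_le (fun x => `|f x|) K -> sums_le (fun x => `|g x|) K' ->
  rsum (fun x => f x + g x) = rsum f + rsum g.
Proof.
move=> fK gK; have fgK : sums_le (fun x => `|f x + g x|) (K + K').
  by apply: sums_le_mono (sums_leD fK gK) => x; apply: ler_normD.
rewrite (rsumE fK) (rsumE gK) (rsumE fgK).
pose h x := f x + g x.
have pf := sums_fpos fK; have pg := sums_fpos gK; have ph := sums_fpos fgK.
have nf := sums_fneg fK; have ng := sums_fneg gK; have nh := sums_fneg fgK.
have e1 := nsumD (fneg_ge0 f) (fneg_ge0 g) nf ng.
have e2 := nsumD (fpos_ge0 f) (fpos_ge0 g) pf pg.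
have e3 := nsumD (fpos_ge0 h) (fun x => addr_ge0 (fneg_ge0 f x) (fneg_ge0 g x)) ph (sums_leD nf ng).
have e4 := nsumD (fneg_ge0 h) (fun x => addr_ge0 (fpos_ge0 f x) (fpos_ge0 g x)) nh (sums_leD pf pg).
have e : (fun x => fpos h x + (fneg f x + fneg g x)) = (fun x => fneg h x + (fpos f x + fpos g x)).
  apply/funext => x; have := fposneg f x; have := fposneg g x; have := fposneg h x.
  by rewrite {3}/h; lra.
rewrite e in e3; have := etrans (esym e3) e4; rewrite -/h e1 e2; lra.
Qed.

Lemma norm_rsum_le f K : sums_le (fun x => `|f x|) K -> `|rsum f| <= K.
Proof.
move=> fK; rewrite (rsumE fK) ler_norml.
have h1 := nsum_le (sums_fpos fK); have h2 := nsum_le (sums_fneg fK).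
have := @nsum_ge _ _ [::] (sums_fpos fK) isT; have := @nsum_ge _ _ [::] (sums_fneg fK) isT.
by rewrite !big_nil; lra.
Qed.

Lemma rsum_finsupp f s : uniq s -> (forall x, x \notin s -> f x = 0) ->
  rsum f = \sum_(x <- s) f x.
Proof.
move=> us fs; have fK : sums_le (fun x => `|f x|) (\sum_(x <- s) `|f x|).
  by apply: sums_le_finsupp => // x /fs->; rewrite normr0.
rewrite (rsumE fK) (nsum_finsupp (fpos_ge0 f) us) => [|x /fs h]; last by rewrite /fpos h maxxx.
rewrite (nsum_finsupp (fneg_ge0 f) us) => [|x /fs h]; last by rewrite /fneg h oppr0 maxxx.
by rewrite -sumrB; apply: eq_bigr => x _; apply: fposneg.
Qed.

Implicit Types (u v : G -> C).

Definition abs_sums_le u (K : R) := forall s, uniq s -> \sum_(x <- s) `|u x| <= K%:C.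

Lemma abs_sums_Re u K : abs_sums_le u K -> sums_le (fun x => `|complex.Re (u x)|) K.
Proof.
move=> uK s us; rewrite -lecR; apply: le_trans (uK s us).
by rewrite (rmorph_sum (real_complex R)) ler_sum // => x _; apply: normc_ge_Re.
Qed.

Lemma abs_sums_Im u K : abs_sums_le u K -> sums_le (fun x => `|complex.Im (u x)|) K.
Proof.
move=> uK s us; rewrite -lecR; apply: le_trans (uK s us).
rewrite (rmorph_sum (real_complex R)) ler_sum // => x _.
rewrite -[leRHS]RRe_real ?normr_real // lecR; apply: norm_Im_le.
by rewrite RRe_real ?normr_real.
Qed.

Lemma csumD u v K K' : abs_sums_le u K -> abs_sums_le v K' ->
  csum (fun x => u x + v x) = csum u + csum v.
Proof.
move=> uK vK; rewrite /csum.
have -> : (fun x => complex.Re (u x + v x)) = (fun x => complex.Re (u x) + complex.Re (v x)).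
  by apply/funext => x; case: (u x) (v x) => [? ?] [? ?].
have -> : (fun x => complex.Im (u x + v x)) = (fun x => complex.Im (u x) + complex.Im (v x)).
  by apply/funext => x; case: (u x) (v x) => [? ?] [? ?].
by rewrite (rsumD (abs_sums_Re uK) (abs_sums_Re vK)) (rsumD (abs_sums_Im uK) (abs_sums_Im vK)).
Qed.

(** Bounding the real and the imaginary part separately costs a factor 2,
    which is harmless here. *)
Lemma norm_csum_le u K : abs_sums_le u K -> `|csum u| <= (K + K)%:C.
Proof.
move=> uK; apply: le_trans (normc_leD _) _; rewrite lecR /csum /=.
by rewrite lerD // norm_rsum_le //; [apply: abs_sums_Re | apply: abs_sums_Im].
Qed.

Lemma csum_finsupp u s : uniq s -> (forall x, x \notin s -> u x = 0) ->
  csum u = \sum_(x <- s) u x.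
Proof.
move=> us u0; rewrite /csum (rsum_finsupp us) => [|x /u0->//].
rewrite (rsum_finsupp us) => [|x /u0->//].
elim: (s) => [|x r IH]; first by rewrite !big_nil.
by rewrite !big_cons -IH; case: (u x).
Qed.

Lemma l2P (x : G -> C) : l2 x <-> exists K : R, sq_sums_le x K%:C.
Proof.
have e s : (\sum_(z <- s) Normc.normc (x z) ^+ 2)%:C = \sum_(z <- s) `|x z| ^+ 2.
  by rewrite (rmorph_sum (real_complex R)); apply: eq_bigr => z _; rewrite (rmorphXn (real_complex R)).
split=> [lx|[K xK]]; last first.
  apply: le_lt_trans (ltry K); apply: esum_le => s us.
  by rewrite -lecR e; apply: xK.
exists (fine (\esum_(z in [set: G]) (Normc.normc (x z) ^+ 2)%:E)%E) => s us.
have := @le_esum_seq (fun z => Normc.normc (x z) ^+ 2) s us.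
have := @le_esum_seq (fun z => Normc.normc (x z) ^+ 2) [::] isT; rewrite big_nil.
move: lx; rewrite /l2 /=; case: (esum _ _) => // r _ _; rewrite lee_fin -lecR /=.
by rewrite -e.
Qed.

End UnorderedSums.

(** * Powers of the contraction converge to the projection onto the kernel *)

Section CauchyLimit.
Local Open Scope classical_set_scope.
Local Open Scope complex_scope.
Variable R : realType.
Local Notation C := R[i].

(** The limit is the supremum of the lower bounds x r - sqrt (b r - l); each
    x r + sqrt (b r - l) is an upper bound for them. *)
Lemma cauchy_limit (x b : nat -> R) (l : R) :
  (forall r, l <= b r) -> (forall r s, (r <= s)%N -> (x r - x s) ^+ 2 <= b r - b s) ->
  exists y, forall r, (x r - y) ^+ 2 <= b r - l.
Proof.
move=> lb xb; pose d r := Num.sqrt (b r - l).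
have d0 r : 0 <= d r by apply: sqrtr_ge0.
have dE r : d r ^+ 2 = b r - l by rewrite sqr_sqrtr // subr_ge0.
have close r s : (r <= s)%N -> `|x r - x s| <= d r.
  move=> rs; rewrite -(ler_pXn2r (_ : (0 < 2)%N)) ?nnegrE // dE.
  rewrite real_normK ?num_real //; apply: le_trans (xb _ _ rs) _.
  by rewrite lerD2l lerN2.
have cross r s : x r - d r <= x s + d s.
  have [rs|/ltnW sr] := leqP r s.
    by have := close _ _ rs; rewrite ler_norml => /andP[_ h]; have := d0 s; lra.
  by have := close _ _ sr; rewrite ler_norml => /andP[h _]; have := d0 r; lra.
pose E := [set z | exists r, z = x r - d r].
have supE : has_sup E.
  split; first by exists (x 0%N - d 0%N), 0%N.
  by exists (x 0%N + d 0%N) => _ [r ->].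
exists (sup E) => r; rewrite -dE -[leLHS]real_normK ?num_real //.
rewrite ler_pXn2r ?nnegrE // ler_norml; apply/andP; split.
  rewrite lerBrDr; have : sup E <= x r + d r; last by lra.
  by apply: ge_sup; [case: supE | move=> _ [s ->]].
rewrite lerBlDr; have : x r - d r <= sup E; last by lra.
by apply: sup_upper_bound => //; exists r.
Qed.

Lemma complex_cauchy_limit (x : nat -> C) (b : nat -> R) (l : R) :
  (forall r, l <= b r) ->
  (forall r s, (r <= s)%N -> `|x r - x s| ^+ 2 <= (b r - b s)%:C) ->
  exists y, forall r, `|x r - y| ^+ 2 <= (2 * (b r - l))%:C.
Proof.
move=> lb xb.
have [|yr yrP] := @cauchy_limit (fun r => complex.Re (x r)) b l lb.
  move=> r s rs; rewrite -lecR; apply: le_trans (xb _ _ rs).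
  rewrite -add_Re2_Im2 lecR; case: (x r) (x s) => [u v] [u' v'] /=.
  by rewrite lerDl sqr_ge0.
have [|yi yiP] := @cauchy_limit (fun r => complex.Im (x r)) b l lb.
  move=> r s rs; rewrite -lecR; apply: le_trans (xb _ _ rs).
  rewrite -add_Re2_Im2 lecR; case: (x r) (x s) => [u v] [u' v'] /=.
  by rewrite lerDr sqr_ge0.
exists (Complex yr yi) => r; rewrite -add_Re2_Im2 lecR.
have := yrP r; have := yiP r; case: (x r) => [u v] /=; lra.
Qed.

End CauchyLimit.

Section ProjectionLimit.
Local Open Scope classical_set_scope.
Local Open Scope complex_scope.
Variables (R : realType) (G : groupType) (I : finType).
Local Notation C := R[i].
Variables (L : seq (letter G I C)) (c : R).
Hypothesis c_gt0 : 0 < c.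
Hypothesis c_small : c%:C * weight L ^+ 2 <= 1.
Variable p0 : I * G.

Definition ralpha r : R := complex.Re (alpha c%:C L p0 r).
Definition alpha_lim : R := inf [set ralpha r | r in [set: nat]].

Let c_ge0 : 0 <= c%:C :> C. Proof. by rewrite lecR ltW. Qed.

Lemma ralphaE r : (ralpha r)%:C = alpha c%:C L p0 r.
Proof. by rewrite RRe_real // ger0_real // alpha_ge0. Qed.

Lemma ralpha_ge0 r : 0 <= ralpha r.
Proof. by rewrite -lecR ralphaE alpha_ge0. Qed.

Lemma ralpha_le r s : (r <= s)%N -> ralpha s <= ralpha r.
Proof. by move=> rs; rewrite -lecR !ralphaE alpha_le. Qed.

Lemma has_inf_ralpha : has_inf [set ralpha r | r in [set: nat]].
Proof.
split; first by exists (ralpha 0), 0%N.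
by exists 0 => _ [r _ <-]; apply: ralpha_ge0.
Qed.

Lemma alpha_lim_le r : alpha_lim <= ralpha r.
Proof. by apply: ge_inf; [case: has_inf_ralpha | exists r]. Qed.

Lemma alpha_lim_ge K : (forall r, K <= ralpha r) -> K <= alpha_lim.
Proof.
move=> Kr; apply: lb_le_inf; first by case: has_inf_ralpha.
by move=> _ [r _ <-].
Qed.

Lemma alpha_lim_near e : 0 < e -> exists N, forall r, (N <= r)%N -> ralpha r <= alpha_lim + e.
Proof.
move=> e0; have [_ [N _ <-] h] := inf_adherent e0 has_inf_ralpha.
by exists N => r Nr; apply: le_trans (ralpha_le Nr) (ltW h).
Qed.

Local Notation v r := (powT c%:C L p0 (r + r)).
Local Notation b r := (ralpha (r + r)).

Lemma eps_le (x : R) : (forall e, 0 < e -> x <= e) -> x <= 0.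
Proof. by move=> h; apply/ler_addgt0Pr => e e0; rewrite add0r h. Qed.

(** The pointwise limit y of T^(2r) d is a limit in norm because of the Cauchy
    estimate. It lies in the kernel of B because c |B T^(2r) d|^2 is at most
    the decrement of alpha at 2r, which tends to 0, and its value at p0 is the
    limit of the numbers <T^(2r) d, d>. *)
Lemma projection_limit : exists y : I * G -> C,
  [/\ forall r, sq_sums_le (fun p => ev (v r) p - y p) (2 * (b r - alpha_lim))%:C,
      forall p, letter_op (@left_shift G) L y p = 0 &
      y p0 = alpha_lim%:C].
Proof.
have lb r : alpha_lim <= b r by apply: alpha_lim_le.
have near0 e : 0 < e -> exists N, forall r, (N <= r)%N -> b r - alpha_lim <= e.
  move=> e0; have [N NP] := alpha_lim_near e0; exists N => r Nr.
  by rewrite lerBlDl NP // (leq_trans Nr) ?leq_addr.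
have diff r s : (r <= s)%N -> sq_sums_le (fun p => ev (v r) p - ev (v s) p) (b r - b s)%:C.
  move=> rs; apply: sq_sums_weaken (sq_sums_powT_diff c_ge0 c_small p0 rs).
  by rewrite (rmorphB (real_complex R)) /= !ralphaE.
have lim p : exists y, forall r, `|ev (v r) p - y| ^+ 2 <= (2 * (b r - alpha_lim))%:C.
  apply: (@complex_cauchy_limit R (fun r => ev (v r) p)) => // r s rs.
  by have := diff r s rs [:: p] isT; rewrite big_seq1.
have {lim} [y yP] := choice lim; exists y.
have ybound r : sq_sums_le (fun p => ev (v r) p - y p) (2 * (b r - alpha_lim))%:C.
  move=> s us; rewrite -[leLHS]RRe_real; last first.
    by apply: sum_real => p _; rewrite realX // normr_real.
  rewrite lecR; apply/ler_addgt0Pr => e e0.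
  (* The pointwise estimates at the finitely many points of s are applied at
     one common index t, large enough for their sum to stay below e. *)
  have e1 : 0 < e / (4 * (size s)%:R + 1) by rewrite divr_gt0 // ltr_wpDl // mulr_ge0.
  have [N NP] := near0 _ e1; pose t := maxn N r.
  have bt := NP t (leq_maxl _ _).
  rewrite -lecR RRe_real; last first.
    by apply: sum_real => p _; rewrite realX // normr_real.
  apply: (@le_trans _ _ (\sum_(p <- s) 2 * (`|ev (v r) p - ev (v t) p| ^+ 2 + `|ev (v t) p - y p| ^+ 2))).
    apply: ler_sum => p _; rewrite -[ev (v r) p - y p](subrKA (ev (v t) p)).
    exact: sqr_normD_le.
  rewrite -mulr_sumr big_split /=.
  apply: (@le_trans _ _ (2 * ((b r - b t)%:C + (2 * (b t - alpha_lim) * (size s)%:R)%:C))).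
    rewrite ler_pM2l // lerD ?diff ?leq_maxr //.
    apply: le_trans (ler_sum _ (fun p _ => yP p t)) _.
    by rewrite big_const_seq count_predT iter_addr_0 -(rmorphMn (real_complex R)) /= mulr_natr.
  have -> : 2 = 2%:C :> C by rewrite (rmorph_nat (real_complex R)).
  rewrite -(rmorphD (real_complex R)) -(rmorphM (real_complex R)) lecR.
  have := lb t; move: bt; rewrite ler_pdivlMr ?ltr_wpDl ?mulr_ge0 //.
  set S := (size s)%:R; have S0 : 0 <= S by rewrite ler0n.
  nra.
split=> //.
- move=> p; apply/eqP; rewrite -normr_eq0 -sqrf_eq0.
  have nr : `|letter_op (@left_shift G) L y p| ^+ 2 \is Num.real by rewrite realX // normr_real.
  rewrite -[_ ^+ 2]RRe_real //; set x := complex.Re _; have xE : x%:C = `|_| ^+ 2 := RRe_real nr.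
  have x0 : 0 <= x by rewrite -lecR xE exprn_ge0.
  suff : c * x <= 0 by rewrite pmulr_rle0 // => x1; rewrite (le_anti (_ : x <= 0 <= x)) ?x0 ?x1.
  (* Splitting B y = B T^(2N) d - B (T^(2N) d - y) bounds c |B y|^2 by
     2 (1 + 2) times the distance of alpha to its limit. *)
  apply: eps_le => e e0; have [N NP] := near0 (e / 6) (divr_gt0 e0 (ltr0Sn _ _)).
  have {NP} := NP N (leqnn _) => bN.
  apply: (@le_trans _ _ (6 * (b N - alpha_lim))); last by lra.
  rewrite -lecR (rmorphM (real_complex R)) /= xE.
  have opB : letter_op (@left_shift G) L y p = letter_op (@left_shift G) L (ev (v N)) p +
      - letter_op (@left_shift G) L (fun q => ev (v N) q - y q) p.
    rewrite /letter_op -sumrB; apply: eq_bigr => t _; by rewrite -mulrBr subKr.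
  have h1 : c%:C * `|letter_op (@left_shift G) L (ev (v N)) p| ^+ 2 <= (b N - alpha_lim)%:C.
    rewrite -ev_vact.
    have := @sq_sums_ev _ _ _ (vact L (v N)) [:: p] isT; rewrite big_seq1 => h.
    apply: le_trans (ler_wpM2l c_ge0 h) _.
    have := alpha_decr c_ge0 c_small p0 (N + N); rewrite -!ralphaE.
    rewrite lerBrDl -lerBrDr => /le_trans; apply.
    by rewrite -(rmorphB (real_complex R)) lecR lerD2l lerN2 alpha_lim_le.
  have h2 : c%:C * `|letter_op (@left_shift G) L (fun q => ev (v N) q - y q) p| ^+ 2 <= (2 * (b N - alpha_lim))%:C.
    have := sq_sums_letter_op L (@left_shift_inj G) (ybound N) (s := [:: p]) isT; rewrite big_seq1 => h.
    apply: le_trans (ler_wpM2l c_ge0 h) _; rewrite mulrA ler_piMl //.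
    by rewrite lecR mulr_ge0 // subr_ge0.
  rewrite opB; apply: le_trans (ler_wpM2l c_ge0 (sqr_normD_le _ _)) _.
  rewrite normrN mulrCA mulrDr.
  apply: le_trans (_ : 2 * ((b N - alpha_lim)%:C + (2 * (b N - alpha_lim))%:C) <= _).
    by rewrite ler_pM2l // lerD.
  have -> : 2 = 2%:C :> C by rewrite (rmorph_nat (real_complex R)).
  by rewrite -(rmorphD (real_complex R)) -(rmorphM (real_complex R)) lecR; have := lb N; lra.
- have : `|y p0 - alpha_lim%:C| ^+ 2 = 0; last first.
    by move/eqP; rewrite sqrf_eq0 normr_eq0 subr_eq0 => /eqP.
  have nr : `|y p0 - alpha_lim%:C| ^+ 2 \is Num.real by rewrite realX // normr_real.
  rewrite -[_ ^+ 2]RRe_real //; set x := complex.Re _; have xE : x%:C = `|_| ^+ 2 := RRe_real nr.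
  have x0 : 0 <= x by rewrite -lecR xE exprn_ge0.
  suff x1 : x <= 0 by rewrite (le_anti (_ : x <= 0 <= x)) ?x0 ?x1.
  apply: eps_le => e e0; pose d := Num.min 1 (e / 6).
  have d0 : 0 < d by rewrite lt_min ltr01 divr_gt0.
  have d1 : d <= 1 by rewrite ge_min lexx.
  have d6 : d <= e / 6 by rewrite ge_min lexx orbT.
  have [N NP] := alpha_lim_near d0.
  have h1 : `|y p0 - ev (v N) p0| ^+ 2 <= (2 * d)%:C.
    rewrite distrC; apply: le_trans (yP p0 N) _; rewrite lecR ler_pM2l // lerBlDl NP //.
    exact: leq_addr.
  have h2 : `|ev (v N) p0 - alpha_lim%:C| ^+ 2 <= d%:C.
    rewrite -alphaE // -ralphaE -(rmorphB (real_complex R)) normc_def /= expr0n /= addr0 sqrtr_sqr.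
    rewrite ger0_norm ?subr_ge0 ?alpha_lim_le // -(rmorphXn (real_complex R)) lecR.
    have := NP N (leqnn _); have := alpha_lim_le N; nra.
  rewrite -lecR xE -[y p0 - _](subrKA (ev (v N) p0)).
  apply: le_trans (sqr_normD_le _ _) _.
  apply: le_trans (_ : 2 * ((2 * d)%:C + d%:C) <= _); first by rewrite ler_pM2l // lerD.
  have -> : 2 = 2%:C :> C by rewrite (rmorph_nat (real_complex R)).
  by rewrite -(rmorphD (real_complex R)) -(rmorphM (real_complex R)) lecR; lra.
Qed.

(** A vector in the kernel that does not vanish at p0 keeps |T^r d|^2 away
    from 0. *)
Lemma ralpha_lower (y : I * G -> C) (K : R) :
  (forall p, letter_op (@left_shift G) L y p = 0) -> sq_sums_le y K%:C -> y p0 != 0 ->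
  exists2 k : R, 0 < k & forall r, k <= ralpha r.
Proof.
move=> yk yK y0; have K0 : 0 <= K by rewrite -lecR; apply: sq_sums_ge0 yK.
pose a := complex.Re (`|y p0| ^+ 2).
have aE : a%:C = `|y p0| ^+ 2 by rewrite RRe_real // realX // normr_real.
have a0 : 0 < a by rewrite -ltcR aE exprn_gt0 // normr_gt0.
have h r : a <= ralpha r * K.
  by rewrite -lecR (rmorphM (real_complex R)) /= ralphaE aE; apply: alpha_lower yK.
have Kp : 0 < K.
  rewrite lt_def K0 andbT; apply/eqP => K00.
  by have := h 0%N; rewrite K00 mulr0 => /(lt_le_trans a0); rewrite ltxx.
by exists (a / K) => [|r]; [apply: divr_gt0 | rewrite ler_pdivrMr].
Qed.

End ProjectionLimit.

(** * The von Neumann dimension of a kernel *)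

Section KernelDimension.
Local Open Scope classical_set_scope.
Local Open Scope complex_scope.
Variables (R : realType) (G : groupType) (n : nat).
Local Notation C := R[i].
Local Notation I := 'I_n.
Implicit Types (x y v w : I -> G -> C).

(** The operators defined by letters act on functions of pairs, while
    square-summable families consist of a function for each index. *)
Definition uncur x : I * G -> C := fun p => x p.1 p.2.

Lemma l2nP x : l2n x <-> exists K : R, sq_sums_le (uncur x) K%:C.
Proof.
split=> [lx|[K xK] i]; last first.
  apply/l2P; exists K => s us.
  rewrite -(big_map (fun g => (i, g)) predT (fun p => `|uncur x p| ^+ 2)).
  by apply: xK; rewrite map_inj_uniq // => g h [].
have [K KP] := choice (fun i => (l2P (x i)).1 (lx i)).
exists (\sum_i K i) => s us; rewrite (rmorph_sum (real_complex R)) /=.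
have -> : \sum_(p <- s) `|uncur x p| ^+ 2 = \sum_i \sum_(p <- s | p.1 == i) `|uncur x p| ^+ 2.
  rewrite (exchange_big_dep xpredT) //=; apply: eq_bigr => p _.
  by rewrite (big_pred1 p.1) // => i; rewrite eq_sym.
apply: ler_sum => i _; rewrite -big_filter.
rewrite big_seq (eq_bigr (fun p => `|x i p.2| ^+ 2)); last first.
  by move=> p; rewrite mem_filter => /andP[/eqP <- _].
rewrite -big_seq -(big_map snd predT (fun g => `|x i g| ^+ 2)).
apply: KP; rewrite map_inj_in_uniq ?filter_uniq // => -[j g] [k h].
by rewrite !mem_filter /= => /andP[/eqP -> _] /andP[/eqP -> _] ->.
Qed.

(** From |a b| <= t |a|^2 + |b|^2 / t. When K is small a suitable t makes the
    bound small, which is all that is used of the Cauchy-Schwarz inequality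
    for infinite sums. *)
Lemma abs_sums_dot x v (K K' t : R) i : 0 < t ->
  sq_sums_le (uncur x) K%:C -> sq_sums_le (uncur v) K'%:C ->
  abs_sums_le (fun g => x i g * conjc (v i g)) (t * K + K' / t).
Proof.
move=> t0 xK vK s us.
apply: (@le_trans _ _ (\sum_(g <- s) (t%:C * `|x i g| ^+ 2 + t^-1%:C * `|v i g| ^+ 2))).
  apply: ler_sum => g _; rewrite normrM normcJ.
  have [a ->] : exists a : R, `|x i g| = a%:C by exists (complex.Re `|x i g|); rewrite RRe_real.
  have [b ->] : exists b : R, `|v i g| = b%:C by exists (complex.Re `|v i g|); rewrite RRe_real.
  rewrite -!(rmorphXn (real_complex R)) -!(rmorphM (real_complex R)) -(rmorphD (real_complex R)) /= lecR.
  have : 0 <= t * (a - b / t) ^+ 2 + (t * a ^+ 2 + b ^+ 2 / t).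
    have t_ge0 := ltW t0.
    apply: addr_ge0; first by apply: mulr_ge0 (sqr_ge0 _).
    by apply: addr_ge0; [apply: mulr_ge0 (sqr_ge0 _) | apply: divr_ge0 t_ge0; apply: sqr_ge0].
  have -> : t * (a - b / t) ^+ 2 + (t * a ^+ 2 + b ^+ 2 / t) = 2 * (t * a ^+ 2 + t^-1 * b ^+ 2 - a * b).
    by field; rewrite gt_eqF.
  by rewrite pmulr_rge0 // subr_ge0.
rewrite big_split /= -!mulr_sumr (rmorphD (real_complex R)) !(rmorphM (real_complex R)) /=.
have us' : uniq [seq (i, g) | g <- s] by rewrite map_inj_uniq // => g h [].
have := xK _ us'; have := vK _ us'; rewrite !big_map => h1 h2.
apply: lerD; first by rewrite ler_wpM2l // lecR ltW.
by rewrite mulrC ler_wpM2r // lecR invr_ge0 ltW.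
Qed.

Lemma l2n_dotD x y v K K' K'' : sq_sums_le (uncur x) K%:C -> sq_sums_le (uncur y) K'%:C ->
  sq_sums_le (uncur v) K''%:C -> l2n_dot (x + y) v = l2n_dot x v + l2n_dot y v.
Proof.
move=> xK yK vK; rewrite /l2n_dot -big_split /=; apply: eq_bigr => i _.
rewrite /l2_dot -(csumD (abs_sums_dot i ltr01 xK vK) (abs_sums_dot i ltr01 yK vK)).
by congr csum; apply/funext => g; rewrite -mulrDl.
Qed.

Lemma norm_l2n_dot_le x v (K K' t : R) : 0 < t ->
  sq_sums_le (uncur x) K%:C -> sq_sums_le (uncur v) K'%:C ->
  `|l2n_dot x v| <= (n%:R * (2 * (t * K + K' / t)))%:C.
Proof.
move=> t0 xK vK; apply: le_trans (ler_norm_sum _ _ _) _.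
rewrite -[X in X%:R * _]card_ord mulr_natl -sumr_const (rmorph_sum (real_complex R)) /=.
apply: ler_sum => i _; apply: le_trans (norm_csum_le (abs_sums_dot i t0 xK vK)) _.
by rewrite lecR mulrDl mul1r.
Qed.

(** Against a finitely supported vector the unordered sums are finite. *)
Lemma l2n_dot_ev (u : seq ((I * G) * C)) x v : uncur x =1 ev u -> l2n_dot x v = vdot u (uncur v).
Proof.
move=> xu; pose s := undup [seq q.1.2 | q <- u].
pose S := [seq (i, g) | i <- enum I, g <- s].
have uS : uniq S.
  by apply: allpairs_uniq; rewrite ?enum_uniq ?undup_uniq // => -[i g] [j h].
have sS : {subset map fst u <= S}.
  move=> _ /mapP[q qu ->]; apply/allpairsP; exists q.1; split.
  - by rewrite mem_enum.
  - by rewrite mem_undup; apply: map_f.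
  - exact: surjective_pairing.
rewrite (vdot_sum _ uS sS) big_allpairs_dep /l2n_dot [RHS]big_enum /=; apply: eq_bigr => i _; rewrite /l2_dot.
rewrite (csum_finsupp (undup_uniq [seq q.1.2 | q <- u])) => [|g gs].
  by apply: eq_bigr => g _; rewrite -xu.
have -> : x i g = ev u (i, g) by rewrite -xu.
rewrite ev_notin ?mul0r //; apply: contraNN gs => /mapP[q qu e].
by rewrite mem_undup; apply/mapP; exists q; rewrite // -e.
Qed.

Lemma l2n_dot_self_eq0 v K : sq_sums_le (uncur v) K%:C -> l2n_dot v v = 0 -> v = 0.
Proof.
move=> vK; have vv i := abs_sums_dot i ltr01 vK vK.
set K' := 1 * K + K / 1 in vv.
pose f i g := complex.Re (`|v i g| ^+ 2).
have fE i g : v i g * conjc (v i g) = (f i g)%:C.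
  by rewrite -sqr_normc RRe_real // realX // normr_real.
have f0 i g : 0 <= f i g by rewrite -lecR -fE -sqr_normc exprn_ge0.
have fK i : sums_le (f i) K'.
  apply: sums_le_mono (abs_sums_Re (vv i)) => g.
  by rewrite fE /= ger0_norm.
have dE i : l2_dot (v i) (v i) = (nsum (f i))%:C.
  rewrite /l2_dot /csum.
  have -> : (fun g => complex.Re (v i g * conjc (v i g))) = f i by apply/funext => g; rewrite fE.
  have -> : (fun g => complex.Im (v i g * conjc (v i g))) = (fun=> 0) by apply/funext => g; rewrite fE.
  rewrite (@rsum_finsupp _ _ (fun=> 0) [::]) // big_nil.
  have fK' : sums_le (fun g => `|f i g|) K'.
    by apply: sums_le_mono (fK i) => g; rewrite ger0_norm.
  rewrite (rsumE fK'); have -> : fpos (f i) = f i.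
    by apply/funext => g; rewrite /fpos max_l.
  have -> : fneg (f i) = fun=> 0 by apply/funext => g; rewrite /fneg max_r // oppr_le0.
  by rewrite (@nsum_finsupp _ _ (fun=> 0) [::]) // big_nil subr0.
rewrite /l2n_dot => /eqP; rewrite psumr_eq0 => [/allP h|i _]; last first.
  rewrite dE lecR; have := nsum_ge (s := [::]) (fK i) isT; by rewrite big_nil.
apply/funext => i; apply/funext => g.
have := h i (mem_index_enum i); rewrite /= dE => /eqP [e].
have := nsum_ge (s := [:: g]) (fK i) isT; rewrite big_seq1 e => fg.
have {}fg : f i g = 0 by apply/le_anti; rewrite fg f0.
by apply/eqP; rewrite -normr_eq0 -sqrf_eq0 sqr_normc fE fg.
Qed.

Variables (L : seq (letter G I C)) (c : R).
Hypothesis c_gt0 : 0 < c.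
Hypothesis c_small : c%:C * weight L ^+ 2 <= 1.

Definition letter_kernel : set (I -> G -> C) :=
  [set x | l2n x /\ forall i g, letter_op (@left_shift G) L (uncur x) (i, g) = 0].

Definition std_vec (i : I) : I -> G -> C := fun k => if k == i then @delta R G 1%g else 0.

Lemma uncur_std i : uncur (std_vec i) =1 ev [:: ((i, 1%g), 1)].
Proof.
move=> [k g]; rewrite /uncur /std_vec /ev /= big_mkcond big_seq1 /= xpair_eqE [i == k]eq_sym.
by case: eqP => _ //=; rewrite /delta eq_sym; case: eqP.
Qed.

Lemma letter_op_sub x y p : letter_op (@left_shift G) L (uncur (x - y)) p =
  letter_op (@left_shift G) L (uncur x) p - letter_op (@left_shift G) L (uncur y) p.
Proof.
by rewrite /letter_op -sumrB; apply: eq_bigr => t _; rewrite -mulrBr.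
Qed.

Lemma l2n_sub x y : l2n x -> l2n y -> l2n (x - y).
Proof.
move=> /l2nP[K xK] /l2nP[K' yK]; apply/l2nP; exists (2 * (K + K')) => s us.
apply: (@le_trans _ _ (\sum_(p <- s) 2 * (`|uncur x p| ^+ 2 + `|uncur y p| ^+ 2))).
  by apply: ler_sum => p _; rewrite -(normrN (uncur y p)); apply: sqr_normD_le.
rewrite -mulr_sumr big_split (rmorphM (real_complex R)) (rmorph_nat (real_complex R)) (rmorphD (real_complex R)) /= ler_pM2l //.
by apply: lerD; [apply: xK | apply: yK].
Qed.

Lemma letter_kernel_sub x y : letter_kernel x -> letter_kernel y -> letter_kernel (x - y).
Proof.
move=> [lx xk] [ly yk]; split; first exact: l2n_sub.
by move=> i g; rewrite letter_op_sub xk yk subrr.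
Qed.

Lemma std_l2n i : l2n (std_vec i).
Proof.
apply/l2nP; exists 1; apply: sq_sums_ext; first by move=> p; rewrite uncur_std.
apply: sq_sums_weaken (@sq_sums_ev _ _ _ [:: ((i, 1%g), 1)]).
by rewrite /vsqnorm vdot_delta /ev big_mkcond big_seq1 eqxx conjC1.
Qed.

(** The limit y of T^(2r) d is the projection of d: it lies in the kernel, and
    for v in the kernel <d - T^(2r) d, v> = 0 because T fixes v, which passes
    to the limit. *)
Lemma orth_proj_kernel i :
  orth_proj letter_kernel (std_vec i) i 1%g = (alpha_lim L c (i, 1%g))%:C /\
  letter_kernel (orth_proj letter_kernel (std_vec i)).
Proof.
have [y [yb yk y1]] := projection_limit c_gt0 c_small (i, 1%g).
pose Y : I -> G -> C := fun k g => y (k, g).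
have YE : uncur Y = y by apply/funext => -[k g].
have Yl2 : l2n Y.
  apply/l2nP; pose v0 := powT c%:C L (i, 1%g) 0.
  exists (2 * (complex.Re (vsqnorm v0) + 2 * (ralpha L c (i, 1%g) 0 - alpha_lim L c (i, 1%g)))) => s us.
  apply: (@le_trans _ _ (\sum_(p <- s) 2 * (`|ev v0 p| ^+ 2 + `|ev v0 p - y p| ^+ 2))).
    apply: ler_sum => p _; rewrite YE -{1}(subKr (ev v0 p) (y p)) -(normrN (ev v0 p - y p)).
    exact: sqr_normD_le.
  rewrite -mulr_sumr big_split (rmorphM (real_complex R)) (rmorph_nat (real_complex R)) (rmorphD (real_complex R)) /= ler_pM2l //.
  apply: lerD; last exact: (yb 0%N).
  by rewrite RRe_real ?ger0_real ?vsqnorm_ge0 //; apply: sq_sums_ev.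
have VY : letter_kernel Y by split=> // k g; rewrite YE yk.
have orth v : letter_kernel v -> l2n_dot (std_vec i - Y) v = 0.
  move=> [/l2nP[K vK] vk].
  have K0 : 0 <= K by rewrite -lecR; apply: sq_sums_ge0 vK.
  have [z zE] : exists z : R, `|l2n_dot (std_vec i - Y) v| = z%:C.
    by exists (complex.Re `|l2n_dot (std_vec i - Y) v|); rewrite RRe_real.
  apply/eqP; rewrite -normr_eq0 zE.
  have z0 : 0 <= z by rewrite -lecR -zE; apply: normr_ge0.
  suff z1 : z <= 0 by rewrite (le_anti (_ : z <= 0 <= z)) ?z0 ?z1.
  apply: eps_le => e e0.
  (* The index N and the parameter t are chosen so that both t K_1 and K / t
     are at most d, where K_1 bounds the squared norm of T^(2N) d_i - Y. *)
  pose d := e / (4 * (n%:R + 1)).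
  have d0 : 0 < d by rewrite divr_gt0 // mulr_gt0 // ltr_wpDl.
  pose t := (K + 1) / d; have t0 : 0 < t by rewrite divr_gt0 // ltr_wpDl.
  have [N NP] := alpha_lim_near c_gt0 c_small (i, 1%g) (divr_gt0 d0 (mulr_gt0 (ltr0Sn _ 1) t0)).
  have bN := NP _ (leq_addr N N).
  pose vN k g := ev (powT c%:C L (i, 1%g) (N + N)) (k, g).
  have vNE : uncur vN =1 ev (powT c%:C L (i, 1%g) (N + N)) by move=> [].
  have d1l2 : sq_sums_le (uncur (std_vec i - vN)) (vsqnorm ([:: ((i, 1%g), 1)] ++ vscale (-1) (powT c%:C L (i, 1%g) (N + N)))).
    apply: sq_sums_ext (@sq_sums_ev _ _ _ _) => -[k g]; rewrite ev_cat ev_vscale -uncur_std mulN1r.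
    by [].
  have D1 : l2n_dot (std_vec i - vN) v = 0.
    rewrite (@l2n_dot_ev ([:: ((i, 1%g), 1)] ++ vscale (-1) (powT c%:C L (i, 1%g) (N + N)))).
      rewrite vdot_cat vdot_vscale vdot_delta vdot_powT_kernel ?mulN1r ?subrr //.
        by rewrite lecR ltW.
      by move=> [k g]; apply: vk.
    by move=> [k g]; rewrite ev_cat ev_vscale -uncur_std mulN1r.
  rewrite -(RRe_real (ger0_real (vsqnorm_ge0 _))) in d1l2.
  have d2l2 : sq_sums_le (uncur (vN - Y)) (2 * (ralpha L c (i, 1%g) (N + N) - alpha_lim L c (i, 1%g)))%:C.
    by apply: sq_sums_ext (yb N) => -[k g].
  rewrite -lecR -zE (_ : std_vec i - Y = (std_vec i - vN) + (vN - Y)); last by rewrite addrA subrK.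
  rewrite (l2n_dotD d1l2 d2l2 vK) D1 add0r.
  apply: le_trans (norm_l2n_dot_le t0 d2l2 vK) _; rewrite lecR.
  set b := ralpha _ _ _ _ in bN *; set l := alpha_lim _ _ _ in bN *.
  have h1 : t * (2 * (b - l)) <= d.
    have bl : b - l <= d / (2 * t) by rewrite lerBlDl.
    have t2 : 0 < 2 * t by apply: mulr_gt0.
    by move: bl; rewrite (ler_pdivlMr _ _ t2) => h; lra.
  have h2 : K / t <= d.
    have Kp : 0 < K + 1 by lra.
    by rewrite /t invf_div mulrA (ler_pdivrMr _ _ Kp); nra.
  apply: (@le_trans _ _ (n%:R * (4 * d))); first by rewrite ler_wpM2l //; lra.
  have dn : d * (4 * (n%:R + 1)) = e.
    by rewrite /d divfK // mulf_neq0 // gt_eqF // ltr_wpDl.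
  by lra.
have proj_spec : [set y | letter_kernel y /\ forall v, letter_kernel v -> l2n_dot (std_vec i - y) v = 0] Y by split.
have -> : orth_proj letter_kernel (std_vec i) = Y.
  apply: xget_unique => // z [kz zo].
  have kd := letter_kernel_sub VY kz.
  have [/l2nP[K dK] _] := kd; have [/l2nP[K1 K1P] _] := kz.
  have sz : l2n (std_vec i - z) by apply: l2n_sub; [apply: std_l2n | case: kz].
  have sY : l2n (std_vec i - Y) by apply: l2n_sub; [apply: std_l2n | ].
  have [[K2 K2P] [K3 K3P]] := ((l2nP _).1 sz, (l2nP _).1 sY).
  have : l2n_dot (Y - z) (Y - z) = 0.
    have e : std_vec i - z = (std_vec i - Y) + (Y - z) by rewrite addrA subrK.
    by have := zo _ kd; rewrite e (l2n_dotD K3P dK dK) (orth _ kd) add0r.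
  by move=> /(l2n_dot_self_eq0 dK) /eqP; rewrite subr_eq0 => /eqP->.
by split=> //; rewrite -[LHS]/(Y i 1%g) /Y y1.
Qed.

(** The trace of a diagonal entry of the projection reads the value at the
    unit of the projection of a standard vector. *)
Lemma vN_dim_kernel : vN_dim letter_kernel = (\sum_i alpha_lim L c (i, 1%g))%:C.
Proof.
rewrite /vN_dim (rmorph_sum (real_complex R)); apply: eq_bigr => i _ /=.
rewrite /trace /op_entry -/(std_vec i).
have [<- _] := orth_proj_kernel i.
rewrite /l2_dot (@csum_finsupp _ _ _ [:: 1%g]) // => [|g].
  by rewrite big_seq1 /delta eqxx conjc1 mulr1.
by rewrite inE /delta => /negPf->; rewrite conjc0 mulr0.
Qed.

Lemma kernel_nonzero i : 0 < alpha_lim L c (i, 1%g) -> exists2 x, letter_kernel x & x <> 0.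
Proof.
move=> l0; have [e kP] := orth_proj_kernel i.
exists (orth_proj letter_kernel (std_vec i)) => // x0.
by move: e; rewrite x0 => -[e]; rewrite -e ltxx in l0.
Qed.

End KernelDimension.

(** * Comparison with the finite models *)

Section Nullity.
Local Open Scope complex_scope.
Variables (R : realType) (G : groupType) (I : finType).
Local Notation C := R[i].
Variables (L : seq (letter G I C)) (c : R).
Hypothesis c_gt0 : 0 < c.
Hypothesis c_small : c%:C * weight L ^+ 2 <= 1.

Definition sum_ralpha r : R := \sum_i ralpha L c (i, 1%g) r.

Let c_ge0 : 0 <= c%:C :> C. Proof. by rewrite lecR ltW. Qed.

Lemma sum_ralphaE r : (sum_ralpha r)%:C = \sum_i alpha c%:C L (i, 1%g) r.
Proof. by rewrite (rmorph_sum (real_complex R)); apply: eq_bigr => i _; rewrite /= ralphaE. Qed.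

Definition power_trace m (phi : G -> 'S_m) r : R :=
  complex.Re (\tr (gram_contraction c%:C (model_mx phi L) ^+ (r + r))).

Lemma power_traceE m (phi : G -> 'S_m) r :
  (power_trace phi r)%:C = \tr (gram_contraction c%:C (model_mx phi L) ^+ (r + r)).
Proof.
rewrite RRe_real // ger0_real // sumr_ge0 // => a _.
have Bw x := sqnorm_mul_model_mx phi L x.
by have /andP[] := diag_exp_itv (r + r) a Bw c_ge0 c_small.
Qed.

Lemma power_trace_transfer m (phi : G -> 'S_m) (F : seq G) r :
  phi 1%g = 1%g -> {subset window L c%:C (r + r) <= F} ->
  `|power_trace phi r - m%:R * sum_ralpha r| <= #|I|%:R * #|bad_points phi F|%:R.
Proof.
move=> phi1 sF; have := trace_transfer c_ge0 c_small phi1 sF.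
rewrite -sum_ralphaE -power_traceE => h; rewrite -lecR; apply: le_trans (le_trans h _).
  rewrite -(rmorph_nat (real_complex R) m) -(rmorphM (real_complex R)) -(rmorphB (real_complex R)) /=.
  by rewrite normc_def /= expr0n /= addr0 sqrtr_sqr.
by rewrite (rmorphM (real_complex R)) !(rmorph_nat (real_complex R)).
Qed.

Definition nullity m (phi : G -> 'S_m) : nat :=
  (#|{: I * 'I_m}| - \rank (model_mx phi L))%N.

(** The kernel contributes 1 for each of its dimensions to the trace of any
    power. *)
Lemma nullity_le_power_trace m (phi : G -> 'S_m) r :
  (nullity phi)%:R <= power_trace phi r.
Proof.
rewrite -lecR (rmorph_nat (real_complex R)) power_traceE.
have [P [s sB]] := singular_values_exist (model_mx phi L).
have Bw x := sqnorm_mul_model_mx phi L x.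
exact: trace_exp_ge sB Bw c_ge0 c_small.
Qed.

Lemma small_power (q eta : R) : 0 <= q < 1 -> 0 < eta ->
  exists N, forall r, (N <= r)%N -> q ^+ (r + r) <= eta.
Proof.
move=> /andP[q0 q1] eta0.
have : ((fun n => q ^+ n) @ \oo --> (0 : R))%classic by apply: cvg_expr; rewrite ger0_norm.
move=> /cvgrPdist_le /(_ _ eta0) [N _ NP]; exists N => r Nr.
have := NP (r + r)%N; rewrite /= sub0r normrN ger0_norm ?exprn_ge0 //; apply.
by rewrite (leq_trans Nr) // leq_addr.
Qed.

(** With at most d / t of the s in ]0, e], where d = |I| m, the trace of a
    high enough power exceeds the nullity by at most 2 d / t; the required
    power depends on c, e and t only, so it serves for all m at once. *)
Lemma power_trace_le_nullity (t : nat) (e : C) : (0 < t)%N -> 0 < e ->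
  (forall m (phi : G -> 'S_m), phi 1%g = 1%g -> forall P s,
    singular_values (model_mx phi L) P s ->
    (#|[set i | (0 < s i <= e)%R]| * t <= #|{: I * 'I_m}|)%N) ->
  exists N, forall r, (N <= r)%N -> forall m (phi : G -> 'S_m), phi 1%g = 1%g ->
    power_trace phi r <= (nullity phi)%:R + #|I|%:R * (m%:R * (2 / t%:R)).
Proof.
move=> t0 e0 few.
have eE : (complex.Re e)%:C = e by rewrite RRe_real // gtr0_real.
pose e' := Num.min (complex.Re e) (c^-1).
have e'0 : 0 < e' by rewrite lt_min invr_gt0 c_gt0 andbT -ltcR eE.
have e'e : e'%:C <= e by rewrite -eE lecR ge_min lexx.
have ce' : c * e' <= 1 by rewrite mulrC -ler_pdivlMr // div1r ge_min lexx orbT.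
have ce0 : 0 < c * e' by apply: mulr_gt0.
have tR : 0 < t%:R :> R by rewrite ltr0n.
have tV : 0 < t%:R^-1 :> R by rewrite invr_gt0.
have q01 : 0 <= 1 - c * e' < 1 by apply/andP; split; lra.
have [N NP] := small_power q01 tV.
exists N => r Nr m phi phi1.
have [P [s sB]] := singular_values_exist (model_mx phi L).
have Bw x := sqnorm_mul_model_mx phi L x.
have h := trace_exp_le_ker (e := e'%:C) (r + r) sB Bw c_ge0 c_small.
have {h} := h (_ : 0 <= e'%:C) (_ : c%:C * e'%:C <= 1).
rewrite -(rmorphM (real_complex R)) /= !lecR => h.
have := h (ltW e'0) ce'; rewrite -power_traceE.
set k := #|[set i | _]| => {}h.
have kt : (k * t <= #|I| * m)%N.
  have dE : #|{: I * 'I_m}| = (#|I| * m)%N by rewrite card_prod card_ord.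
  rewrite -dE; apply: leq_trans (few m phi phi1 P s sB); rewrite leq_mul2r; apply/orP; right.
  apply: subset_leq_card; apply/fintype.subsetP => i; rewrite !inE => /andP[-> /= si].
  exact: le_trans si e'e.
have {}h : power_trace phi r <= (nullity phi)%:R + k%:R + (#|I| * m)%:R * (1 - c * e') ^+ (r + r).
  rewrite -lecR; apply: le_trans h _.
  have dE : #|{: I * 'I_m}| = (#|I| * m)%N by rewrite card_prod card_ord.
  have pE (u : R) j : ((1 - u) ^+ j)%:C = (1 - u%:C) ^+ j :> C.
    by rewrite (rmorphXn (real_complex R)) (rmorphB (real_complex R)) (rmorph1 (real_complex R)).
  have sE (x y z w : R) : (x + y + z * w)%:C = x%:C + y%:C + z%:C * w%:C :> C.
    by rewrite !(rmorphD (real_complex R)) (rmorphM (real_complex R)).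
  by rewrite -dE sE pE !(rmorph_nat (real_complex R)).
apply: le_trans h _; rewrite -addrA lerD2l.
have k_le : k%:R <= #|I|%:R * m%:R / t%:R :> R.
  by rewrite ler_pdivlMr // -!natrM ler_nat.
have q_le := NP r Nr.
have Im0 : 0 <= #|I|%:R * m%:R :> R by rewrite mulr_ge0.
rewrite natrM; have := ler_wpM2l Im0 q_le; lra.
Qed.

End Nullity.

Section RankOfConjugates.
Local Open Scope complex_scope.
Variable C : numClosedFieldType.

Lemma mxrank_mxsub_le (K : fieldType) n r (B : 'M[K]_n) (f g : 'I_r -> 'I_n) :
  (\rank (mxsub f g B) <= \rank B)%N.
Proof.
have -> : mxsub f g B = rowsub f 1%:M *m B *m (rowsub g 1%:M)^T.
  rewrite mul_rowsub_mx mul1mx; apply/matrixP => i j; rewrite !mxE (bigD1 (g j)) //=.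
  rewrite !mxE eqxx mulr1 big1 ?addr0 // => k kj.
  by rewrite !mxE eq_sym (negPf kj) mulr0.
by apply: leq_trans (mxrankM_maxl _ _) (mxrankM_maxr _ _).
Qed.

(** A nonvanishing minor of a - A is the value at a of an integer polynomial,
    which does not vanish at b either if integer polynomials that vanish at b
    also vanish at a. *)
Lemma mxrank_conjugate_le n (A : 'M[int]_n) (a b : C) :
  (forall g : {poly int}, root (map_poly intr g) b -> root (map_poly intr g) a) ->
  (\rank (a%:M - map_mx intr A)%R <= \rank (b%:M - map_mx intr A)%R)%N.
Proof.
move=> ab; have [f [g [fi gi]]] := nonzero_full_minor (a%:M - map_mx intr A).
rewrite -horner_minor_char_poly => mn0.
have {mn0} : ~~ root (map_poly intr (\det (mxsub f g (char_poly_mx A)))) b.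
  by apply: contra mn0 => /ab.
rewrite rootE horner_minor_char_poly -unitfE -[_ \is a _]/(_ \in unitmx) -row_full_unit.
rewrite /row_full => /eqP {1}<-; exact: mxrank_mxsub_le.
Qed.

End RankOfConjugates.

Section ShiftedLetters.
Local Open Scope complex_scope.
Variables (R : realType) (G : groupType) (I : finType).
Local Notation C := R[i].

(** The letters of a - A when L gives A. *)
Definition shift (a : C) (L : seq (letter G I C)) : seq (letter G I C) :=
  [seq (1%g, i, i, a) | i <- enum I] ++ map_letters -%R L.

Lemma letter_op_shift a L y p : letter_op (@left_shift G) (shift a L) y p = a * y p - letter_op (@left_shift G) L y p.
Proof.
rewrite /letter_op /shift big_cat; congr (_ + _).
  rewrite big_map big_mkcond big_enum -big_mkcond /= (big_pred1 p.1) => [|i]; last by rewrite /li /= eq_sym.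
  by rewrite /left_shift invg1 mul1g -surjective_pairing.
by rewrite [LHS]big_map -sumrN; apply: eq_bigr => t _; rewrite /lc /= mulNr.
Qed.

Lemma model_mx_shift m (phi : G -> 'S_m) a (L : seq (letter G I int)) :
  phi 1%g = 1%g ->
  model_mx phi (shift a (map_letters intr L)) = a%:M - map_mx intr (model_mx phi L).
Proof.
move=> phi1; rewrite (map_model_mx phi intr); apply/matrixP => x z.
rewrite !mxE /shift big_cat; congr (_ + _); last first.
  by rewrite [LHS]big_map -sumrN.
rewrite big_map big_mkcond big_enum /= (bigD1 (enum_val x).1) //= big1 ?addr0 => [|i ix].
  rewrite /lj /li /lg /lc /= phi1 perm1 eqxx /= -(inj_eq enum_val_inj).
  rewrite [enum_val x]surjective_pairing [enum_val z]surjective_pairing xpair_eqE.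
  by rewrite /=; case: (_ && _).
by rewrite /lj /= (negPf ix).
Qed.

Lemma weight_map_intr (L : seq (letter G I int)) : exists K : nat,
  forall m (phi : G -> 'S_m), int_bounded R K (model_mx phi L).
Proof.
have [K KP] := nat_bound (weight (map_letters (intr : int -> C) L)); exists K => m phi x.
rewrite (map_model_mx phi intr); apply: le_trans (sqnorm_mul_model_mx _ _ _) _.
rewrite ler_wpM2r ?sqnorm_ge0 //; apply: lerXn2r; rewrite ?nnegrE ?weight_ge0 //.
by rewrite -[leLHS]ger0_norm ?weight_ge0.
Qed.

Lemma small_constant (L : seq (letter G I C)) : exists c : R, 0 < c /\ c%:C * weight L ^+ 2 <= 1.
Proof.
have [K KP] := nat_bound (weight L); exists (K.+1%:R ^+ 2)^-1.
have K0 : 0 < K.+1%:R :> R by rewrite ltr0n.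
split; first by rewrite invr_gt0 exprn_gt0.
rewrite fmorphV (rmorphXn (real_complex R)) (rmorph_nat (real_complex R)) /= mulrC.
rewrite ler_pdivrMr ?exprn_gt0 ?ltr0n // mul1r; apply: lerXn2r; rewrite ?nnegrE ?weight_ge0 ?ler0n //.
rewrite -[leLHS]ger0_norm ?weight_ge0 //; apply: le_trans KP _; by rewrite ler_nat.
Qed.

End ShiftedLetters.

Lemma subset_catl (T : eqType) (s1 s2 : seq T) : {subset s1 <= s1 ++ s2}.
Proof. by move=> x xs; rewrite mem_cat xs. Qed.

Lemma subset_catr (T : eqType) (s1 s2 : seq T) : {subset s2 <= s1 ++ s2}.
Proof. by move=> x xs; rewrite mem_cat xs orbT. Qed.

Section LimitOfTraces.
Local Open Scope complex_scope.
Variables (R : realType) (G : groupType) (I : finType).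
Local Notation C := R[i].
Variables (L : seq (letter G I C)) (c : R).
Hypothesis c_gt0 : 0 < c.
Hypothesis c_small : c%:C * weight L ^+ 2 <= 1.

Definition sum_alpha_lim : R := \sum_i alpha_lim L c (i, 1%g).

Lemma sum_alpha_lim_le r : sum_alpha_lim <= sum_ralpha L c r.
Proof. by apply: ler_sum => i _; apply: alpha_lim_le. Qed.

(** Finitely many limits are approached simultaneously. *)
Lemma sum_ralpha_near eta : 0 < eta ->
  exists N, forall r, (N <= r)%N -> sum_ralpha L c r <= sum_alpha_lim + #|I|%:R * eta.
Proof.
move=> eta0.
have [N NP] := choice (fun i => alpha_lim_near c_gt0 c_small (i, 1%g) eta0).
exists (\max_i N i)%N => r Nr; rewrite mulr_natl -sumr_const -big_split /=.
by apply: ler_sum => i _; apply: NP; apply: leq_trans Nr; apply: leq_bigmax.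
Qed.

End LimitOfTraces.

Section Core.
Local Open Scope complex_scope.
Variables (R : realType) (G : groupType) (I : finType).
Local Notation C := R[i].
Hypothesis sofG : sofic R G.
Variable LZ : seq (letter G I int).
Local Notation LA := (map_letters (intr : int -> C) LZ).

(** Left convolution commutes with right translations; this moves a point
    where an eigenvector does not vanish to the unit. *)
Lemma letter_op_translate (L : seq (letter G I C)) y h p :
  letter_op (@left_shift G) L (fun q => y (q.1, (q.2 * h)%g)) p = letter_op (@left_shift G) L y (p.1, (p.2 * h)%g).
Proof. by rewrite /letter_op; apply: eq_bigr => t _; rewrite /= /left_shift mulgA. Qed.

Lemma sq_sums_translate (y : I * G -> C) h K :
  sq_sums_le y K -> sq_sums_le (fun q => y (q.1, (q.2 * h)%g)) K.
Proof.
move=> yK s us.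
rewrite -(big_map (fun q => (q.1, (q.2 * h)%g)) predT (fun q => `|y q| ^+ 2)).
by apply: yK; rewrite map_inj_uniq // => -[i g] [j k] [-> /mulIg ->].
Qed.

(** An eigenvector keeps alpha above some k > 0, so in a good finite model the
    normalised trace of the power of T is at least about k. If a were not an
    algebraic integer, few of the s would lie in [0, e] and the trace would be
    at most 3 |I| m / t; with a transfer error of |I| m / t this is impossible
    when 4 |I| < k t. *)
Theorem eigenvalue_integral (a : C) (y : I * G -> C) (K : R) p :
  (forall q, letter_op (@left_shift G) LA y q = a * y q) -> sq_sums_le y K%:C -> y p != 0 ->
  integralOver (intr : int -> C) a.
Proof.
case: p => i0 h ya yK yp; apply: contrapT => a_nint.
pose L := shift a LA; have [c [c0 cs]] := small_constant L.
pose y' q := y (q.1, (q.2 * h)%g).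
have y'k q : letter_op (@left_shift G) L y' q = 0.
  by rewrite letter_op_shift letter_op_translate ya subrr.
have y'0 : y' (i0, 1%g) != 0 by rewrite /y' /= mul1g.
have [k k0 kP] := ralpha_lower c0 y'k (sq_sums_translate h yK) y'0.
(* The nullity, the two parts of the excess of the trace over it, and the bad
   points cost |I| m / t each. *)
pose t := (Num.bound (4 * #|I|%:R / k)).+1.
have tk : 4 * #|I|%:R < k * t%:R.
  rewrite [ltRHS]mulrC -ltr_pdivrMr //.
  apply: lt_trans (archi_boundP _) _; last by rewrite ltr_nat.
  by rewrite divr_ge0 ?mulr_ge0 // ltW.
have tR : 0 < t%:R :> R by rewrite ltr0n.
have [K1 K1P] := weight_map_intr R LZ.
have [e e0 few] := few_small_singular_values_off_integers K1 a_nint (ltn0Sn _ : (0 < t)%N).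
have few0 m (phi : G -> 'S_m) : phi 1%g = 1%g -> forall P s,
    singular_values (model_mx phi L) P s ->
    (#|[set i | (s i <= e)%R]| * t <= #|{: I * 'I_m}|)%N.
  by move=> phi1 P s; rewrite /L model_mx_shift //; apply/few/K1P.
have few1 m (phi : G -> 'S_m) : phi 1%g = 1%g -> forall P s,
    singular_values (model_mx phi L) P s ->
    (#|[set i | (0 < s i <= e)%R]| * t <= #|{: I * 'I_m}|)%N.
  move=> phi1 P s sB; apply: leq_trans (few0 m phi phi1 P s sB).
  rewrite leq_mul2r; apply/orP; right.
  by apply: subset_leq_card; apply/fintype.subsetP => i; rewrite !inE => /andP[].
have [N NP] := power_trace_le_nullity c0 cs (ltn0Sn _ : (0 < t)%N) e0 few1.
have tV0 : 0 < t%:R^-1 :> R by rewrite invr_gt0.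
have [m [phi [m0 phi1 bad]]] := sofic_good_points sofG (window L c%:C (N + N)) tV0.
have tr_up := NP N (leqnn _) m phi phi1.
have := power_trace_transfer c0 cs phi1 (fun g (H : g \in window L c%:C (N + N)) => H).
have null : (nullity L phi)%:R * t%:R <= #|I|%:R * m%:R :> R.
  rewrite -!natrM ler_nat.
  have [P [s sB]] := singular_values_exist (model_mx phi L).
  have dE : #|{: I * 'I_m}| = (#|I| * m)%N by rewrite card_prod card_ord.
  rewrite -dE; apply: leq_trans (few0 m phi phi1 P s sB).
  rewrite /nullity -(card_zero_singular sB) leq_mul2r; apply/orP; right.
  by apply: subset_leq_card; apply/fintype.subsetP => i; rewrite !inE => /eqP->; rewrite ltW.
rewrite ler_norml => /andP[tr_low _].
have k_le : k <= sum_ralpha L c N.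
  apply: le_trans (kP N) _; rewrite /sum_ralpha (bigD1 i0) //= lerDl.
  by apply: sumr_ge0 => i _; apply: ralpha_ge0.
have mR : 0 < m%:R :> R by rewrite ltr0n.
have m_k : m%:R * k <= m%:R * sum_ralpha L c N by rewrite ler_wpM2l.
have I0 : 0 <= #|I|%:R :> R by [].
have {}bad := ler_wpM2l I0 bad.
have tV : t%:R^-1 * t%:R = 1 :> R by rewrite mulVf // gt_eqF.
have : m%:R * k * t%:R <= 4 * #|I|%:R * m%:R.
  have h1 : m%:R * k <= (nullity L phi)%:R + #|I|%:R * (m%:R * (2 / t%:R)) + #|I|%:R * (t%:R^-1 * m%:R) by lra.
  have := ler_wpM2r (ltW tR) h1.
  have -> : ((nullity L phi)%:R + #|I|%:R * (m%:R * (2 / t%:R)) + #|I|%:R * (t%:R^-1 * m%:R)) * t%:R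
      = (nullity L phi)%:R * t%:R + 3 * (#|I|%:R * m%:R) * (t%:R^-1 * t%:R) :> R by ring.
  by rewrite tV mulr1; move: null; lra.
rewrite -mulrA [leRHS]mulrC ler_pM2l //; lra.
Qed.

Lemma nullity_conjugate (a b : C) m (phi : G -> 'S_m) : phi 1%g = 1%g ->
  (forall g : {poly int}, root (map_poly intr g) a = root (map_poly intr g) b) ->
  nullity (shift a LA) phi = nullity (shift b LA) phi.
Proof.
move=> phi1 ab; rewrite /nullity !model_mx_shift //; congr (_ - _)%N.
by apply/eqP; rewrite eqn_leq !mxrank_conjugate_le // => g; rewrite ab.
Qed.

(** In a finite model that is good for both numbers, up to errors of order
    |I| / t, the limit at a is at most the normalised trace at a, which is at
    most the normalised nullity at a, by the bound on the number of s in ]0,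
    e]. The nullity at b is the same and bounds the normalised trace at b from
    below, which is close to the limit at b. There are five error terms
    |I| / t: one for each of the two comparisons with the finite model, two
    for the excess over the nullity at a, and one for the distance to the
    limit at b. *)
Lemma sum_alpha_lim_conjugate_le (a b : C) (ca cb : R) :
  0 < ca -> 0 < cb ->
  ca%:C * weight (shift a LA) ^+ 2 <= 1 -> cb%:C * weight (shift b LA) ^+ 2 <= 1 ->
  integralOver (intr : int -> C) a ->
  (forall g : {poly int}, root (map_poly intr g) a = root (map_poly intr g) b) ->
  sum_alpha_lim (shift a LA) ca <= sum_alpha_lim (shift b LA) cb.
Proof.
move=> ca0 cb0 cas cbs [P mP Pa] ab.
set La := shift a LA in cas *; set Lb := shift b LA in cbs *.
have [K KP] := weight_map_intr R LZ.
rewrite -subr_le0; apply: eps_le => eta eta0.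
pose t := (Num.bound ((5 * #|I|%:R) / eta)).+1.
have teta : 5 * #|I|%:R <= eta * t%:R.
  rewrite [leRHS]mulrC -ler_pdivrMr //; apply/ltW.
  apply: lt_trans (archi_boundP _) _; last by rewrite ltr_nat.
  by rewrite divr_ge0 ?mulr_ge0 // ltW.
have tR : 0 < t%:R :> R by rewrite ltr0n.
have tV0 : 0 < t%:R^-1 :> R by rewrite invr_gt0.
have tV : t%:R^-1 * t%:R = 1 :> R by rewrite mulVf // gt_eqF.
have [e e0 few] := few_small_singular_values_at_integer K mP Pa t.
have few1 m (phi : G -> 'S_m) : phi 1%g = 1%g -> forall P s,
    singular_values (model_mx phi La) P s ->
    (#|[set i | (0 < s i <= e)%R]| * t <= #|{: I * 'I_m}|)%N.
  by move=> phi1 U s; rewrite /La model_mx_shift //; apply/few/KP.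
have [N1 N1P] := power_trace_le_nullity ca0 cas (ltn0Sn _ : (0 < t)%N) e0 few1.
have [N2 N2P] := sum_ralpha_near cb0 cbs tV0.
pose r := maxn N1 N2.
pose F := window La ca%:C (r + r) ++ window Lb cb%:C (r + r).
have [m [phi [m0 phi1 bad]]] := sofic_good_points sofG F tV0.
have ha := N1P r (leq_maxl _ _) m phi phi1.
have hb := N2P r (leq_maxr _ _).
have Fa : {subset window La ca%:C (r + r) <= F} := @subset_catl _ _ _.
have Fb : {subset window Lb cb%:C (r + r) <= F} := @subset_catr _ _ _.
have ta := power_trace_transfer ca0 cas phi1 Fa.
have tb := power_trace_transfer cb0 cbs phi1 Fb.
rewrite ler_norml in ta; rewrite ler_norml in tb; case/andP: ta => ta _; case/andP: tb => _ tb.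
have nb := nullity_le_power_trace cb0 cbs phi r.
rewrite (nullity_conjugate phi1 ab) -/Lb in ha.
have sa := sum_alpha_lim_le La ca r.
have mR : 0 < m%:R :> R by rewrite ltr0n.
have I0 : 0 <= #|I|%:R :> R by [].
have {}bad := ler_wpM2l I0 bad.
have {}sa := ler_wpM2l (ltW mR) sa.
have {}hb := ler_wpM2l (ltW mR) hb.
set A := sum_alpha_lim La ca in sa *; set B := sum_alpha_lim Lb cb in hb *.
have h : m%:R * A <= m%:R * (B + 5 * #|I|%:R * t%:R^-1).
  have -> : m%:R * (B + 5 * #|I|%:R * t%:R^-1) = m%:R * (B + #|I|%:R * t%:R^-1) +
     #|I|%:R * (m%:R * (2 / t%:R)) + 2 * (#|I|%:R * (t%:R^-1 * m%:R)) :> R by ring.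
  move: ta tb bad ha hb nb sa; clear.
  move: (nullity _ _)%:R (power_trace La _ _ _) (power_trace Lb _ _ _) => nu ta tb.
  move: (sum_ralpha La _ _) (sum_ralpha Lb _ _) (#|bad_points _ _|%:R) => sa sb bd.
  by clear; lra.
rewrite ler_pM2l // in h; rewrite lerBlDl; apply: le_trans h _.
by rewrite lerD2l ler_pdivrMr.
Qed.

Lemma sum_alpha_lim_conjugate (a b : C) (ca cb : R) :
  0 < ca -> 0 < cb ->
  ca%:C * weight (shift a LA) ^+ 2 <= 1 -> cb%:C * weight (shift b LA) ^+ 2 <= 1 ->
  integralOver (intr : int -> C) a ->
  (forall g : {poly int}, root (map_poly intr g) a = root (map_poly intr g) b) ->
  sum_alpha_lim (shift a LA) ca = sum_alpha_lim (shift b LA) cb.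
Proof.
move=> ca0 cb0 cas cbs inta ab; have intb : integralOver (intr : int -> C) b.
  by case: inta => P mP Pa; exists P; rewrite // -ab.
apply/le_anti/andP; split; first exact: sum_alpha_lim_conjugate_le.
by apply: sum_alpha_lim_conjugate_le.
Qed.

End Core.

(** * Algebraic numbers and conjugates *)

Section Conjugates.
Variable R : realType.
Local Notation C := R[i].
Local Notation ratC := (ratr : rat -> C).

Let mapM p q : map_poly ratC (p * q) = map_poly ratC p * map_poly ratC q.
Proof. exact: rmorphM. Qed.

Let mapD p q : map_poly ratC (p + q) = map_poly ratC p + map_poly ratC q.
Proof. exact: rmorphD. Qed.

Lemma min_poly_dvd (a : C) p h : is_min_poly a p ->
  root (map_poly ratC h) a -> p %| h.
Proof.
move=> [mp pa pmin] ha; have p0 := monic_neq0 mp.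
rewrite /dvdp; apply: contraT => r0.
have ra : root (map_poly ratC (h %% p)) a.
  have := congr1 (fun q => (map_poly ratC q).[a]) (divp_eq h p).
  rewrite mapD mapM hornerD hornerM (eqP ha) (eqP pa) mulr0 add0r => e.
  by apply/eqP; rewrite -e.
by have := pmin _ r0 ra; rewrite leqNgt ltn_modp p0.
Qed.

(** The minimal polynomial p of a divides every h that vanishes at a, so such
    an h vanishes at b. If h vanishes at b but not at a, then neither does
    g = gcd (p, h) vanish at a, so p / g does; minimality makes g constant,
    although g vanishes at b. *)
Lemma conjugate_root (a b : C) (h : {poly rat}) : galois_conjugate a b ->
  root (map_poly ratC h) a = root (map_poly ratC h) b.
Proof.
move=> [p minp pb]; apply/idP/idP => [ha|hb].
  have /dvdpP[q ->] := min_poly_dvd minp ha.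
  by rewrite mapM rootM pb orbT.
have [mp pa pmin] := minp; have p0 := monic_neq0 mp.
have [g gE] : exists g, g = gcdp p h by eexists.
have gb : root (map_poly ratC g) b by rewrite gE gcdp_map root_gcd pb hb.
have g0 : g != 0 by rewrite gE gcdp_eq0 negb_and p0.
have /dvdpP[u pE] : g %| p by rewrite gE dvdp_gcdl.
have /dvdpP[v hE] : g %| h by rewrite gE dvdp_gcdr.
have u0 : u != 0 by apply: contraTneq p0 => u0; rewrite pE u0 mul0r eqxx.
have [ga|nga] := boolP (root (map_poly ratC g) a).
  by rewrite hE mapM rootM ga orbT.
have ua : root (map_poly ratC u) a.
  by move: pa; rewrite pE mapM rootM (negPf nga) orbF.
have sz : (size p <= size u)%N := pmin u u0 ua.
have sg : size g = 1%N.
  rewrite pE (size_mul u0 g0) in sz.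
  have su : (0 < size u)%N by rewrite size_poly_gt0.
  have sg : (0 < size g)%N by rewrite size_poly_gt0.
  by move: (size u) (size g) su sg sz => m k; clear; lia.
have [k k0 gk] := size_poly1P _ (introT eqP sg).
by move: gb; rewrite gk map_polyC rootC (fmorph_eq0 ratC) (negPf k0).
Qed.

Lemma conjugate_int_root (a b : C) (N : int) : galois_conjugate a b ->
  forall g : {poly int}, root (map_poly intr g) (N%:~R * a) = root (map_poly intr g) (N%:~R * b).
Proof.
move=> ab g; pose h := map_poly (intr : int -> rat) g \Po (N%:~R%:P * 'X).
have hE (x : C) : root (map_poly ratC h) x = root (map_poly intr g) (N%:~R * x).
  rewrite map_comp_poly rmorphM /= map_polyC map_polyX /= !rootE horner_comp !hornerE.
  rewrite ratr_int -map_poly_comp /=; congr (_.[_] == 0).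
  by apply: eq_map_poly => z /=; rewrite ratr_int.
by rewrite -!hE; apply: conjugate_root.
Qed.

(** If q = N p is an integer polynomial with p monic of degree d and p(z) = 0,
    then N z is a root of X^d + sum over k < d of q_k N^(d-k-1) X^k. *)
Lemma integral_scale (z : C) : algebraic_number z ->
  exists2 N : int, N != 0 & algebraic_integer (N%:~R * z).
Proof.
move=> /integral_algebraic [p mp pz].
have [q [N N0 pE]] := rat_poly_scale p; exists N => //.
have qN k : (q`_k)%:~R = N%:~R * p`_k :> rat.
  by rewrite pE coefZ coef_map mulrA mulfV ?mul1r // intr_eq0.
have sz_gt0 : (0 < size p)%N by rewrite size_poly_gt0 monic_neq0.
pose d := (size p).-1; have sz : size p = d.+1 by rewrite prednK.
pose P : {poly int} := 'X^d + \poly_(k < d) (q`_k * N ^+ (d - k.+1)).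
have mP : P \is monic.
  apply/monicP; rewrite lead_coefDl ?lead_coefXn // size_polyXn ltnS.
  exact: size_poly.
exists P => //.
have NC : N%:~R != 0 :> C by rewrite intr_eq0.
have pz0 : z ^+ d + \sum_(k < d) ratC p`_k * z ^+ k = 0.
  have /eqP := pz; rewrite horner_coef size_map_poly sz big_ord_recr /= addrC => e.
  rewrite -[RHS]e coef_map /=; have -> : p`_d = 1.
    by have := monicP mp; rewrite lead_coefE.
  by rewrite rmorph1 mul1r; congr (_ + _); apply: eq_bigr => k _; rewrite coef_map.
rewrite rootE /P rmorphD /= hornerD map_polyXn hornerXn.
rewrite (@horner_coef_wide _ d) => [|]; last first.
  by apply: leq_trans (size_poly _ _) _; apply: size_poly.
have -> : (N%:~R * z) ^+ d + \sum_(k < d) (map_poly intr (\poly_(k < d) (q`_k * N ^+ (d - k.+1))))`_k * (N%:~R * z) ^+ k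
   = N%:~R ^+ d * (z ^+ d + \sum_(k < d) ratC p`_k * z ^+ k).
  rewrite mulrDr exprMn; congr (_ + _); rewrite mulr_sumr; apply: eq_bigr => k _.
  rewrite coef_map /= coef_poly ltn_ord rmorphM rmorphXn /= exprMn.
  have -> : (q`_k)%:~R = N%:~R * ratC p`_k.
    by rewrite -(ratr_int C (q`_k)) qN rmorphM /= ratr_int.
  have -> : N%:~R ^+ d = N%:~R * N%:~R ^+ (d - k.+1) * N%:~R ^+ k :> C.
    by rewrite -exprS -exprD; congr (_ ^+ _); have := ltn_ord k; lia.
  ring.
by rewrite pz0 mulr0.
Qed.

Lemma integral_int (N : int) : algebraic_integer (N%:~R : C).
Proof. exact: (integral_id intr N). Qed.

Lemma integral_scale_seq (zs : seq C) : (forall z, z \in zs -> algebraic_number z) ->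
  exists2 N : int, N != 0 & forall z, z \in zs -> algebraic_integer (N%:~R * z).
Proof.
elim: zs => [|z zs IH] alg; first by exists 1.
have [|N N0 NP] := IH; first by move=> w wz; apply: alg; rewrite inE wz orbT.
have [M M0 MP] := integral_scale (alg z (mem_head _ _)).
exists (N * M); first by rewrite mulf_neq0.
move=> w; rewrite inE rmorphM /= => /orP[/eqP->|/NP h].
  by rewrite -mulrA; apply: integral_mul => //; apply: integral_int.
by rewrite mulrAC mulrC; apply: integral_mul => //; apply: integral_int.
Qed.

Lemma rational_scale_seq (zs : seq C) : (forall z, z \in zs -> exists q : rat, z = ratr q) ->
  exists2 N : int, N != 0 & forall z, z \in zs -> exists k : int, N%:~R * z = k%:~R.
Proof.
elim: zs => [|z zs IH] rt; first by exists 1.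
have [|N N0 NP] := IH; first by move=> w wz; apply: rt; rewrite inE wz orbT.
have [q ->] := rt z (mem_head _ _).
exists (N * denq q); first by rewrite mulf_neq0 // denq_eq0.
move=> w; rewrite inE rmorphM /= => /orP[/eqP->|/NP[k h]].
  exists (N * numq q); rewrite rmorphM -mulrA /=; congr (_ * _).
  rewrite -(ratr_int C (denq q)) -(ratr_int C (numq q)) -rmorphM /=; congr ratr.
  by rewrite numqE mulrC.
by exists (k * denq q); rewrite mulrAC h rmorphM.
Qed.

Lemma algebraic_of_scaled (N : int) (a : C) : N != 0 ->
  algebraic_integer (N%:~R * a) -> algebraic_number a.
Proof.
move=> N0 [P mP Pa]; have NC : N%:~R != 0 :> C by rewrite intr_eq0.
have aN : algebraic_number (N%:~R * a).
  exists (map_poly intr P); first by rewrite monic_neq0 // monic_map.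
  rewrite -map_poly_comp; congr (root _ _ = true): Pa; apply: eq_map_poly => z /=.
  by rewrite ratr_int.
have -> : a = ratC (N%:~R)^-1 * (N%:~R * a) by rewrite fmorphV /= ratr_int mulKf.
by apply: algebraic_mul => //; apply: algebraic_id.
Qed.

(** By induction the monomials in the elements of zs, with exponents below the
    degrees of the monic polynomials they satisfy, span a group stable under
    multiplication by each z. In the basis of monomials multiplication by z is
    an integer matrix Z z, and the vector w of the values of the monomials is
    a common eigenvector. *)
Lemma common_integral_module (zs : seq C) : (forall z, z \in zs -> algebraic_integer z) ->
  exists (J : finType) (w : J -> C) (Z : C -> J -> J -> int),
    (exists s, w s != 0) /\
    forall z, z \in zs -> forall s, \sum_s' (Z z s s')%:~R * w s' = z * w s.
Proof.
elim: zs => [|z0 zs IH] int_zs.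
  by exists unit, (fun=> 1), (fun _ _ _ => 0); split=> //; exists tt; rewrite oner_eq0.
have [|J [w [Z [[s0 w0] ZP]]]] := IH; first by move=> z zz; apply: int_zs; rewrite inE zz orbT.
have [P mP Pz0] := int_zs z0 (mem_head _ _).
have sz_gt0 : (0 < size P)%N by rewrite size_poly_gt0 monic_neq0.
pose d := (size P).-1; have sz : size P = d.+1 by rewrite prednK.
have rel : z0 ^+ d = - \sum_(k < d) (P`_k)%:~R * z0 ^+ k.
  have /eqP := Pz0; rewrite horner_coef size_map_inj_poly //; last exact: intr_inj.
  rewrite sz big_ord_recr /= coef_map /=; have -> : P`_d = 1.
    by have := monicP mP; rewrite lead_coefE.
  rewrite mul1r => /eqP; rewrite addrC addr_eq0 => /eqP ->; congr (- _).
  by apply: eq_bigr => k _; rewrite coef_map.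
have d_gt0 : (0 < d)%N.
  rewrite lt0n; apply/eqP => d0; have := rel; rewrite d0 expr0 => /eqP.
  move: rel; rewrite d0 big_ord0 oppr0 => e; by rewrite oner_eq0.
pose w' (p : J * 'I_d) := w p.1 * z0 ^+ p.2.
(* The companion matrix of P: multiplication by z0 on the powers of z0. *)
pose c0 (k k' : 'I_d) : int := if (k.+1 < d)%N then (k' == k.+1 :> nat)%:R else - P`_k'.
(* A new z0 acts on the new factor, the other numbers on the old one. *)
pose Z' z (p p' : J * 'I_d) : int :=
  if z == z0 then (p.1 == p'.1)%:R * c0 p.2 p'.2 else Z z p.1 p'.1 * (p.2 == p'.2)%:R.
exists (J * 'I_d)%type, w', Z'; split.
  by exists (s0, Ordinal d_gt0); rewrite /w' /= expr0 mulr1.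
move=> z zin [s k].
rewrite -(pair_bigA _ (fun s' k' => (Z' z (s, k) (s', k'))%:~R * w' (s', k'))) /=.
rewrite /Z' /w' /=; case: eqP => [->|zne].
  rewrite (bigD1 s) //= [X in _ + X]big1 ?addr0 => [|s' /negPf s'ne]; last first.
    by rewrite big1 // => k' _; rewrite eq_sym s'ne mul0r mul0r.
  under eq_bigr do rewrite eqxx mul1r mulrCA.
  rewrite -mulr_sumr [RHS]mulrCA; congr (_ * _); rewrite /c0.
  have [kd|kd] := ltnP k.+1 d.
    rewrite (bigD1 (Ordinal kd)) //= big1 => [|k' k'ne].
      by rewrite eqxx mul1r addr0 exprS.
    by rewrite (_ : (k' == k.+1 :> nat) = false) ?mul0r //; apply: contraNF k'ne => /eqP e; apply/eqP/val_inj.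
  have kE : k.+1 = d by apply/eqP; rewrite eqn_leq kd (ltn_ord k).
  rewrite -exprS kE rel -sumrN; apply: eq_bigr => k' _.
  by rewrite rmorphN mulNr.
have zzs : z \in zs by move: zin; rewrite inE => /orP[/eqP//|].
rewrite mulrA -(ZP z zzs s) mulr_suml; apply: eq_bigr => s' _.
rewrite (bigD1 k) //= big1 => [|k' /negPf k'ne].
  by rewrite eqxx mulr1 addr0 mulrA.
by rewrite eq_sym k'ne mulr0 mul0r.
Qed.

End Conjugates.

(** * Operators given by matrices over the group ring *)

Section Reductions.
Local Open Scope complex_scope.
Variables (R : realType) (G : groupType) (I : finType).
Local Notation C := R[i].
Hypothesis sofG : sofic R G.

Definition coefs (K : Type) (L : seq (letter G I K)) : seq K := [seq lc t | t <- L].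

Lemma letter_op_scale (N : C) (L : seq (letter G I C)) y p :
  letter_op (@left_shift G) (map_letters ( *%R N) L) y p = N * letter_op (@left_shift G) L y p.
Proof. by rewrite /letter_op big_map mulr_sumr; apply: eq_bigr => t _; rewrite /lc /= mulrA. Qed.

(** Replacing each coefficient z by the integer matrix Z z turns an
    eigenvector y for coefficients z into the eigenvector y tensored with w,
    for the same eigenvalue and integer coefficients. *)
Lemma integral_eigenvalue (L : seq (letter G I C)) (a : C) (y : I * G -> C) (K : R) p :
  (forall z, z \in coefs L -> algebraic_integer z) ->
  (forall q, letter_op (@left_shift G) L y q = a * y q) -> sq_sums_le y K%:C -> y p != 0 ->
  algebraic_integer a.
Proof.
move=> intL ya yK yp.
have [J [w [Z [[s0 ws0] ZP]]]] := common_integral_module intL.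
pose LZ : seq (letter G (I * J)%type int) :=
  [seq (lg t, (li t, ss.1), (lj t, ss.2), Z (lc t) ss.1 ss.2) | t <- L, ss <- enum {: J * J}].
pose y' (q : (I * J) * G) : C := y (q.1.1, q.2) * w q.1.2.
have y'a q : letter_op (@left_shift G) (map_letters intr LZ) y' q = a * y' q.
  case: q => [[i s] g]; rewrite /y' /= mulrA -ya /letter_op /map_letters big_map big_mkcond big_allpairs_dep.
  rewrite /= mulr_suml [RHS]big_mkcond big_seq [RHS]big_seq; apply: eq_bigr => t tL.
  rewrite big_enum /= -(pair_bigA _ (fun s1 s2 => if li (lg t, (li t, s1), (lj t, s2), (Z (lc t) s1 s2)%:~R : C) == (i, s)
    then lc (lg t, (li t, s1), (lj t, s2), (Z (lc t) s1 s2)%:~R : C) * (y (lj t, left_shift (lg t) g) * w s2) else 0)) /=.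
  rewrite /li /lc /= (bigD1 s) //= [X in _ + X]big1 ?addr0 => [|s1 /negPf s1s]; last first.
    by rewrite big1 // => s2 _; rewrite xpair_eqE s1s andbF.
  under eq_bigr do rewrite xpair_eqE eqxx andbT.
  case: eqP => _; last by rewrite big1.
  rewrite mulrAC -(ZP _ (map_f _ tL)) mulr_suml; apply: eq_bigr => s2 _.
  by rewrite -mulrA [w s2 * _]mulrC.
have y'p : y' ((p.1, s0), p.2) != 0 by rewrite /y' /= -surjective_pairing mulf_neq0.
(* The squared norm of the tensor product is the product of the squared norms. *)
pose W : R := \sum_s complex.Re (`|w s| ^+ 2).
apply: (eigenvalue_integral (K := K * W) sofG y'a _ y'p) => s us.
have WE : W%:C = \sum_s `|w s| ^+ 2.
  rewrite (rmorph_sum (real_complex R)); apply: eq_bigr => j _.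
  by apply: RRe_real; rewrite realX // normr_real.
rewrite (rmorphM (real_complex R)) /= WE mulr_sumr.
have -> : \sum_(q <- s) `|y' q| ^+ 2 = \sum_j \sum_(q <- s | q.1.2 == j) `|y' q| ^+ 2.
  rewrite (exchange_big_dep xpredT) //=; apply: eq_bigr => q _.
  by rewrite (big_pred1 q.1.2) // => j; rewrite eq_sym.
apply: ler_sum => j _; rewrite -big_filter.
rewrite big_seq (eq_bigr (fun q => `|y (q.1.1, q.2)| ^+ 2 * `|w j| ^+ 2)); last first.
  by move=> q; rewrite mem_filter => /andP[/eqP <- _]; rewrite /y' normrM exprMn.
rewrite -big_seq -mulr_suml ler_wpM2r ?exprn_ge0 //.
rewrite -(big_map (fun q => (q.1.1, q.2)) predT (fun q => `|y q| ^+ 2)).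
apply: yK; rewrite map_inj_in_uniq ?filter_uniq // => -[[i1 j1] g1] [[i2 j2] g2].
by rewrite !mem_filter /= => /andP[/eqP -> _] /andP[/eqP -> _] [-> ->].
Qed.

(** Some integer multiple of the operator has algebraic integers as
    coefficients. *)
Lemma algebraic_eigenvalue (L : seq (letter G I C)) (a : C) (y : I * G -> C) (K : R) p :
  (forall z, z \in coefs L -> algebraic_number z) ->
  (forall q, letter_op (@left_shift G) L y q = a * y q) -> sq_sums_le y K%:C -> y p != 0 ->
  algebraic_number a.
Proof.
move=> algL ya yK yp; have [N N0 NP] := integral_scale_seq algL.
apply: (algebraic_of_scaled N0).
apply: (integral_eigenvalue (L := map_letters ( *%R N%:~R) L) _ _ yK yp) => [z|q].
  by rewrite /coefs -map_comp => /mapP[t tL ->]; apply: NP; apply: map_f.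
by rewrite letter_op_scale ya mulrA.
Qed.

Lemma integer_letters (L : seq (letter G I C)) :
  (forall z, z \in coefs L -> exists k : int, z = k%:~R) ->
  exists LZ : seq (letter G I int), map_letters intr LZ = L.
Proof.
elim: L => [|t L IH] intL; first by exists [::].
have [|LZ LZE] := IH; first by move=> z zL; apply: intL; rewrite inE zL orbT.
have [k kE] := intL (lc t) (mem_head _ _).
exists ((lg t, li t, lj t, k) :: LZ); rewrite /= LZE /lc /= -kE.
by case: t {intL kE} => [[[h i] j] z].
Qed.

End Reductions.

Section MatrixLetters.
Local Open Scope complex_scope.
Variables (R : realType) (G : groupType) (n : nat).
Local Notation C := R[i].
Variable A : 'M[group_ring C G]_n.

Definition matrix_letters : seq (letter G 'I_n C) :=
  [seq (h, ij.1, ij.2, A ij.1 ij.2 h) | ij <- enum {: 'I_n * 'I_n}, h <- finsupp (A ij.1 ij.2)].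

Lemma letter_op_matrix_letters (x : 'I_n -> G -> C) i g :
  letter_op (@left_shift G) matrix_letters (uncur x) (i, g) = lambda A x i g.
Proof.
rewrite /letter_op /matrix_letters big_mkcond big_allpairs_dep /= big_enum /=.
rewrite -(pair_bigA _ (fun k j => \sum_(h <- finsupp (A k j)) if li (h, k, j, A k j h) == i
   then lc (h, k, j, A k j h) * uncur x (lj (h, k, j, A k j h), left_shift (lg (h, k, j, A k j h)) g) else 0)) /=.
rewrite (bigD1 i) //= [X in _ + X]big1 ?addr0 => [|k /negPf ki]; last first.
  by rewrite big1 // => j _; rewrite big1 // => h _; rewrite /li /= ki.
by apply: eq_bigr => j _; apply: eq_bigr => h _; rewrite /li /= eqxx.
Qed.

Lemma coefs_matrix_letters z : z \in coefs matrix_letters ->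
  exists g i j, z = coef_mx A g i j.
Proof.
move=> /mapP[t /allpairsPdep[ij [h [_ _ ->]]] ->].
by exists h, ij.1, ij.2; rewrite mxE.
Qed.

(** Scaling the matrix and the eigenvalue by the same N does not change the
    eigenspace; this lets rational coefficients be replaced by integers. *)
Lemma eigenspaceE (N a : C) : N != 0 ->
  lambda_eigenspace A a = letter_kernel (shift (N * a) (map_letters ( *%R N) matrix_letters)).
Proof.
move=> N0; apply/seteqP; split=> x [lx xk]; split=> // i g.
  rewrite letter_op_shift letter_op_scale letter_op_matrix_letters -mulrA -mulrBr.
  by rewrite [X in N * X](_ : _ = 0) ?mulr0 // -[RHS](xk i g).
have := xk i g; rewrite letter_op_shift letter_op_scale letter_op_matrix_letters -mulrA -mulrBr => /eqP.
by rewrite mulf_eq0 (negPf N0) => /eqP.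
Qed.

Lemma eigenvalueP (a : C) : lambda_eigenvalue A a ->
  exists (y : 'I_n * G -> C) (K : R) p, [/\ forall q, letter_op (@left_shift G) matrix_letters y q = a * y q, sq_sums_le y K%:C & y p != 0].
Proof.
move=> [x [/l2nP[K xK] xk] x0]; exists (uncur x), K.
have [p xp] : exists p, uncur x p != 0.
  apply: contrapT => no; apply: x0; apply/funext => i; apply/funext => g.
  by apply/eqP; apply: contrapT => xig; apply: no; exists (i, g); apply/negP.
exists p; split=> // -[i g]; rewrite letter_op_matrix_letters; apply/esym/eqP; rewrite -subr_eq0; apply/eqP/xk.
Qed.

End MatrixLetters.

Theorem theorem1p2 (R : realType) (G : groupType) (n : nat)
    (A : 'M[group_ring R[i] G]_n)
    (sofG : sofic R G) (n_ge1 : (1 <= n)%N)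
    (algA : forall g i j, algebraic_number (coef_mx A g i j)) :
  [/\ (forall a : R[i], lambda_eigenvalue A a -> algebraic_number a),
      ((forall g i j, algebraic_integer (coef_mx A g i j)) ->
       forall a : R[i], lambda_eigenvalue A a -> algebraic_integer a) &
      ((forall g i j, exists q : rat, coef_mx A g i j = ratr q) ->
       forall a b : R[i], lambda_eigenvalue A a -> galois_conjugate a b ->
         lambda_eigenvalue A b /\
         vN_dim (lambda_eigenspace A b) = vN_dim (lambda_eigenspace A a))].
Proof.
split=> [a /eigenvalueP[y [K [p [ya yK yp]]]] | intA a /eigenvalueP[y [K [p [ya yK yp]]]] |].
- apply: algebraic_eigenvalue ya yK yp => // z /coefs_matrix_letters[g [i [j ->]]].
  exact: algA.
- apply: integral_eigenvalue ya yK yp => // z /coefs_matrix_letters[g [i [j ->]]].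
  exact: intA.
move=> ratA a b eva ab.
have [|N N0 NP] := @rational_scale_seq R (coefs (matrix_letters A)).
  by move=> z /coefs_matrix_letters[g [i [j ->]]]; apply: ratA.
have NC : N%:~R != 0 :> R[i] by rewrite intr_eq0.
have [|LZ LZE] := @integer_letters R G 'I_n (map_letters ( *%R N%:~R) (matrix_letters A)).
  by rewrite /coefs -map_comp => z /mapP[t tL ->]; apply: NP; apply: map_f.
have [y [K [[i0 h] [ya yK yp]]]] := eigenvalueP eva.
have y'a q : letter_op (@left_shift G) (map_letters intr LZ) y q = N%:~R * a * y q.
  by rewrite LZE letter_op_scale ya mulrA.
have intNa := eigenvalue_integral sofG y'a yK yp.
have [La LaE] : exists La, La = shift (N%:~R * a) (map_letters intr LZ) by eexists.
have [Lb LbE] : exists Lb, Lb = shift (N%:~R * b) (map_letters intr LZ) by eexists.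
have Va : lambda_eigenspace A a = letter_kernel La by rewrite LaE LZE; apply: eigenspaceE.
have Vb : lambda_eigenspace A b = letter_kernel Lb by rewrite LbE LZE; apply: eigenspaceE.
have [ca [ca0 cas]] := small_constant La; have [cb [cb0 cbs]] := small_constant Lb.
have eq_dim : sum_alpha_lim La ca = sum_alpha_lim Lb cb.
  rewrite LaE LbE; apply: sum_alpha_lim_conjugate => //; rewrite -?LaE -?LbE //.
  exact: conjugate_int_root.
have dima := vN_dim_kernel ca0 cas; have dimb := vN_dim_kernel cb0 cbs.
split; last first.
  rewrite Va Vb.
  exact: etrans dimb (etrans (congr1 (real_complex R) (esym eq_dim)) (esym dima)).
(* A translate of the eigenvector for a makes the dimension at a positive; so
   is the dimension at b, and its eigenspace is nonzero. *)
pose y' q := y (q.1, (q.2 * h)%g).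
have y'k q : letter_op (@left_shift G) La y' q = 0 by rewrite LaE letter_op_shift letter_op_translate y'a subrr.
have y'0 : y' (i0, 1%g) != 0 by rewrite /y' /= mul1g.
have [k k0 kP] := ralpha_lower ca0 y'k (sq_sums_translate h yK) y'0.
have sum_gt0 : 0 < sum_alpha_lim La ca.
  apply: (lt_le_trans k0); rewrite /sum_alpha_lim (bigD1 i0 isT).
  apply: ler_wpDr; last exact: alpha_lim_ge.
  by apply: sumr_ge0 => i _; apply: alpha_lim_ge => r; apply: ralpha_ge0.
have [i li0] : exists i, 0 < alpha_lim Lb cb (i, 1%g).
  apply: contrapT => no; move: sum_gt0; rewrite eq_dim ltNge => /negP; apply.
  apply: sumr_le0 => i _; rewrite leNgt; apply/negP => li0; apply: no; by exists i.
have [x xk x0] := kernel_nonzero cb0 cbs li0.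
by exists x; [rewrite Vb | exact: x0].
Qed.
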